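(* Let $E$ and $F$ be Polish spaces. For each $x\in F$ let $P_x$ be a Markov kernel on $E$ such that for every $A\in\mathcal{B}(E)$ the map $(x,y)\mapsto P_x(y,A)$ is measurable. Let $X=(X_t)_{t\in\mathbb{Z}}$ be a stationary $F$-valued process on a probability space $(\Omega,\mathcal{A},\mathbb{P})$, and let $p\ge1$ be an integer. Assume: (A4) There exist measurable maps $V:E\to(0,\infty)$ and $\lambda,b:F^p\to(0,\infty)$ such that for all $(x_1,\ldots,x_p)\in F^p$, $$[P_{x_1}\cdots P_{x_p}]V\le \lambda(x_p,x_{p-1},\ldots,x_1)V+b(x_p,x_{p-1},\ldots,x_1),$$ with $\mathbb{E}\log^+\lambda(X_p,\ldots,X_1)<\infty$, $\mathbb{E}\log^+ b(X_p,\ldots,X_1)<\infty$, and $$\limsup_{n\to\infty}\prod_{k=0}^{n-1}\lambda\big(X_{-1-kp},\ldots,X_{-(k+1)p}\big)^{1/n}<1\quad\text{a.s.}$$ (A5) There exists a measurable $\eta:(0,\infty)\times F^p\to(0,1)$ such that for every $R>0$ there is a probability kernel $\nu_R$ from $F^p$ to $E$ with $$[P_{x_1}\cdots P_{x_p}](y,A)\ge \eta(R,x_p,\ldots,x_1)\,\nu_R(x_p,\ldots,x_1,A)$$ for all $(x_1,\ldots,x_p)\in F^p$, $y\in V^{-1}([0,R])$, $A\in\mathcal{B}(E)$. Then there exists a stationary process $((Y_t,X_t))_{t\in\mathbb{Z}}$ (with $(X_t)$ distributed as the given environment) satisfying $$\mathbb{P}\left(Y_t\in A\mid X,Y_{t-1},Y_{t-2},\ldots\right)=P_{X_{t-1}}(Y_{t-1},A),\qquad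 t\in\mathbb{Z},\ A\in\mathcal{B}(E),$$ and the distribution of such a process is unique. If in addition $(X_t)_{t\in\mathbb{Z}}$ is ergodic, then $((Y_t,X_t))_{t\in\mathbb{Z}}$ is also ergodic.
   Context: $\log^+(u)=\log(\max(u,1))$. The product of Markov kernels $R,S$ on $E$ is $RS(y,A)=\int_E R(y,dy')S(y',A)$, and $PV(y)=\int P(y,dy')V(y')$. In the conditional-distribution identity, $X$ denotes the whole sequence $(X_s)_{s\in\mathbb{Z}}$. *)

(* Defs.v *)
From HB Require Import structures.
From mathcomp Require Import all_boot all_order all_algebra.
From mathcomp Require Import all_classical all_reals all_analysis.
From mathcomp Require Import measurable_realfun.
Set Implicit Arguments. Unset Strict Implicit. Unset Printing Implicit Defensive.
Import Order.TTheory GRing.Theory Num.Theory.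
Import numFieldNormedType.Exports.
Local Open Scope classical_set_scope.
Local Open Scope ring_scope.

(* Polish space: a (pointed) complete metric space, Hausdorff (so the
   pseudometric is a metric) and separable. *)
Definition polish {R : realType} (T : completePseudoMetricType R) : Prop :=
  hausdorff_space T /\ exists D : set T, countable D /\ dense D.

Definition borel (T : ptopologicalType) := g_sigma_algebraType (@open T).

Definition logp {R : realType} (u : R) : R := ln (Num.max u 1).

Definition cyl {d} (I : Type) (T : measurableType d) : set (set (I -> T)) :=
  <<s [set S | exists i A, measurable A /\ S = (fun f : I -> T => f i) @^-1` A] >>.

Definition path_of {Om T : Type} (Z : int -> Om -> T) (w : Om) : int -> T :=
  fun t => Z t w.

Definition shift {T : Type} (f : int -> T) : int -> T := fun t => f (t + 1)%R.

Definition measurable_process {d dT} {Om : measurableType d} {T : measurableType dT}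
  (Z : int -> Om -> T) : Prop := forall t, measurable_fun setT (Z t).

Definition stationary {R : realType} {d dT} {Om : measurableType d}
  {T : measurableType dT} (Pr : probability Om R) (Z : int -> Om -> T) : Prop :=
  forall (h : int) (S : set (int -> T)), cyl S ->
    Pr ((fun w t => Z (t + h)%R w) @^-1` S) = Pr (path_of Z @^-1` S).

Definition ergodic {R : realType} {d dT} {Om : measurableType d}
  {T : measurableType dT} (Pr : probability Om R) (Z : int -> Om -> T) : Prop :=
  stationary Pr Z /\
  forall S : set (int -> T), cyl S -> S = shift @^-1` S ->
    Pr (path_of Z @^-1` S) = 0%E \/ Pr (path_of Z @^-1` S) = 1%E.

Definition same_law {R : realType} {d1 d2 dT} {Om1 : measurableType d1}
  {Om2 : measurableType d2} {T : measurableType dT}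
  (P1 : probability Om1 R) (Z1 : int -> Om1 -> T)
  (P2 : probability Om2 R) (Z2 : int -> Om2 -> T) : Prop :=
  forall S : set (int -> T), cyl S ->
    P1 (path_of Z1 @^-1` S) = P2 (path_of Z2 @^-1` S).

Fixpoint kiter {R : realType} {dE} {E : measurableType dE} {F : Type}
  (P : F -> E -> probability E R) (xs : seq F) (g : E -> \bar R) : E -> \bar R :=
  match xs with
  | [::] => g
  | x :: xs' => fun y => (\int[P x y]_z kiter P xs' g z)%E
  end.

Definition past_sigma {d dE dF} {Om : measurableType d} {E : measurableType dE}
  {F : measurableType dF} (Y : int -> Om -> E) (X : int -> Om -> F) (t : int)
  : set (set Om) :=
  <<s [set S | (exists s B, measurable B /\ S = X s @^-1` B) \/
               (exists s A, (s < t)%R /\ measurable A /\ S = Y s @^-1` A)] >>.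

Definition is_cond_prob {R : realType} {d} {Om : measurableType d}
  (Pr : probability Om R) (G : set (set Om)) (B : set Om) (f : Om -> \bar R) : Prop :=
  (forall U : set (\bar R), measurable U -> G (f @^-1` U)) /\
  (forall S, G S -> (\int[Pr]_(w in S) f w)%E = Pr (B `&` S)).

Definition solution {R : realType} {dE dF d0 d} {E : measurableType dE}
  {F : measurableType dF} (P : F -> E -> probability E R)
  {Om0 : measurableType d0} (P0 : probability Om0 R) (X0 : int -> Om0 -> F)
  {Om : measurableType d} (Pr : probability Om R)
  (Y : int -> Om -> E) (X : int -> Om -> F) : Prop :=
  [/\ measurable_process Y, measurable_process X,
      stationary Pr (fun t w => (Y t w, X t w)),
      same_law Pr X P0 X0 &
      forall (t : int) (A : set E), measurable A ->
        is_cond_prob Pr (past_sigma Y X t) (Y t @^-1` A)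
          (fun w => P (X (t - 1)%R w) (Y (t - 1)%R w) A)].

(* Main.v *)
(** Let [mu] be the law of the environment [X] on bi-infinite paths, and call Markov law a law of
    [(Y, X)] with environment marginal [mu] and transitions [P].

    Iterating the drift (A4) along blocks of [p] steps ending at time 0 bounds [V] by a random sum
    of products of the [lambda]s times [b].  This sum is finite almost surely: by the root
    condition the products decay geometrically, and by stationarity and integrability [log^+ b] is
    sublinear along the blocks.  By Poincaré recurrence almost every environment contains, in its
    past, infinitely many well separated times at which this sum and the minorization constant of
    (A5) are under control.  Between two such times the kernel product contracts a weighted
    oscillation by a fixed factor, so the chain forgets its starting point, uniformly on level sets
    of [V] and outside a set of environments of small probability.

    Hence two Markov laws under which [V(Y)] is tight along the times [-kp] coincide.  Chains
    started from a fixed point at time [-kp] converge in total variation on each finite window of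
    times, and the limit is a tight Markov law.  A stationary law is tight, which gives uniqueness;
    conversely the tight Markov law is stationary, since its shifts are again tight Markov laws.

    For ergodicity, condition a stationary Markov law on a shift-invariant event of positive
    probability.  Such an event is, up to null sets, determined by the past of any given time, so
    the transitions are unchanged; the environment marginal is still [mu], because an ergodic law
    dominates no other invariant law.  By uniqueness the conditioned law is the original one, so
    the event has probability one. *)

(* The constants in (A4) and (A5) are random and unbounded, so no single step contracts. They are
   frozen by keeping only the times where the accumulated drift is at most [i] and the minorization
   constant at least [c]. With [W = V / i], the products between separated such times all satisfy
   one Harris condition, and the oscillation weighted by [1 + c / 2 * W] shrinks by [1 - c / 8]: if
   [W y + W y' >= 8] the drift gains, otherwise both points lie in the minorized set. The
   environment then enters only through the number of such times in its past.

   The law of [Y] given [X] is never disintegrated. Transitions act on functionals of the whole path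
   [(Y, X)], redrawing one coordinate of [Y] and leaving [X] untouched; to be determined by part of
   [Y] means to be unchanged when the rest of [Y] is erased. As the chain has no first time, total
   variation yields a limit on each window only; the windows are glued by an extension theorem,
   obtained by coding both spaces by bits and sampling the bits from one uniform variable. *)
Require Import Defs.
From HB Require Import structures.
From mathcomp Require Import all_boot all_order all_algebra.
From mathcomp Require Import all_classical all_reals all_analysis.
From mathcomp Require Import measurable_realfun giry.
From mathcomp Require Import ring lra zify.
Set Implicit Arguments. Unset Strict Implicit. Unset Printing Implicit Defensive.
Import Order.TTheory GRing.Theory Num.Theory.
Import numFieldNormedType.Exports.
Local Open Scope classical_set_scope.
Local Open Scope ring_scope.

(** * Probability kernels and path spaces *)

Section image_probability.
Context d1 d2 (T1 : measurableType d1) (T2 : measurableType d2) (R : realType).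
Variables (mu : probability T1 R) (f : T1 -> T2) (mf : measurable_fun setT f).

(** The measurability proof is an explicit argument so that the structures declared below can
    recover it from the term; [bind_fun] and [pker] follow the same pattern. *)
Definition image_fun of measurable_fun setT f := fun A : set T2 => mu (f @^-1` A).

Let image0 : image_fun mf set0 = 0%E. Proof. exact: measure0. Qed.
Let image_ge0 A : (0 <= image_fun mf A)%E. Proof. exact: measure_ge0. Qed.
Let image_sigma_additive : semi_sigma_additive (image_fun mf).
Proof.
move=> A mA tA mUA; rewrite /image_fun preimage_bigcup.
apply: measure_semi_sigma_additive => [n||].
- by rewrite -[X in measurable X]setTI; exact: mf.
- apply/trivIsetP => i j _ _ ij; rewrite -preimage_setI.
  by move/trivIsetP : tA => /(_ _ _ _ _ ij) ->//; rewrite preimage_set0.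
- by rewrite -preimage_bigcup -[X in measurable X]setTI; exact: mf.
Qed.

HB.instance Definition _ := isMeasure.Build _ _ _ (image_fun mf)
  image0 image_ge0 image_sigma_additive.
Let imageT : image_fun mf setT = 1%E.
Proof. by rewrite /image_fun preimage_setT probability_setT. Qed.
HB.instance Definition _ := Measure_isProbability.Build _ _ _ (image_fun mf) imageT.

Definition image_prob : probability T2 R := image_fun mf.

Lemma integral_image (G : T2 -> \bar R) : measurable_fun setT G ->
  (forall y, 0 <= G y)%E -> (\int[image_prob]_y G y = \int[mu]_x G (f x))%E.
Proof.
move=> mG G0; transitivity (\int[pushforward mu f]_y G y)%E.
  by apply: eq_measure_integral.
by rewrite (ge0_integral_pushforward mf)// preimage_setT.
Qed.

End image_probability.

Section bind_probability.
Context d1 d2 (T1 : measurableType d1) (T2 : measurableType d2) (R : realType).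
Variables (mu : probability T1 R) (k : T1 -> probability T2 R).
Hypothesis mk : forall A, measurable A -> measurable_fun setT (fun x => k x A).

Let kg : T1 -> giry T2 R := fun x => k x.
Let mkg : measurable_fun setT kg.
Proof. exact: measurable_giry_codensity. Qed.

Definition bind_fun of (forall A, measurable A -> measurable_fun setT (fun x => k x A)) :
  set T2 -> \bar R := giry_bind (mu : giry T1 R) mkg.

HB.instance Definition _ := Measure.on (bind_fun mk).

Let bind_int (h : T2 -> \bar R) : measurable_fun setT h -> (forall x, 0 <= h x)%E ->
  (\int[bind_fun mk]_y h y = \int[mu]_x \int[k x]_y h y)%E.
Proof. exact: giry_int_bind. Qed.

Let bindE (A : set T2) : measurable A -> bind_fun mk A = (\int[mu]_x k x A)%E.
Proof.
move=> mA; rewrite -[LHS](_ : \int[bind_fun mk]_y (\1_A y)%:E = _)%E; last first.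
  by rewrite integral_indic// setIT.
rewrite bind_int//; last exact/measurable_EFinP/measurable_indic.
by apply: eq_integral => x _; rewrite integral_indic// setIT.
Qed.

Let bindT : bind_fun mk setT = 1%E.
Proof.
rewrite bindE// (eq_integral (cst 1%E)) => [|x _]; last exact: probability_setT.
by rewrite integral_cst// mul1e; exact: probability_setT.
Qed.

HB.instance Definition _ := Measure_isProbability.Build _ _ _ (bind_fun mk) bindT.

Definition bind_prob : probability T2 R := bind_fun mk.

Lemma bind_probE (A : set T2) : measurable A -> bind_prob A = (\int[mu]_x k x A)%E.
Proof. exact: bindE. Qed.

Lemma integral_bind (h : T2 -> \bar R) : measurable_fun setT h ->
  (forall x, 0 <= h x)%E ->
  (\int[bind_prob]_y h y = \int[mu]_x \int[k x]_y h y)%E.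
Proof. exact: bind_int. Qed.

End bind_probability.

Section probability_kernel.
Context d1 d2 (T1 : measurableType d1) (T2 : measurableType d2) (R : realType).
Variable k : T1 -> probability T2 R.
Hypothesis mk : forall A, measurable A -> measurable_fun setT (fun x => k x A).

Definition pker of (forall A, measurable A -> measurable_fun setT (fun x => k x A)) :
  T1 -> {measure set T2 -> \bar R} := k.

HB.instance Definition _ := isKernel.Build _ _ _ _ _ (pker mk) mk.
Let pker1 x : pker mk x setT = 1%E. Proof. exact: probability_setT. Qed.
HB.instance Definition _ := Kernel_isProbability.Build _ _ _ _ _ (pker mk) pker1.

Lemma measurable_integral_pker (h : T1 * T2 -> \bar R) :
  measurable_fun setT h -> (forall z, 0 <= h z)%E ->
  measurable_fun setT (fun x => \int[k x]_y h (x, y))%E.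
Proof.
by move=> mh h0; exact: (@measurable_fun_integral_finite_kernel _ _ _ _ _ _ (pker mk)).
Qed.

End probability_kernel.

Section path.
Context d (T : measurableType d).

Definition path := g_sigma_algebraType
  [set S : set (int -> T) | exists i A, measurable A /\ S = (fun f => f i) @^-1` A].

Lemma measurable_coord (t : int) : measurable_fun setT (fun f : path => f t).
Proof.
move=> _ A mA; rewrite setTI; apply: sub_gen_smallest.
by exists t, A.
Qed.

Lemma measurable_pathP d' (Om : measurableType d') (g : Om -> path) :
  (forall t, measurable_fun setT (fun w => g w t)) -> measurable_fun setT g.
Proof.
move=> mg.
apply: (@measurability _ _ Om path setT g [set S : set (int -> T) |
  exists i A, measurable A /\ S = (fun f => f i) @^-1` A]) => //.
move=> _ [_ [i [A [mA ->]]] <-].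
exact: (mg i).
Qed.

Definition shiftn (h : int) (f : path) : path := fun t => f (t + h).

Lemma measurable_shiftn h : measurable_fun setT (shiftn h).
Proof. by apply: measurable_pathP => t; exact: measurable_coord. Qed.

Lemma path_probability_unique (R : realType) (mu nu : probability path R)
  (G : set (set path)) :
  setI_closed G -> G `<=` measurable ->
  (forall t A, measurable A -> G ((fun f : path => f t) @^-1` A)) ->
  (forall S, G S -> mu S = nu S) -> forall S, measurable S -> mu S = nu S.
Proof.
move=> GI mG Gc munu.
apply: (@measure_unique _ _ _ G (fun=> setT)) => //.
- apply/seteqP; split.
    apply: smallest_sub; first exact: smallest_sigma_algebra.
    move=> _ [i [A [mA ->]]]; apply: sub_gen_smallest; exact: Gc.
  by apply: smallest_sub => //; exact: sigma_algebra_measurable.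
- by move=> _; rewrite (_ : setT = (fun f : path => f 0) @^-1` setT)//; exact: Gc.
- by apply/seteqP; split => // x _; exists 0%N.
- by move=> _; rewrite [X in (X < _)%E](probability_setT mu) ltry.
Qed.

End path.

(** * Markov laws in an environment *)

Section markov.
Context (R : realType) dE dF (E : measurableType dE) (F : measurableType dF)
  (P : F -> E -> probability E R).
Hypothesis mP : forall A, measurable A ->
  measurable_fun setT (fun xy : F * E => P xy.1 xy.2 A).

Local Notation Xi := (path (E * F)%type).

Definition upd (f : Xi) (t : int) (z : E) : Xi :=
  fun s => if s == t then (z, (f s).2) else f s.
(** Stands in for the sigma-algebra generated by [X] and the [Y_s] with [s] in [D]: measurability
    with respect to it becomes invariance under [restr D], which is checked pointwise. The
    environment is never erased. *)
Definition restr (D : pred int) (f : Xi) : Xi :=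
  fun s => if D s then f s else (point, (f s).2).
Definition env (f : Xi) : path F := fun s => (f s).2.
Definition depends {U : Type} (D : pred int) (G : Xi -> U) :=
  forall f, G (restr D f) = G f.

Lemma measurable_upd t : measurable_fun setT (fun fz : Xi * E => upd fz.1 t fz.2).
Proof.
apply: measurable_pathP => s; rewrite /upd; case: eqP => _.
  apply/measurable_fun_pair => //=.
  exact: (measurableT_comp measurable_snd
    (measurableT_comp (measurable_coord s) measurable_fst)).
by apply: (measurableT_comp (measurable_coord s)).
Qed.

Lemma measurable_upd2 f t : measurable_fun setT (upd f t).
Proof. exact: (measurableT_comp (measurable_upd t) (pair1_measurable f)). Qed.

Lemma measurable_restr D : measurable_fun setT (restr D).
Proof.
apply: measurable_pathP => s; rewrite /restr; case: (D s).
  exact: measurable_coord.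
apply/measurable_fun_pair => //=.
exact: (measurableT_comp measurable_snd (measurable_coord s)).
Qed.

Lemma measurable_env : measurable_fun setT env.
Proof.
apply: measurable_pathP => s.
exact: (measurableT_comp measurable_snd (measurable_coord s)).
Qed.

Lemma restrI D D' f : restr D (restr D' f) = restr (predI D D') f.
Proof. by apply/funext => s; rewrite /restr/=; case: (D s); case: (D' s). Qed.

Lemma eq_restr D D' : D =1 D' -> restr D = restr D'.
Proof. by move=> e; apply/funext => f; apply/funext => s; rewrite /restr e. Qed.

Lemma env_restr D f : env (restr D f) = env f.
Proof. by apply/funext => s; rewrite /env /restr; case: ifP. Qed.

Lemma env_upd f t z : env (upd f t z) = env f.
Proof. by apply/funext => s; rewrite /env /upd; case: ifP. Qed.

Lemma restr_upd_in (D : pred int) (f : Xi) t z : D t -> restr D (upd f t z) = upd (restr D f) t z.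
Proof.
move=> Dt; apply/funext => s; rewrite /restr /upd.
by case: eqP => [->|_]; rewrite ?Dt//; case: (D s).
Qed.

Lemma restr_upd_out (D : pred int) (f : Xi) t z : ~~ D t -> restr D (upd f t z) = restr D f.
Proof.
move=> Dt; apply/funext => s; rewrite /restr /upd.
by case: eqP => [->|//]; rewrite (negbTE Dt).
Qed.

Lemma dependsP {U : Type} (D : pred int) (G : Xi -> U) f g : depends D G -> env f = env g ->
  (forall s, D s -> (f s).1 = (g s).1) -> G f = G g.
Proof.
move=> dG efg fg; rewrite -dG -[RHS]dG; congr G; apply/funext => s.
have := congr1 (@^~ s) efg; rewrite /env /restr => es; case: ifP => [/fg|_].
  by move: es; case: (f s) => a b; case: (g s) => a' b' /= -> ->.
by rewrite es.
Qed.

Lemma dependsS {U : Type} (D D' : pred int) (G : Xi -> U) :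
  (forall s, D s -> D' s) -> depends D G -> depends D' G.
Proof.
move=> DD' dG f; apply: (dependsP dG); first exact: env_restr.
by move=> s /DD' Ds; rewrite /restr Ds.
Qed.

(** Acting on functionals of the whole path carries the environment along as a parameter, so
    conditioning on all of [X], future included, costs nothing. *)
Definition Jop (t : int) (G : Xi -> \bar R) (f : Xi) : \bar R :=
  (\int[P (f t).2 (f t).1]_z G (upd f (t + 1) z))%E.

Fixpoint Jit (s : int) (n : nat) (G : Xi -> \bar R) : Xi -> \bar R :=
  if n is n'.+1 then Jop s (Jit (s + 1) n' G) else G.

Lemma Jit_add s a b G : Jit s (a + b) G = Jit s a (Jit (s + a%:Z) b G).
Proof.
elim: a s => [|a ih] s; first by rewrite addr0.
rewrite addSn /= ih; congr (Jop _ (Jit _ _ (Jit _ _ _))).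
by rewrite -addrA -PoszD add1n.
Qed.

Let kP t (f : Xi) := P (f t).2 (f t).1.
Let mkP t A : measurable A -> measurable_fun setT (fun f => kP t f A).
Proof.
move=> mA; apply: (@measurableT_comp _ _ _ _ _ _ _ _ (fun f : Xi => ((f t).2, (f t).1))
  (mP mA)).
apply/measurable_fun_pair => /=.
  exact: (measurableT_comp measurable_snd (measurable_coord t)).
exact: (measurableT_comp measurable_fst (measurable_coord t)).
Qed.

Lemma measurable_Jop t G : measurable_fun setT G -> (forall f, 0 <= G f)%E ->
  measurable_fun setT (Jop t G).
Proof.
move=> mG G0.
apply: (@measurable_integral_pker _ _ _ _ _ _ (mkP t)
  (fun fz => G (upd fz.1 (t + 1) fz.2))) => //.
exact: (measurableT_comp mG (measurable_upd _)).
Qed.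

Lemma Jop_ge0 t G : (forall f, 0 <= G f)%E -> forall f, (0 <= Jop t G f)%E.
Proof. by move=> G0 f; exact: integral_ge0. Qed.

Lemma Jit_ge0 s n G : (forall f, 0 <= G f)%E -> forall f, (0 <= Jit s n G f)%E.
Proof. by elim: n s => //= n ih s G0; apply: Jop_ge0 => f; exact: ih. Qed.

Lemma measurable_Jit s n G : measurable_fun setT G -> (forall f, 0 <= G f)%E ->
  measurable_fun setT (Jit s n G).
Proof.
move=> mG G0; elim: n s => //= n ih s; apply: measurable_Jop => //.
by move=> f; exact: Jit_ge0.
Qed.

Lemma Jop_le1 t G : measurable_fun setT G -> (forall f, 0 <= G f <= 1)%E ->
  forall f, (Jop t G f <= 1)%E.
Proof.
move=> mG G1 f; rewrite -(@probability_setT _ _ _ (P (f t).2 (f t).1)) -[leRHS]mul1e.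
rewrite -integral_cst//; apply: ge0_le_integral => //.
- by move=> z _; have /andP[] := G1 (upd f (t + 1) z).
- exact: (measurableT_comp mG (measurable_upd2 _ _)).
- by move=> z _; have /andP[] := G1 (upd f (t + 1) z).
Qed.

Lemma Jit_le1 s n G : measurable_fun setT G -> (forall f, 0 <= G f <= 1)%E ->
  forall f, (0 <= Jit s n G f <= 1)%E.
Proof.
move=> mG G1; have G0 f : (0 <= G f)%E by have /andP[] := G1 f.
elim: n s => //= n ih s f; apply/andP; split.
  by apply: Jop_ge0 => g; exact: Jit_ge0.
by apply: Jop_le1 => // ; exact: measurable_Jit.
Qed.

(** The integral removes the coordinate [t + 1] and the kernel reads the coordinate [t]. Along an
    iteration these cancel, which leaves the initial time and the part of [D] before it. *)
Lemma depends_Jop t (D : pred int) G : depends D G ->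
  depends [pred u | (u == t) || (D u && (u != t + 1))] (Jop t G).
Proof.
move=> dG f; rewrite /Jop; set D' := [pred u | _].
have D't : D' t by rewrite /D'/= eqxx.
rewrite {1 2}/restr D't; apply: eq_integral => z _.
apply: (dependsP dG); first by rewrite !env_upd env_restr.
move=> s Ds; rewrite /upd /restr; case: eqP => [//|/eqP st].
by rewrite /D'/= Ds st orbT.
Qed.

Lemma depends_Jit s n (D : pred int) G : depends D G -> (forall u, D u -> u <= s + n%:Z) ->
  depends [pred u | (u <= s) && (D u || (u == s))] (Jit s n G).
Proof.
elim: n s => [|n ih] s dG Dn /=.
  by apply: dependsS dG => u Du /=; rewrite Du -(addr0 s) Dn.
have := @depends_Jop s _ _ (ih (s + 1) dG _).
rewrite -addrA -PoszD add1n => /(_ Dn); apply: dependsS => u /=.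
by lia.
Qed.

Definition J (t : int) (f : Xi) : probability Xi R :=
  image_prob (P (f t).2 (f t).1) (measurable_upd2 f (t + 1)).

Lemma integral_J t f G : measurable_fun setT G -> (forall g, 0 <= G g)%E ->
  (\int[J t f]_g G g = Jop t G f)%E.
Proof. by move=> mG G0; rewrite integral_image. Qed.

Lemma JE t f S : measurable S -> J t f S = Jop t (fun g => (\1_S g)%:E) f.
Proof.
move=> mS; rewrite -integral_J//; first by rewrite integral_indic// setIT.
exact/measurable_EFinP/measurable_indic.
Qed.

Lemma measurable_J t S : measurable S -> measurable_fun setT (fun f => J t f S).
Proof.
move=> mS; apply: (@eq_measurable_fun _ _ _ _ _ (Jop t (fun g => (\1_S g)%:E))).
  by move=> f _; rewrite JE.
apply: measurable_Jop => //; exact/measurable_EFinP/measurable_indic.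
Qed.

Definition step (M : probability Xi R) t : probability Xi R :=
  bind_prob M (measurable_J t).

Lemma integral_step M t G : measurable_fun setT G -> (forall g, 0 <= G g)%E ->
  (\int[step M t]_g G g = \int[M]_f Jop t G f)%E.
Proof.
move=> mG G0; rewrite integral_bind//; apply: eq_integral => f _.
exact: integral_J.
Qed.

Definition upto (t : int) : pred int := fun s => s <= t.

Definition past (M : probability Xi R) t : probability Xi R :=
  image_prob M (measurable_restr (upto t)).

(** An identity between laws rather than a conditional probability: it composes by plain integration
    and survives limits in total variation. [markov_cond] and [cond_markovP] relate it to the
    conditional form. *)
Definition markov_at (M : probability Xi R) t := forall S, measurable S ->
  past M (t + 1) S = step (past M t) t S.

Lemma integral_past M t G : measurable_fun setT G -> (forall g, 0 <= G g)%E ->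
  (\int[past M t]_f G f = \int[M]_f G (restr (upto t) f))%E.
Proof. exact: integral_image. Qed.

Lemma eq_prob_integral (M N : probability Xi R) (G : Xi -> \bar R) :
  (forall S, measurable S -> M S = N S) -> (\int[M]_f G f = \int[N]_f G f)%E.
Proof. by move=> e; apply: eq_measure_integral => S mS _; exact: e. Qed.

Lemma markov_integral M s n G :
  (forall t, s <= t -> markov_at M t) ->
  measurable_fun setT G -> (forall g, 0 <= G g)%E ->
  (\int[past M (s + n%:Z)]_f G f = \int[past M s]_f Jit s n G f)%E.
Proof.
elim: n s => [|n ih] s mM mG G0 /=; first by rewrite addr0.
have -> : s + n.+1 = s + 1 + n%:Z by rewrite -addrA -PoszD add1n.
rewrite ih//; last by move=> t st; apply: mM; lia.
rewrite (eq_prob_integral _ (mM s (lexx s))) integral_step//.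
  exact: measurable_Jit.
by move=> g; exact: Jit_ge0.
Qed.

(** The integrand on the right reads only [X] and [Y_s], so [M] enters through the joint law of
    these two. Two Markov laws in the same environment can then differ on the window only through
    [Y_s], which the chain forgets. *)
Lemma markov_integral_window M s n (D : pred int) G :
  (forall t, s <= t -> markov_at M t) ->
  (forall u, D u -> s < u <= s + n%:Z) -> depends D G ->
  measurable_fun setT G -> (forall g, 0 <= G g)%E ->
  depends (pred1 s) (Jit s n G) /\
  (\int[M]_f G f = \int[M]_f Jit s n G f)%E.
Proof.
move=> mM Dn dG mG G0.
have dJ : depends (pred1 s) (Jit s n G).
  apply: dependsS (depends_Jit dG (fun u Du => _)) => [u /=|u /Dn].
    by case/andP => us /orP[/Dn|//]; lia.
  by case/andP.
split=> //; have := @markov_integral M s n G mM mG G0.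
rewrite (integral_past _ _ mG G0).
rewrite (integral_past _ _ (measurable_Jit s n mG G0) (Jit_ge0 s n G0)) => e.
transitivity (\int[M]_f G (restr (upto (s + n%:Z)) f))%E.
  apply: eq_integral => f _; apply/esym.
  by apply: (dependsS _ dG) => u /Dn /andP[].
rewrite e; apply: eq_integral => f _.
by apply: (dependsS _ dJ) => u /= /eqP ->; rewrite /upto.
Qed.

Fixpoint seg (x : path F) (s : int) (n : nat) : seq F :=
  if n is n'.+1 then x s :: seg x (s + 1) n' else [::].

(** Once only the final coordinate is read, the path operator becomes the product of kernels along
    the environment, to which drift and minorization apply. *)
Lemma Jit_kiter s a (H : Xi -> \bar R) f : depends (pred1 (s + a%:Z)) H ->
  Jit s a H f =
  kiter P (seg (env f) s a) (fun z => H (upd f (s + a%:Z) z)) (f s).1.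
Proof.
elim: a s f => [|a ih] s f dH /=.
  rewrite addr0; congr H; apply/funext => u; rewrite /upd.
  by case: eqP => // ->; case: (f s).
rewrite /Jop; apply: eq_integral => z _.
have e : s + a.+1 = s + 1 + a%:Z by rewrite -addrA -PoszD add1n.
rewrite ih -?e// env_upd (_ : (upd f (s + 1) z (s + 1)).1 = z); last first.
  by rewrite /upd eqxx.
congr kiter; apply/funext => z'.
apply: (dependsP dH); first by rewrite !env_upd.
by move=> u /= /eqP ->; rewrite /upd eqxx.
Qed.

End markov.

(** * Contraction of products of kernels *)

Section minorization.
Local Open Scope ereal_scope.
Context d (T : measurableType d) (R : realType).
Variables (m1 m2 : {measure set T -> \bar R}).
Import HBNNSimple.

(** Holds term by term on simple functions; the integral is the supremum over the simple functions
    below [h], and dividing by [c > 0] carries the bound through that supremum. *)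
Lemma le_integral_minor (c : R) (h : T -> \bar R) : (0 < c)%R ->
  (forall A, measurable A -> c%:E * m1 A <= m2 A) -> (forall x, 0 <= h x) ->
  c%:E * \int[m1]_x h x <= \int[m2]_x h x.
Proof.
move=> c0 m12 h0; rewrite !ge0_integralTE//.
rewrite -lee_pdivlMl//; apply: ge_ereal_sup => _ [g gh <-].
rewrite lee_pdivlMl//; apply: (@le_trans _ _ (sintegral m2 g)); last first.
  by apply: ereal_sup_ubound; exists g.
rewrite !sintegralE ge0_mule_fsumr; last exact: nnsfun_mulemu_ge0.
apply: lee_fsum => // x [y _ <-]; rewrite muleCA; apply: lee_pmul => //.
- by rewrite lee_fin fun_ge0.
- by apply: mule_ge0 => //; rewrite lee_fin ltW.
- exact: m12.
Qed.

End minorization.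

(** Any [c] between all values of [u - f] and all values of [u + f] works, and the hypothesis says
    that the former lie below the latter. Weighted oscillations are carried below as distances to
    such a centre. *)
Lemma oscillation_center (R : realType) (T : pointedType) (u f : T -> R) :
  (forall y y', u y - u y' <= f y + f y') -> exists c, forall y, `|u y - c| <= f y.
Proof.
move=> uf; pose S := range (fun y => u y + f y); exists (inf S) => y.
have lbS : lbound S (u y - f y) by move=> _ [z _ <-]; have := uf y z; lra.
have h1 : u y - f y <= inf S by apply: lb_le_inf => //; exists (u point + f point), point.
have h2 : inf S <= u y + f y by apply: ge_inf; [exists (u y - f y)|exists y].
by rewrite ler_norml; lra.
Qed.

Section contraction.
Context d (T : measurableType d) (R : realType).
Variables (k : T -> probability T R) (W : T -> R) (eta : R) (nu : probability T R).
Hypotheses (mW : measurable_fun setT W) (W0 : forall y, 0 <= W y).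
Hypothesis eta01 : 0 < eta < 1.
Hypothesis drift : forall y, (\int[k y]_z (W z)%:E <= (W y / 2 + 1)%:E)%E.
Hypothesis minor : forall y A, measurable A -> W y <= 8 -> (eta%:E * nu A <= k y A)%E.

Variables (u : T -> R) (c C : R).
Hypotheses (mu : measurable_fun setT u) (u01 : forall z, 0 <= u z <= 1) (C0 : 0 <= C).
Hypothesis uc : forall z, `|u z - c| <= C * (1 + eta / 2 * W z).

Let iW y : (k y).-integrable setT (EFin \o W).
Proof.
apply/integrableP; split; first exact/measurable_EFinP.
apply: le_lt_trans (ltry (W y / 2 + 1)); apply: le_trans (drift y).
by under eq_integral do rewrite /= ger0_norm//.
Qed.

Let iu y : (k y).-integrable setT (EFin \o u).
Proof.
apply/integrableP; split; first exact/measurable_EFinP.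
apply: le_lt_trans (ltry 1); rewrite -(@probability_setT _ _ _ (k y)) -[leRHS]mul1e.
rewrite -integral_cst//; apply: ge0_le_integral => //=.
  by apply/measurable_EFinP; exact: measurableT_comp.
by move=> z _; rewrite lee_fin ger0_norm; have /andP[] := u01 z.
Qed.

Let h (s : R) z := C * (1 + eta / 2 * W z) + s * (u z - c).
Let mh s : measurable_fun setT (h s).
Proof.
apply: measurable_funD; apply: measurable_funM => //.
  by apply: measurable_funD => //; apply: measurable_funM.
exact: measurable_funB.
Qed.

Let h0 s z : s = 1 \/ s = -1 -> 0 <= h s z.
Proof. by have := uc z; rewrite ler_norml /h => /andP[? ?] [->|->]; lra. Qed.

Let Ih s y : (\int[k y]_z (h s z)%:E)%E =
  (C * (1 + eta / 2 * (\int[k y]_z W z)%R) + s * ((\int[k y]_z u z)%R - c))%:E.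
Proof.
transitivity (\int[k y]_z ((C - s * c)%:E + ((C * eta / 2)%:E * (W z)%:E + s%:E * (u z)%:E)))%E.
  by apply: eq_integral => z _; rewrite -!EFinM -!EFinD /h; congr EFin; field.
have iD1 : (k y).-integrable setT (fun z => (C * eta / 2)%:E * (W z)%:E)%E.
  exact: (integrableZl measurableT (C * eta / 2) (iW y)).
have iD2 : (k y).-integrable setT (fun z => s%:E * (u z)%:E)%E.
  exact: (integrableZl measurableT s (iu y)).
have iD : (k y).-integrable setT
    (fun z => (C * eta / 2)%:E * (W z)%:E + s%:E * (u z)%:E)%E by exact: integrableD.
rewrite integralD//=; last exact: finite_measure_integrable_cst.
rewrite integral_cst// [X in (_ * X)%E](@probability_setT _ _ _ (k y)) mule1.
rewrite (integralD measurableT iD1 iD2).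
rewrite (integralZl measurableT (iW y)) (integralZl measurableT (iu y)) /Rintegral.
rewrite -[X in (_ * X + _)%E]fineK ?(integrable_fin_num _ (iW y))//.
rewrite -[X in (_ + (_ + _ * X))%E]fineK ?(integrable_fin_num _ (iu y))//.
rewrite -!EFinM -!EFinD; congr EFin.
by move: (fine _) (fine _) => a b; field.
Qed.

(** The integrands add up to [2 C (1 + eta / 2 W)], at least [2 C]. Through the minorization this is
    the source of the gain [2 C eta]. *)
Let nuh : (\int[nu]_z (h 1 z)%:E + \int[nu]_z (h (-1) z)%:E >= (2 * C)%:E)%E.
Proof.
have mhE s : measurable_fun setT (fun z => (h s z)%:E) by exact/measurable_EFinP.
rewrite -ge0_integralD//; last 2 first.
- by move=> z _; rewrite lee_fin h0//; left.
- by move=> z _; rewrite lee_fin h0//; right.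
rewrite -[leLHS]mule1 -(@probability_setT _ _ _ nu) -integral_cst//.
apply: ge0_le_integral => //.
- by move=> z _; rewrite lee_fin mulr_ge0.
- exact: emeasurable_funD.
- move=> z _; rewrite -EFinD lee_fin /h.
  suff : 0 <= C * (eta / 2 * W z) by lra.
  by rewrite !mulr_ge0// ltW//; case/andP: eta01.
Qed.

Let Ih_minor s y : s = 1 \/ s = -1 -> W y <= 8 ->
  (eta%:E * \int[nu]_z (h s z)%:E <= \int[k y]_z (h s z)%:E)%E.
Proof.
move=> s1 Wy; apply: le_integral_minor; first by case/andP: eta01.
  by move=> A mA; exact: minor.
by move=> z; rewrite lee_fin h0.
Qed.

(** Harris' theorem with the weight of Hairer and Mattingly. As [h 1] and [h (-1)] are nonnegative,
    integrating the first against [k y'] and the second against [k y] bounds the difference of the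
    two means of [u] by the weights; the factor [1 - eta / 8] comes from the drift or from the
    minorization, according to the size of [W y + W y']. *)
Lemma contraction_step : exists c', forall y,
  `|(\int[k y]_z u z)%R - c'| <= C * (1 - eta / 8) * (1 + eta / 2 * W y).
Proof.
apply: oscillation_center => y y'; have /andP[e0 e1] := eta01.
set q := (\int[k y]_z u z)%R; set q' := (\int[k y']_z u z)%R.
pose w x := (\int[k x]_z W z)%R.
have wd x : w x <= W x / 2 + 1.
  by rewrite -lee_fin /w /Rintegral fineK ?(integrable_fin_num _ (iW x))//; exact: drift.
have I x s : s = 1 \/ s = -1 -> 0 <= C * (1 + eta / 2 * w x) + s * ((\int[k x]_z u z)%R - c).
  by move=> s1; rewrite -lee_fin -Ih; apply: integral_ge0 => z _; rewrite lee_fin h0.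
have I1 := I y (-1) (or_intror erefl); have I2 := I y' 1 (or_introl erefl).
rewrite -/q -/q' in I1 I2.
(* Let [S = W y + W y']. The drift bounds the new weight by [2 + eta S / 4 + eta], which is below
   [(1 - eta / 8) (2 + eta S / 2)] as soon as [S >= 20 / 3], because [eta < 1]. Below the threshold
   both points satisfy [W <= 8]. *)
have [Wb|Ws] := lerP 8 (W y + W y').
  have key : 2 + eta / 2 * (w y + w y') <= (1 - eta / 8) * (2 + eta / 2 * (W y + W y')).
    have ws : 0 <= (W y + W y') / 2 + 2 - (w y + w y') by have := wd y; have := wd y'; lra.
    have s8 : 0 <= W y + W y' - 8 by lra.
    move: (W y + W y') (w y + w y') ws s8 => s ws ws0 s8.
    have := mulr_ge0 (ltW e0) ws0; have := mulr_ge0 (ltW e0) s8.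
    have : 0 <= eta * (1 - eta) * s by rewrite !mulr_ge0//; lra.
    lra.
  have := ler_wpM2l C0 key; lra.
have [Wy Wy'] : W y <= 8 /\ W y' <= 8 by have := W0 y; have := W0 y'; lra.
have M1 := @Ih_minor (-1) y (or_intror erefl) Wy.
have M2 := @Ih_minor 1 y' (or_introl erefl) Wy'.
rewrite Ih in M1; rewrite Ih in M2.
(* [W] is not known to be [nu]-integrable; the minorization itself bounds the integral, by the
   finite one against the kernel divided by [eta]. *)
have nf s x : s = 1 \/ s = -1 -> W x <= 8 -> (\int[nu]_z (h s z)%:E)%E \is a fin_num.
  move=> s1 Wx; rewrite ge0_fin_numE; last first.
    by apply: integral_ge0 => z _; rewrite lee_fin h0.
  have := @Ih_minor s x s1 Wx; rewrite Ih.
  move: (\int[nu]_z (h s z)%:E)%E => [r _||//]; first by rewrite ltry.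
  by rewrite gt0_muley ?lte_fin// leye_eq.
have n1 := nf _ _ (or_intror erefl) Wy; have n2 := nf _ _ (or_introl erefl) Wy'.
move: nuh M1 M2; rewrite -(fineK n1) -(fineK n2) -EFinD -!EFinM !lee_fin -/(w y) -/(w y') -/q -/q'.
move: (fine _) (fine _) => a b ab M1 M2.
have key : 2 + eta / 2 * (w y + w y') - 2 * eta <= (1 - eta / 8) * (2 + eta / 2 * (W y + W y')).
  have ws : 0 <= (W y + W y') / 2 + 2 - (w y + w y') by have := wd y; have := wd y'; lra.
  have s0 : 0 <= W y + W y' by rewrite addr_ge0.
  move: (W y + W y') (w y + w y') ws s0 => s ws ws0 s0.
  have := mulr_ge0 (ltW e0) ws0; have := mulr_ge0 (ltW e0) s0.
  have : 0 <= eta * (1 - eta) * s by rewrite !mulr_ge0//; lra.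
  lra.
have := ler_wpM2l C0 key; have := ler_wpM2l (ltW e0) ab; nra.
Qed.

End contraction.

(** * Products of kernels as operators on functions *)

Section kiter.
Context (R : realType) dE dF (E : measurableType dE) (F : measurableType dF)
  (P : F -> E -> probability E R).
Hypothesis mP : forall A, measurable A ->
  measurable_fun setT (fun xy : F * E => P xy.1 xy.2 A).
Implicit Types (xs ys : seq F) (g : E -> \bar R).

Lemma kiter_cat xs ys g : kiter P (xs ++ ys) g = kiter P xs (kiter P ys g).
Proof.
by elim: xs => //= x xs ih; apply/funext => y; apply: eq_integral => z _; rewrite ih.
Qed.

(** [kiter] is an operator on functions; exhibiting one kernel behind it, the same for all [g],
    turns linearity, monotonicity and the bound by 1 into facts on integrals. *)
Lemma kiter_kernel xs : exists k : E -> probability E R,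
  (forall A, measurable A -> measurable_fun setT (fun y => k y A)) /\
  forall g, measurable_fun setT g -> (forall y, 0 <= g y)%E ->
    forall y, kiter P xs g y = (\int[k y]_z g z)%E.
Proof.
elim: xs => [|x xs [k [mk ik]]].
  exists (fun y => dirac y); split=> [A mA|g mg g0 y]; first exact: measurable_fun_dirac.
  by rewrite integral_dirac// diracT mul1e.
have mPx A : measurable A -> measurable_fun setT (fun y => P x y A).
  by move=> mA; exact: (measurableT_comp (mP mA) (pair1_measurable x)).
exists (fun y => bind_prob (P x y) mk); split=> [A mA|g mg g0 y].
  apply: (eq_measurable_fun (fun y => \int[P x y]_z k z A)%E).
    by move=> y _; rewrite bind_probE.
  by apply: (measurable_fun_integral_kernel (l := P x)) => //; exact: mk.
rewrite integral_bind//=; apply: eq_integral => z _; exact: ik.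
Qed.

Lemma measurable_kiter xs g : measurable_fun setT g -> (forall y, 0 <= g y)%E ->
  measurable_fun setT (kiter P xs g).
Proof.
have [k [mk ik]] := kiter_kernel xs => mg g0.
apply: (eq_measurable_fun (fun y => \int[k y]_z g z)%E).
  by move=> y _; rewrite ik.
exact: (measurable_fun_integral_kernel (l := k)).
Qed.

Lemma kiter_ge0 xs g : (forall y, 0 <= g y)%E -> forall y, (0 <= kiter P xs g y)%E.
Proof. by elim: xs => //= x xs ih g0 y; apply: integral_ge0 => z _; exact: ih. Qed.

Lemma le_kiter xs g g' : measurable_fun setT g -> (forall y, 0 <= g y)%E ->
  measurable_fun setT g' -> (forall y, g y <= g' y)%E ->
  forall y, (kiter P xs g y <= kiter P xs g' y)%E.
Proof.
have [k [mk ik]] := kiter_kernel xs => mg g0 mg' gg' y.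
have g'0 z : (0 <= g' z)%E by exact: le_trans (g0 z) (gg' z).
by rewrite !ik//; exact: ge0_le_integral.
Qed.

Lemma kiter_affine xs g (a c : R) : measurable_fun setT g -> (forall y, 0 <= g y)%E ->
  0 <= a -> 0 <= c -> forall y,
  kiter P xs (fun z => a%:E * g z + c%:E)%E y = (a%:E * kiter P xs g y + c%:E)%E.
Proof.
have [k [mk ik]] := kiter_kernel xs => mg g0 a0 c0 y.
have mag : measurable_fun setT (fun z => a%:E * g z)%E by exact: measurable_funeM.
rewrite !ik//; last 2 first.
- exact: emeasurable_funD.
- by move=> z; rewrite adde_ge0// mule_ge0// lee_fin.
rewrite ge0_integralD//; last by move=> z _; rewrite mule_ge0// lee_fin.
rewrite ge0_integralZl_EFin// integral_cst//.
by rewrite [X in (_ + _ * X)%E](@probability_setT _ _ _ (k y)) mule1.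
Qed.

Lemma kiter_cst xs (c : R) y : 0 <= c -> kiter P xs (cst c%:E) y = c%:E.
Proof.
have [k [mk ik]] := kiter_kernel xs => c0.
by rewrite ik// integral_cst// [X in (_ * X)%E](@probability_setT _ _ _ (k y)) mule1.
Qed.

Lemma kiter_le1 xs g : measurable_fun setT g -> (forall y, 0 <= g y <= 1)%E ->
  forall y, (0 <= kiter P xs g y <= 1)%E.
Proof.
move=> mg g1 y; have g0 z : (0 <= g z)%E by have /andP[] := g1 z.
rewrite kiter_ge0//= -(@kiter_cst xs 1 y)//; apply: le_kiter => // z.
by have /andP[] := g1 z.
Qed.

(** The hypotheses of [contraction_step], with [W] and [eta] common to all blocks so that the rates
    multiply; only the minorizing measure may change from block to block. *)
Definition good_list (W : E -> R) (eta : R) xs :=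
  (forall y, (kiter P xs (fun z => (W z)%:E) y <= (W y / 2 + 1)%:E)%E) /\
  exists nu : probability E R, forall y A, measurable A -> W y <= 8 ->
    (eta%:E * nu A <= kiter P xs (fun z => (\1_A z)%:E) y)%E.

Lemma contraction_iter (W : E -> R) eta (xss : seq (seq F)) (v : E -> \bar R) :
  measurable_fun setT W -> (forall y, 0 <= W y) -> 0 < eta < 1 ->
  (forall xs, xs \in xss -> good_list W eta xs) ->
  measurable_fun setT v -> (forall y, 0 <= v y <= 1)%E ->
  exists c, forall y, `|fine (kiter P (flatten xss) v y) - c| <=
    (1 - eta / 8) ^+ size xss * (1 + eta / 2 * W y).
Proof.
move=> mW W0 eta01 + mv v1; have v0 y : (0 <= v y)%E by have /andP[] := v1 y.
have e8 : 0 <= 1 - eta / 8 by lra.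
elim: xss => [_|xs xss ih good] /=.
  (* A function with values in [0, 1] lies within 1 of the centre 0, so the induction starts with
     the constant 1. *)
  exists 0 => y; rewrite expr0 mul1r subr0.
  have /andP[a b] := v1 y.
  have fv : v y \is a fin_num by rewrite ge0_fin_numE// (le_lt_trans b)// ltry.
  rewrite ger0_norm ?fine_ge0//; apply: (@le_trans _ _ 1).
    by rewrite -lee_fin fineK.
  have := W0 y; nra.
have [xs' xs'xss|c hc] := ih; first by apply: good; rewrite inE xs'xss orbT.
have [drift [nu minor]] : good_list W eta xs by apply: good; rewrite inE eqxx.
have [k [mk ik]] := kiter_kernel xs.
set u := fun z => fine (kiter P (flatten xss) v z).
have uE z : (u z)%:E = kiter P (flatten xss) v z.
  rewrite /u fineK// ge0_fin_numE; last exact: kiter_ge0.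
  by have /andP[_ /le_lt_trans->//] := kiter_le1 (flatten xss) mv v1 z; rewrite ltry.
have mu : measurable_fun setT u.
  apply/measurable_EFinP; apply: (eq_measurable_fun (kiter P (flatten xss) v)).
    by move=> z _; rewrite /= uE.
  exact: measurable_kiter.
have u01 z : 0 <= u z <= 1 by rewrite -!lee_fin uE kiter_le1.
have mWE : measurable_fun setT (fun z => (W z)%:E) by exact/measurable_EFinP.
have := @contraction_step _ _ _ k W eta nu mW W0 eta01 _ _ u c _ mu u01 _ hc.
case=> [y|y A mA Wy||c' hc'].
- by rewrite -ik//; exact: drift.
- rewrite -[leRHS](_ : (\int[k y]_z (\1_A z)%:E)%E = _); last by rewrite integral_indic// setIT.
  rewrite -ik//; first exact: minor.
  exact/measurable_EFinP/measurable_indic.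
- by rewrite exprn_ge0.
exists c' => y; have := hc' y; rewrite exprSr; congr (`|_ - _| <= _).
rewrite kiter_cat (ik _ (measurable_kiter _ mv v0) (kiter_ge0 _ v0)).
by rewrite /Rintegral; congr fine; apply: eq_integral => z _; rewrite uE.
Qed.

End kiter.

(** * Forgetting the initial state *)

Section pathwise.
Context (R : realType) dE dF (E : measurableType dE) (F : measurableType dF)
  (P : F -> E -> probability E R).
Hypothesis mP : forall A, measurable A ->
  measurable_fun setT (fun xy : F * E => P xy.1 xy.2 A).
Variables (p : nat) (V : E -> R) (L B : path F -> R).
Hypotheses (mV : measurable_fun setT V) (V0 : forall y, 0 <= V y).
Hypotheses (L0 : forall x, 0 < L x) (B1 : forall x, 1 <= B x).
Hypothesis drift : forall x y,
  (kiter P (seg x 0 p) (fun z => (V z)%:E) y <= (L x * V y + B x)%:E)%E.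

Implicit Types (x : path F).

Definition before (n : nat) x : path F := shiftn (- (n * p)%:Z) x.
(** Blocks are numbered backwards from time 0: block [j] occupies the times [-(j+1)p, ..., -jp-1],
    and [L (before j.+1 x)] is its drift factor. [prodL] and [sumB] are the two coefficients of the
    drift after running through the blocks [n+k-1, ..., n] and arriving at time [-np], see
    [blocks_drift]. *)
Definition prodL x n k := \prod_(i < k) L (before (n + i).+1 x).
Definition sumB x n k := \sum_(i < k) prodL x n i * B (before (n + i).+1 x).

Lemma seg_shiftn x h s n : seg (shiftn h x) s n = seg x (s + h) n.
Proof. by elim: n s => //= n ih s; rewrite ih addrAC. Qed.

Lemma seg_add x s m n : seg x s (m + n) = seg x s m ++ seg x (s + m%:Z) n.
Proof.
elim: m s => [|m ih] s; first by rewrite addr0.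
by rewrite addSn /= ih -addrA -PoszD add1n.
Qed.

Lemma beforeD m n x : before m (before n x) = before (n + m) x.
Proof.
apply/funext => t; rewrite /before /shiftn; congr (x _).
by rewrite mulnDl PoszD opprD -addrA [X in _ + X]addrC.
Qed.

Definition blocks x n k := seg x (- (((n + k) * p)%:Z)) (k * p).

Lemma blocks_cat x n k k' : blocks x n (k + k') = blocks x (n + k) k' ++ blocks x n k.
Proof.
rewrite /blocks (_ : ((k + k') * p = k' * p + k * p)%N); last by rewrite mulnDl addnC.
rewrite seg_add addnA; congr (_ ++ seg _ _ _).
by rewrite [((_ + k') * p)%N]mulnDl PoszD; lia.
Qed.

Lemma blocks1 x n : blocks x n 1 = seg (before n.+1 x) 0 p.
Proof. by rewrite /blocks seg_shiftn add0r addn1 mul1n. Qed.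

Lemma blocks_before x n k m : blocks (before m x) n k = blocks x (m + n) k.
Proof.
by rewrite /blocks seg_shiftn; congr seg; rewrite !mulnDl !PoszD; lia.
Qed.

Lemma prodLS x n k : prodL x n k.+1 = prodL x n k * L (before (n + k).+1 x).
Proof. by rewrite /prodL big_ord_recr. Qed.

Lemma sumBS x n k : sumB x n k.+1 = sumB x n k + prodL x n k * B (before (n + k).+1 x).
Proof. by rewrite /sumB big_ord_recr. Qed.

Lemma prodL_gt0 x n k : 0 < prodL x n k.
Proof. exact: prodr_gt0. Qed.

Lemma prodL_before x m n k : prodL (before m x) n k = prodL x (m + n) k.
Proof. by apply: eq_bigr => i _; rewrite beforeD addnS addnA. Qed.

Lemma sumB_before x m n k : sumB (before m x) n k = sumB x (m + n) k.
Proof. by apply: eq_bigr => i _; rewrite prodL_before beforeD addnS addnA. Qed.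

Lemma sumB_ge0 x n k : 0 <= sumB x n k.
Proof.
apply: sumr_ge0 => i _; rewrite mulr_ge0 ?(ltW (prodL_gt0 _ _ _))//.
exact: le_trans (B1 _).
Qed.

(** Thanks to [B >= 1] every product is dominated by a term of the sum, so bounding [sumB] alone
    controls both coefficients of the drift. *)
Lemma prodL_le_sumB x n k : prodL x n k <= sumB x n k.+1.
Proof.
rewrite sumBS; have := sumB_ge0 x n k; have := prodL_gt0 x n k.
have := B1 (before (n + k).+1 x); nra.
Qed.

Let mVE : measurable_fun setT (fun z => (V z)%:E).
Proof. exact/measurable_EFinP. Qed.
Let VE0 z : (0 <= (V z)%:E)%E. Proof. by rewrite lee_fin. Qed.

Lemma blocks_drift x n k y :
  (kiter P (blocks x n k) (fun z => (V z)%:E) y <=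
   (prodL x n k * V y + sumB x n k)%:E)%E.
Proof.
elim: k y => [|k ih] y.
  by rewrite /blocks mul0n /= /prodL /sumB !big_ord0 mul1r addr0.
rewrite -addn1 blocks_cat kiter_cat addn1.
have A0 := ltW (prodL_gt0 x n k); have S0 := sumB_ge0 x n k.
apply: (@le_trans _ _ (kiter P (blocks x (n + k) 1)
  (fun z => (prodL x n k)%:E * (V z)%:E + (sumB x n k)%:E)%E y)).
  apply: le_kiter => //.
  - exact: measurable_kiter.
  - exact: kiter_ge0.
  - by apply: emeasurable_funD => //; exact: measurable_funeM.
rewrite kiter_affine// blocks1 prodLS sumBS.
apply: (@le_trans _ _ ((prodL x n k)%:E *
  (L (before (n + k).+1 x) * V y + B (before (n + k).+1 x))%:E + (sumB x n k)%:E)%E).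
  by rewrite leeD2r// lee_wpmul2l ?lee_fin//; exact: drift.
by rewrite -EFinM -EFinD lee_fin; lra.
Qed.

Variables (i c : R) (e : path F -> R).
Hypotheses (i0 : 0 < i) (c0 : 0 < c < 1).
Hypothesis minor : forall x, exists nu : probability E R,
  forall y A, measurable A -> V y <= 8 * i ->
  ((e x)%:E * nu A <= kiter P (seg x 0 p) (fun z => (\1_A z)%:E) y)%E.

(** The two conditions look in opposite directions from time [-np]: the sum controls the arrival at
    [-np] from arbitrarily far back, the other one minorizes the block that leaves [-np]. *)
Definition good (n : nat) : set (path F) :=
  [set x | (forall k, sumB x n k <= i) /\ c <= e (before n x)].

(** The minorizing measure of the first block, pushed through the remaining ones, minorizes the
    whole stretch with the same constant. Dividing [V] by [i] turns the additive term of the drift,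
    at most [i], into 1. *)
Lemma good_listP x n k : good n x -> c <= e (before (n + k.+1) x) ->
  prodL x n k.+1 <= 2^-1 -> good_list P (fun y => V y / i) c (blocks x n k.+1).
Proof.
move=> [Si _] ce A2; have ii0 : 0 <= i^-1 by rewrite invr_ge0 ltW.
have iE z : (V z / i)%:E = ((i^-1)%:E * (V z)%:E + 0%:E)%E.
  by rewrite -EFinM -EFinD addr0 mulrC.
split.
  move=> y; under eq_fun do rewrite iE.
  rewrite kiter_affine// adde0.
  apply: (@le_trans _ _ ((i^-1)%:E * (prodL x n k.+1 * V y + sumB x n k.+1)%:E)%E).
    by rewrite lee_wpmul2l ?lee_fin//; exact: blocks_drift.
  rewrite -EFinM lee_fin mulrDr; apply: lerD.
    rewrite mulrCA [leRHS]mulrC ler_pM// ?(ltW (prodL_gt0 _ _ _))//.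
      by rewrite mulr_ge0.
    by rewrite mulrC.
  by rewrite ler_pdivrMl// mulr1.
have [nu nuP] := minor (before (n + k).+1 x).
have [k1 [mk1 ik1]] := kiter_kernel mP (blocks x n k).
exists (bind_prob nu mk1) => y A mA WA.
have [k2 [mk2 ik2]] := kiter_kernel mP (blocks x (n + k) 1).
have mA1 : measurable_fun setT (fun z => (\1_A z : R)%:E).
  exact/measurable_EFinP/measurable_indic.
rewrite -addn1 blocks_cat kiter_cat bind_probE// ik2; last 2 first.
- exact: measurable_kiter.
- exact: kiter_ge0.
rewrite (_ : \int[nu]_z k1 z A = \int[nu]_z kiter P (blocks x n k) (fun z => (\1_A z)%:E) z)%E; last first.
  by apply: eq_integral => z _; rewrite ik1// integral_indic// setIT.
apply: le_integral_minor; [by case/andP: c0| |exact: kiter_ge0] => D mD.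
apply: (@le_trans _ _ ((e (before (n + k).+1 x))%:E * nu D)%E).
  by rewrite lee_wpmul2r// lee_fin -addnS.
rewrite -[leRHS](_ : (\int[k2 y]_z (\1_D z)%:E)%E = _); last by rewrite integral_indic// setIT.
rewrite -ik2//; last exact/measurable_EFinP/measurable_indic.
by rewrite blocks1; apply: nuP => //; move: WA; rewrite ler_pdivrMr.
Qed.

(** Good times may be adjacent, and a short stretch need not halve [V]; separation is therefore
    expressed by the product over the stretch, the drift factor that [good_list] requires. The
    integer [l] counts the contracting stretches between time [-np] and time 0. *)
Fixpoint chain (l n : nat) : set (path F) :=
  if l is l'.+1 then
    [set x | good n x /\ exists2 m, (m < n)%N & chain l' m x /\ prodL x m (n - m) <= 2^-1]
  else good n.

Lemma chain_good l n x : chain l n x -> good n x.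
Proof. by case: l => //= l []. Qed.

Lemma chainP l n x : chain l n x -> exists xss m,
  [/\ size xss = l, forall xs, xs \in xss -> good_list P (fun y => V y / i) c xs,
      (m <= n)%N & blocks x 0 n = flatten xss ++ blocks x 0 m].
Proof.
elim: l n => [|l ih] n /=; first by exists [::], n.
move=> [gn [m mn [/[dup] /chain_good gm /ih[xss [m' [sx gx m'm bE]]] A2]]].
have nE : n = (m + (n - m.+1).+1)%N by lia.
exists (blocks x m (n - m.+1).+1 :: xss), m'; split => //=.
- by rewrite sx.
- move=> xs; rewrite inE => /predU1P[->|/gx//]; apply: good_listP => //.
    by rewrite -nE; case: gn.
  by move: A2; rewrite {1}nE addKn.
- by rewrite (leq_trans m'm)// ltnW.
- by rewrite {1}nE blocks_cat add0n bE catA.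
Qed.

(** The price of the initial point is paid once: the mean of [V / i] on arrival at the good time is
    bounded independently of [k], that is, of how far back the chain starts. *)
Lemma blocks_bound x n k y : good n x -> 1 <= i ->
  (kiter P (blocks x n k) (fun z => (V z / i)%:E) y <= (V y + 1)%:E)%E.
Proof.
move=> [Si _] i1.
have ii0 : 0 <= i^-1 by rewrite invr_ge0 ltW.
have iE z : (V z / i)%:E = ((i^-1)%:E * (V z)%:E + 0%:E)%E.
  by rewrite -EFinM -EFinD addr0 mulrC.
under eq_fun do rewrite iE.
rewrite kiter_affine// adde0.
apply: (@le_trans _ _ ((i^-1)%:E * (prodL x n k * V y + sumB x n k)%:E)%E).
  by rewrite lee_wpmul2l ?lee_fin//; exact: blocks_drift.
rewrite -EFinM lee_fin ler_pdivrMl// mulrDr mulr1; apply: lerD => //.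
by rewrite ler_wpM2r//; exact: le_trans (prodL_le_sumB _ _ _) _.
Qed.

Lemma chain_forget l n x v y y' k : chain l n x -> 1 <= i ->
  measurable_fun setT v -> (forall y, 0 <= v y <= 1)%E ->
  `|fine (kiter P (blocks x 0 (n + k)) v y) - fine (kiter P (blocks x 0 (n + k)) v y')| <=
  (1 - c / 8) ^+ l * (4 + V y + V y').
Proof.
have /andP[c_gt0 c_lt1] := c0.
move=> xn i1 mv v1; have v0 z : (0 <= v z)%E by have /andP[] := v1 z.
have gn := chain_good xn; have [xss [m [sx gx mn bE]]] := chainP xn.
set v' := kiter P (blocks x 0 m) v.
have mv' : measurable_fun setT v' by exact: measurable_kiter.
have v'1 z : (0 <= v' z <= 1)%E by exact: kiter_le1.
have mW : measurable_fun setT (fun y => V y / i) by exact: measurable_funM.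
have W0 z : 0 <= V z / i by rewrite divr_ge0// ltW.
have [d hd] := contraction_iter mP mW W0 c0 gx mv' v'1.
rewrite -kiter_cat -bE sx in hd.
set u := kiter P (blocks x 0 n) v in hd.
have mu : measurable_fun setT u by exact: measurable_kiter.
have u1 z : (0 <= u z <= 1)%E by exact: kiter_le1.
have u0 z : (0 <= u z)%E by have /andP[] := u1 z.
have [kk [mkk ikk]] := kiter_kernel mP (blocks x n k).
(* With [C] the power of the rate, contraction gives the distance [C (1 + c / 2 * V / i)] to [d] at
   time [-np]; averaging over the earlier blocks with [blocks_bound], and [c < 1], leaves
   [C (2 + V z)]. *)
have key z : `|fine (kiter P (blocks x 0 (n + k)) v z) - d| <=
    (1 - c / 8) ^+ l * (2 + V z).
  rewrite blocks_cat kiter_cat ikk//.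
  set C := (1 - c / 8) ^+ l in hd *.
  have C0 : 0 <= C by rewrite exprn_ge0//; lra.
  have uE w : u w = (fine (u w))%:E.
    have /andP[a /le_lt_trans b] := u1 w.
    by rewrite fineK// ge0_fin_numE// b// ltry.
  have iu : (kk z).-integrable setT (EFin \o (fun w => fine (u w))).
    have mfu : measurable_fun setT (EFin \o (fun w => fine (u w))).
      by apply: (eq_measurable_fun u) => // w _; rewrite /= -uE.
    apply/integrableP; split => //.
    apply: le_lt_trans (ltry 1); rewrite -(@probability_setT _ _ _ (kk z)) -[leRHS]mul1e.
    rewrite -integral_cst//; apply: ge0_le_integral => //=.
      by apply/measurable_EFinP; apply: measurableT_comp => //; exact/measurable_EFinP.
    move=> w _; have /andP[a b] := u1 w.
    by rewrite lee_fin ger0_norm -lee_fin -uE.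
  have Wb : (\int[kk z]_w (V w / i)%:E <= (V z + 1)%:E)%E.
    rewrite -ikk//; [exact: blocks_bound|exact/measurable_EFinP].
  have iW : (kk z).-integrable setT (EFin \o (fun w => V w / i)).
    apply/integrableP; split; first exact/measurable_EFinP.
    apply: le_lt_trans (ltry (V z + 1)); apply: le_trans Wb.
    by under eq_integral do rewrite /= ger0_norm//.
  have -> : fine (\int[kk z]_w u w)%E = (\int[kk z]_w fine (u w))%R.
    by rewrite /Rintegral; congr fine; apply: eq_integral => w _; exact: uE.
  have W1 : (\int[kk z]_w (V w / i))%R <= V z + 1.
    by rewrite -lee_fin /Rintegral fineK// ?(integrable_fin_num _ iW).
  have ik (r : R) : (kk z).-integrable setT (EFin \o cst r).
    exact: finite_measure_integrable_cst.
  have Ic (r : R) : (\int[kk z]_w r)%R = r.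
    by rewrite Rintegral_cst// [X in fine X](@probability_setT _ _ _ (kk z)) mulr1.
  have iCW : (kk z).-integrable setT (EFin \o (fun w => C * (c / 2) * (V w / i))).
    exact: (integrableZl measurableT (C * (c / 2)) iW).
  have iF : (kk z).-integrable setT (EFin \o (fun w => C + C * (c / 2) * (V w / i))).
    exact: (integrableD measurableT (ik C) iCW).
  have IF : (\int[kk z]_w (C + C * (c / 2) * (V w / i)))%R <= C * (2 + V z).
    rewrite (RintegralD measurableT (ik C) iCW) Ic RintegralZl//.
    have c2 : 0 <= C * (1 - c / 2) by rewrite mulr_ge0//; lra.
    have W2 : 0 <= (\int[kk z]_w (V w / i))%R by apply: Rintegral_ge0.
    have := ler_wpM2l C0 W1; have := mulr_ge0 c2 W2; lra.
  have h1 w : fine (u w) <= d + (C + C * (c / 2) * (V w / i)).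
    by have := hd w; rewrite ler_norml => /andP[_]; lra.
  have h2 w : d <= fine (u w) + (C + C * (c / 2) * (V w / i)).
    by have := hd w; rewrite ler_norml => /andP[+ _]; lra.
  rewrite ler_norml; apply/andP; split.
    have := le_Rintegral measurableT (ik d) (integrableD measurableT iu iF) (fun w _ => h2 w).
    by rewrite Ic (RintegralD measurableT iu iF); lra.
  have := le_Rintegral measurableT iu (integrableD measurableT (ik d) iF) (fun w _ => h1 w).
  by rewrite (RintegralD measurableT (ik d) iF) Ic; lra.
have := key y; have := key y'; rewrite !ler_norml => /andP[? ?] /andP[? ?].
by apply/andP; split; lra.
Qed.

End pathwise.

Lemma measure_incr_gt d (T : measurableType d) (R : realType)
  (mu : probability T R) (A : (set T)^nat) (a : \bar R) :
  (forall n, measurable (A n)) -> {homo A : n m / (n <= m)%N >-> n `<=` m} ->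
  (a < mu (\bigcup_n A n))%E -> exists n, (a < mu (A n))%E.
Proof.
move=> mA ndA; apply: contraPP => /forallNP h; apply/negP; rewrite -leNgt.
have cA : mu (A n) @[n --> \oo] --> mu (\bigcup_n A n).
  apply: nondecreasing_cvg_mu => //; first exact: bigcup_measurable.
  by move=> n m nm; apply/subsetPset; exact: ndA.
rewrite -(cvg_lim _ cA)//; apply: lime_le; first exact: cvgP cA.
by apply: nearW => n; rewrite leNgt; apply/negP; exact: h.
Qed.

Lemma bounded_sum_small (R : realType) (u : nat -> R) (M : R) : (forall k, 0 <= u k) ->
  (forall n, \sum_(k < n) u k <= M) ->
  forall eps, 0 < eps -> exists N, forall n, (N <= n)%N -> u n <= eps.
Proof.
move=> u0 uM eps eps0.
have c : cvgn (series u).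
  apply: nondecreasing_is_cvgn; first exact: nondecreasing_series.
  by exists M => _ [n _ <-]; rewrite /series/= big_mkord.
have /cvgrPdist_le/(_ _ eps0)[N _ hN] := cvg_series_cvg_0 c.
exists N => n Nn; have := hN n Nn; rewrite /= sub0r normrN ger0_norm//.
Qed.

Lemma exp_small (R : realType) (q C eps : R) : 0 <= q < 1 -> 0 < eps ->
  exists l, q ^+ l * C <= eps.
Proof.
move=> /andP[q0 q1] e0; have : `|q| < 1 by rewrite ger0_norm.
have [C0|C0] := ltP 0 C; last by exists 0%N; rewrite expr0 mul1r (le_trans C0)// ltW.
move=> /cvg_expr/cvgrPdist_le/(_ (eps / C) (divr_gt0 e0 C0))[l _ /(_ l (leqnn l))] /=.
by rewrite sub0r normrN ger0_norm ?exprn_ge0// ler_pdivlMr// => ?; exists l.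
Qed.

(** * Forgetting, uniformly off a small set of environments *)

Section forget.
Context (R : realType) dE dF (E : measurableType dE) (F : measurableType dF)
  (P : F -> E -> probability E R).
Hypothesis mP : forall A, measurable A ->
  measurable_fun setT (fun xy : F * E => P xy.1 xy.2 A).
Variables (p : nat) (V : E -> R) (L B : path F -> R).
Hypotheses (mV : measurable_fun setT V) (V0 : forall y, 0 <= V y).
Hypotheses (mL : measurable_fun setT L) (mB : measurable_fun setT B).
Hypotheses (L0 : forall x, 0 < L x) (B1 : forall x, 1 <= B x).
Hypothesis drift : forall x y,
  (kiter P (seg x 0 p) (fun z => (V z)%:E) y <= (L x * V y + B x)%:E)%E.
Hypothesis minor : forall r, 0 < r -> exists e : path F -> R,
  [/\ measurable_fun setT e, forall x, 0 < e x &
  forall x, exists nu : probability E R,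
  forall y A, measurable A -> V y <= r ->
  ((e x)%:E * nu A <= kiter P (seg x 0 p) (fun z => (\1_A z)%:E) y)%E].

Variable mu : probability (path F) R.
Hypothesis minv : forall h S, measurable S -> mu (shiftn h @^-1` S) = mu S.

Lemma measurable_preimage_before n (S : set (path F)) :
  measurable S -> measurable (before p n @^-1` S).
Proof. by move=> mS; rewrite -[X in measurable X]setTI; exact: measurable_shiftn. Qed.

Lemma measurable_prodL n k : measurable_fun setT (fun x => prodL p L x n k).
Proof.
apply: measurable_prod => i _.
exact: (measurableT_comp mL (measurable_shiftn _)).
Qed.

Lemma measurable_sumB n k : measurable_fun setT (fun x => sumB p L B x n k).
Proof.
apply: measurable_sum => i; apply: measurable_funM; first exact: measurable_prodL.
exact: (measurableT_comp mB (measurable_shiftn _)).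
Qed.

Lemma measurable_set_le d (T : measurableType d) (f g : T -> R) :
  measurable_fun setT f -> measurable_fun setT g -> measurable [set x | f x <= g x].
Proof.
by move=> mf mg; rewrite -[X in measurable X]setTI; exact: measurable_fun_le.
Qed.

Lemma measurable_good i c e n : measurable_fun setT e ->
  measurable (good p L B i c e n).
Proof.
move=> me; apply: measurableI; last first.
  by apply: measurable_set_le => //; exact: (measurableT_comp me (measurable_shiftn _)).
rewrite (_ : (fun _ => _) = \bigcap_k [set x | sumB p L B x n k <= i]).
  by apply: bigcapT_measurable => k; apply: measurable_set_le => //; exact: measurable_sumB.
by apply/seteqP; split => [x h k _|x h k]; exact: h.
Qed.

Lemma measurable_chain i c e l n : measurable_fun setT e ->
  measurable (chain p L B i c e l n).
Proof.
move=> me; elim: l n => [|l ih] n /=; first exact: measurable_good.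
apply: measurableI; first exact: measurable_good.
rewrite (_ : (fun _ => _) = \bigcup_(m in [set m | (m < n)%N])
  (chain p L B i c e l m `&` [set x | prodL p L x m (n - m) <= 2^-1])).
  apply: bigcup_measurable => m _; apply: measurableI => //.
  by apply: measurable_set_le => //; exact: measurable_prodL.
by apply/seteqP; split => [x [m mn h]|x [m mn h]]; exists m.
Qed.

Lemma good_before i c e n : good p L B i c e n = before p n @^-1` good p L B i c e 0.
Proof.
apply/seteqP; split => x; rewrite /good /preimage/= => -[h1 h2].
  by split=> [k|]; rewrite ?sumB_before ?addn0 ?beforeD ?addn0.
by split=> [k|]; [have := h1 k|move: h2]; rewrite ?sumB_before ?addn0 ?beforeD ?addn0.
Qed.

(** The products that start at a good time are dominated by the terms of a convergent series because
    [B >= 1], hence tend to 0; any good time far enough further back then closes a contracting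
    stretch. *)
Lemma lim_sup_good i c e l x : lim_sup_set (good p L B i c e) x ->
  exists n, chain p L B i c e l n x.
Proof.
move=> xinf; suff h m : exists2 n, (m <= n)%N & chain p L B i c e l n x.
  by have [n _ ?] := h 0%N; exists n.
elim: l m => [|l ih] m /=; first by have [n mn gn] := xinf m Logic.I; exists n.
have [n mn xn] := ih m; have [Sn _] := chain_good xn.
have [|||N hN] := @bounded_sum_small R (fun k => prodL p L x n k) i _ _ 2^-1.
- by move=> k; exact/ltW/prodL_gt0.
- move=> k; apply: le_trans (Sn k); apply: ler_sum => j _.
  by rewrite ler_peMr// ltW// prodL_gt0.
- by [].
have [n' /= nn' gn'] := xinf (n + N).+1 Logic.I.
exists n'; first lia.
split=> //; exists n; first lia.
by split=> //; apply: hN; lia.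
Qed.

Hypothesis fin_sum : mu (\bigcup_(i : nat) [set x | forall k, sumB p L B x 0 k <= i%:R]) = 1%E.

Let Sle (i : nat) := [set x | forall k, sumB p L B x 0 k <= i%:R].
Let mSle i : measurable (Sle i).
Proof.
rewrite (_ : Sle i = \bigcap_k [set x | sumB p L B x 0 k <= i%:R]).
  by apply: bigcapT_measurable => k; apply: measurable_set_le => //; exact: measurable_sumB.
by apply/seteqP; split => [x h k _|x h k]; exact: h.
Qed.

(** Constants are chosen by continuity of [mu] along increasing events: first [i] for the sum, then
    [c] for the minorization, then, [l] being given by the rate, [N] for the occurrence of [l]
    stretches. *)
Lemma forget (K eps : R) : 0 < eps -> exists N (A : set (path F)),
  [/\ measurable A, ((1 - eps)%:E < mu A)%E &
  forall x n v y y', A x -> (N <= n)%N -> measurable_fun setT v ->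
    (forall z, 0 <= v z <= 1)%E -> V y <= K -> V y' <= K ->
    `|fine (kiter P (blocks p x 0 n) v y) - fine (kiter P (blocks p x 0 n) v y')| <= eps].
Proof.
move=> eps0.
pose ep := eps / 2; have ep0 : 0 < ep by rewrite divr_gt0.
have [||| i0 hi0] := @measure_incr_gt _ _ _ mu Sle (1 - ep)%:E.
- exact: mSle.
- by move=> n m nm x h k; apply: le_trans (h k) _; rewrite ler_nat.
- by rewrite (fin_sum : mu (\bigcup_n Sle n) = 1%E) lte_fin; lra.
(* [chain_forget] asks for [1 <= i]. *)
pose i := i0.+1; have i1 : 1 <= i%:R :> R by rewrite ler1n.
have hi : ((1 - ep)%:E < mu (Sle i))%E.
  apply: (lt_le_trans hi0); apply: le_measure; rewrite ?inE//.
  by move=> x h k; apply: le_trans (h k) _; rewrite ler_nat.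
have i_gt0 : 0 < i%:R :> R by exact: lt_le_trans i1.
have [|e [me e0 eP]] := minor (r := 8 * i%:R); first by rewrite mulr_gt0.
(* The sequence starts at 1/2 so that the constant stays below 1. *)
pose cc (j : nat) : R := j.+2%:R^-1.
have [|||j hj] := @measure_incr_gt _ _ _ mu (fun j => good p L B i%:R (cc j) e 0) (1 - ep)%:E.
- by move=> n; exact: measurable_good.
- move=> n m nm x [h1 h2]; split=> //; apply: le_trans h2.
  by rewrite /cc lef_pV2 ?posrE// ler_nat !ltnS.
- rewrite (_ : \bigcup_n _ = Sle i)//; apply/seteqP; split => [x [n _ []]//|x h].
  have [n hn] : exists n : nat, cc n <= e (before p 0 x).
    exists (Num.bound (e (before p 0 x))^-1).
    rewrite /cc invf_ple ?posrE//.
    have := archi_boundP (ltW (e0 (before p 0 x))) => _.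
    apply: (@le_trans _ _ (Num.bound (e (before p 0 x))^-1)%:R).
      by rewrite ltW// archi_boundP// invr_ge0 ltW.
    by rewrite ler_nat; lia.
  by exists n.
set c := cc j in hj.
have c01 : 0 < c < 1.
  by rewrite /c /cc invr_gt0 ltr0n/= invf_lt1 ?ltr0n// ltr1n.
have [l hl] : exists l, (1 - c / 8) ^+ l * (4 + 2 * `|K|) <= eps.
  by apply: exp_small => //; case/andP: c01 => ? ?; lra.
pose G := good p L B i%:R c e.
have mG n : measurable (G n) by exact: measurable_good.
have muG n : mu (G n) = mu (G 0%N) by rewrite /G good_before minv.
(* Recurrence in the form needed: by invariance the events [G n] have equal mass, and their upper
   limit, being the limit of the unions of the tails, has at least that mass. *)
have Dge : (mu (G 0%N) <= mu (lim_sup_set G))%E.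
  have cvD := @lim_sup_set_cvg _ _ _ mu G mG _.
  have {}cvD := cvD (le_lt_trans (probability_le1 mu (bigcup_measurable (fun k _ => mG k))) (ltry 1)).
  rewrite -(cvg_lim _ cvD)//; apply: lime_ge; first exact: cvgP cvD.
  apply: nearW => n; rewrite -(muG n); apply: le_measure; rewrite ?inE//.
    exact: bigcup_measurable.
  by move=> x Gx; exists n => /=.
pose U N := \bigcup_(n in [set n | (n <= N)%N]) chain p L B i%:R c e l n.
have mU N : measurable (U N).
  by apply: bigcup_measurable => n _; exact: measurable_chain.
have [|||N hN] := @measure_incr_gt _ _ _ mu U (1 - ep)%:E.
- exact: mU.
- by move=> n m nm x [n' /= n'n h]; exists n' => //=; exact: leq_trans nm.
- apply: (lt_le_trans hj); apply: (le_trans Dge); apply: le_measure; rewrite ?inE.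
  + by apply: bigcapT_measurable => n; exact: bigcup_measurable.
  + exact: bigcup_measurable.
  + by move=> x /(lim_sup_good l)[n xn]; exists n => //; exists n => /=.
exists N, (U N); split=> //.
  by apply: le_lt_trans hN; rewrite lee_fin /ep; lra.
move=> x n v y y' [m /= mN xm] Nn mv v1 Vy Vy'.
rewrite -(subnKC (leq_trans mN Nn)).
apply: le_trans (chain_forget mP mV V0 L0 B1 drift i_gt0 c01 eP y y' _ xm i1 mv v1) _.
apply: le_trans hl; apply: ler_wpM2l.
  by rewrite exprn_ge0//; case/andP: c01 => ? ?; lra.
by have := ler_norm K; lra.
Qed.

Lemma tight_start y0 eps : 0 < eps -> exists K : R, exists2 A : set (path F),
  measurable A /\ ((1 - eps)%:E < mu A)%E & forall x k, A x ->
  (kiter P (blocks p x 0 k) (fun z => (V z)%:E) y0 <= K%:E)%E.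
Proof.
move=> eps0.
have [||| i0 hi0] := @measure_incr_gt _ _ _ mu Sle (1 - eps)%:E.
- exact: mSle.
- by move=> n m nm x h k; apply: le_trans (h k) _; rewrite ler_nat.
- by rewrite (fin_sum : mu (\bigcup_n Sle n) = 1%E) lte_fin; lra.
exists (i0%:R * V y0 + i0%:R), (Sle i0) => // x k Sx.
apply: le_trans (blocks_drift mP mV V0 L0 B1 drift _ _ _ _) _.
rewrite lee_fin; apply: lerD => //; rewrite ler_wpM2r//.
exact: le_trans (prodL_le_sumB _ L0 B1 _ _ _) _.
Qed.

End forget.

(** * Summability of the drift *)

(** The root condition gives [l n <= q ^ n] from some index on, with [q < 1]. For
    [delta = - ln q / 2] the growth of [b] spends half of this decay, and the series is eventually
    dominated by a geometric one whose ratio [r] is the square root of [q]. *)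
Lemma summable_of_root_test (R : realType) (l b : nat -> R) :
  (forall n, 0 < l n) -> (forall n, 1 <= b n) ->
  (limn_esup (fun n => (l n `^ n%:R^-1)%:E) < 1)%E ->
  (forall delta, 0 < delta -> exists N, forall n, (N <= n)%N -> ln (b n) <= delta * n.+1%:R) ->
  exists i : nat, forall k, \sum_(j < k) l j * b j <= i%:R.
Proof.
move=> l0 b1 hl hb.
have [n0 [q [q0 q1 hq]]] : exists n0, exists q, [/\ 2^-1 <= q, q < 1 &
    forall n, (n0 <= n)%N -> l n <= q ^+ n].
  set u := (fun n => (l n `^ n%:R^-1)%:E) in hl.
  have : (ereal_inf (range (esups u)) < 1)%E.
    by rewrite -(cvg_lim _ (@cvg_esups_inf _ u))// -limn_esup_lim.
  move=> /ereal_inf_lt[_ [m _ <-] hm].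
  have ule n : (m <= n)%N -> (u n <= esups u m)%E.
    by move=> mn; apply: ereal_sup_ubound; exists n.
  have fq : esups u m \is a fin_num.
    rewrite fin_numElt (lt_trans hm) ?ltry// andbT (lt_le_trans _ (ule m (leqnn m)))//.
    exact: ltNyr.
  (* The shift excludes [n = 0], where there is no root to undo; the maximum with 1/2 keeps [q]
     positive, so that [ln q] is meaningful. *)
  exists m.+1, (Num.max 2^-1 (fine (esups u m))); split.
  - by rewrite le_max lexx.
  - rewrite gt_max; apply/andP; split; first lra.
    by rewrite -lte_fin fineK.
  move=> n mn; have n0 : (0 < n)%N by exact: leq_trans mn.
  have -> : l n = (l n `^ n%:R^-1) ^+ n.
    rewrite -powR_mulrn ?powR_ge0// -powRrM mulVf ?powRr1 ?ltW//.
    by rewrite pnatr_eq0 -lt0n.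
  rewrite lerXn2r// ?nnegrE ?powR_ge0// ?le_max ?invr_ge0 ?ler0n//.
  by apply/orP; right; rewrite -lee_fin fineK//; apply: ule; exact: ltnW.
clear hl; pose delta := - ln q / 2.
have qpos : 0 < q by lra.
have d0 : 0 < delta by rewrite divr_gt0// oppr_gt0 ln_lt0// qpos.
have [n1 hn1] := hb _ d0.
pose r := expR (- delta).
have r1 : r < 1 by rewrite expR_lt1 oppr_lt0.
have r0 : 0 < r by exact: expR_gt0.
have qE : q = r ^+ 2.
  rewrite -expRM_natl -{1}(@lnK _ q) ?posrE//; congr expR; rewrite /delta.
  by rewrite mulrN -mulrN -[LHS]mulr1; field.
pose N := maxn n0 n1.
have ht j : (N <= j)%N -> l j * b j <= expR delta * r ^+ j.
  rewrite geq_max => /andP[j0 j1].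
  have bj : b j <= expR (delta * j.+1%:R).
    rewrite -[leLHS]lnK ?posrE ?(lt_le_trans _ (b1 j))// ler_expR; exact: hn1.
  apply: le_trans (ler_pM (ltW (l0 j)) (le_trans ler01 (b1 j)) (hq j j0) bj) _.
  have -> : expR (delta * j.+1%:R) = expR delta ^+ j.+1 by rewrite -expRM_natl mulrC.
  rewrite qE (_ : r ^+ 2 ^+ j * _ = expR delta * r ^+ j * (r * expR delta) ^+ j).
    by rewrite /r expRN mulVf ?gt_eqF ?expR_gt0// expr1n mulr1.
  rewrite -exprM mul2n -addnn exprD exprS exprMn; ring.
pose t j := l j * b j.
have t0 j : 0 <= t j by rewrite mulr_ge0 ?(ltW (l0 j))// (le_trans _ (b1 j)).
have hs m : \sum_(j < N + m) t j <= \sum_(j < N) t j + expR delta * (1 - r ^+ m) / (1 - r).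
  elim: m => [|m ih]; first by rewrite addn0 expr0 subrr mulr0 mul0r addr0.
  rewrite addnS big_ord_recr/=; apply: le_trans (lerD ih (ht (N + m)%N (leq_addr _ _))) _.
  rewrite -addrA lerD2l exprS.
  have rm : r ^+ (N + m) <= r ^+ m by apply: ler_wiXn2l; [exact: ltW|exact: ltW|exact: leq_addl].
  have := ler_wpM2l (expR_ge0 delta) rm.
  have r10 : 1 - r != 0 by rewrite subr_eq0 gt_eqF.
  rewrite (_ : (expR delta * (1 - r * r ^+ m) / (1 - r) =
    expR delta * (1 - r ^+ m) / (1 - r) + expR delta * r ^+ m)%R); first by rewrite lerD2l.
  by move: (expR delta) (r ^+ m) => e1 e2; field.
pose M := \sum_(j < N) t j + expR delta / (1 - r).
exists (Num.bound M) => k; apply: le_trans (ltW (archi_boundP _)); last first.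
  by rewrite addr_ge0 ?sumr_ge0// divr_ge0 ?expR_ge0//; lra.
apply: (@le_trans _ _ (\sum_(j < N + k) t j)).
  rewrite addnC big_split_ord/= lerDl; exact: sumr_ge0.
apply: le_trans (hs k) _; rewrite lerD2l -mulrA ler_wpM2l ?expR_ge0//.
apply: ler_piMl; first by rewrite invr_ge0; lra.
by have := exprn_ge0 k (ltW r0); lra.
Qed.

(** After integration in [xi] this is the tail-sum bound for Borel-Cantelli. The auxiliary bound by
    [n] serves the induction when the new index counts: then [n + 1] itself is below
    [xi / delta]. *)
Lemma count_mult_le (R : realType) (xi delta : R) n : 0 <= xi -> 0 < delta ->
  \sum_(i < n) (delta * i.+1%:R < xi)%R%:R <= xi / delta :> R.
Proof.
move=> xi0 d0; suff [//] : \sum_(i < n) (delta * i.+1%:R < xi)%R%:R <= xi / delta :> R /\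
  \sum_(i < n) (delta * i.+1%:R < xi)%R%:R <= n%:R :> R.
elim: n => [|n [ih1 ih2]]; first by rewrite big_ord0; split => //; rewrite divr_ge0// ltW.
rewrite big_ord_recr/=; have [h|h] := ltP (delta * n.+1%:R) xi; last first.
  by rewrite addr0; split=> //; rewrite (le_trans ih2)// ler_nat.
have e : n.+1%:R = n%:R + 1 :> R by rewrite -natr1.
rewrite e lerD2r; split=> //.
rewrite ler_pdivlMr// mulrC; apply: le_trans (ltW h); rewrite ler_wpM2l ?(ltW d0)// e.
by rewrite lerD2r.
Qed.

Section stationary_growth.
Context (R : realType) d (T : measurableType d) (mu : probability (path T) R).
Hypothesis minv : forall h S, measurable S -> mu (shiftn h @^-1` S) = mu S.
Variables (p : nat) (xi : path T -> R).
Hypotheses (mxi : measurable_fun setT xi) (xi0 : forall x, 0 <= xi x).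
Hypothesis ixi : (\int[mu]_x (xi x)%:E < +oo)%E.

(** Borel-Cantelli: by invariance the event at [n] has the probability of [xi > delta (n + 1)], and
    these sum to at most the mean of [xi] divided by [delta]. *)
Lemma stationary_sublinear (delta : R) : 0 < delta ->
  {ae mu, forall x, exists N, forall n, (N <= n)%N ->
    xi (before p n.+1 x) <= delta * n.+1%:R}.
Proof.
move=> d0; pose A n := [set x | delta * n.+1%:R < xi x].
have mA n : measurable (A n).
  rewrite (_ : A n = ~` [set x | xi x <= delta * n.+1%:R]).
    by apply: measurableC; apply: measurable_set_le.
  by apply/seteqP; split=> x /=; rewrite /A/= ltNge => /negP.
pose B n := before p n.+1 @^-1` A n.
have mB n : measurable (B n).
  by rewrite -[B n]setTI; exact: (measurable_shiftn _ measurableT).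
have muB n : mu (B n) = (\int[mu]_x ((delta * n.+1%:R < xi x)%R%:R)%:E)%E.
  rewrite /B minv// -[A n]setIT -integral_indic//.
  apply: eq_integral => x _; congr EFin; rewrite indicE; congr (_%:R); congr nat_of_bool.
  by apply/idP/idP; rewrite inE.
have : mu (lim_sup_set B) = 0%E.
  apply: lim_sup_set_cvg0 => //.
  apply: (@le_lt_trans _ _ ((delta^-1)%:E * \int[mu]_x (xi x)%:E)%E); last first.
    rewrite lte_mul_pinfty ?lee_fin ?invr_ge0 ?(ltW d0)//.
  have mi (i : nat) : measurable_fun setT (fun x => ((delta * i.+1%:R < xi x)%R%:R : R)%:E).
    apply/measurable_EFinP; rewrite (_ : (fun _ => _) = \1_(A i)); first exact: measurable_indic.
    apply/funext => x; rewrite indicE; congr (_%:R); congr nat_of_bool.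
    by apply/idP/idP; rewrite inE.
  apply: lime_le; first exact: is_cvg_nneseries.
  apply: nearW => n; rewrite (eq_bigr _ (fun i _ => muB i)) -ge0_integral_sum//; last first.
  rewrite -ge0_integralZl_EFin ?invr_ge0 ?(ltW d0)//; last 2 first.
  - by move=> x _; rewrite lee_fin.
  - exact/measurable_EFinP.
  apply: ge0_le_integral => //.
  - by move=> x _; apply: sume_ge0.
  - exact: emeasurable_sum.
  - by apply: measurable_funeM; exact/measurable_EFinP.
  - move=> x _; rewrite sumEFin -EFinM lee_fin big_mkord mulrC.
    exact: count_mult_le.
move=> B0; exists (lim_sup_set B); split=> //.
  by apply: bigcapT_measurable => n; exact: bigcup_measurable.
move=> x /= /forallNP h n _; apply: contrapT => hn; apply: (h n) => m nm.
rewrite leNgt; apply/negP => hm; apply: hn; exists m => //.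
Qed.

End stationary_growth.

(** * Uniqueness of tight Markov laws *)

Section tight_markov.
Context (R : realType) dE dF (E : measurableType dE) (F : measurableType dF)
  (P : F -> E -> probability E R).
Hypothesis mP : forall A, measurable A ->
  measurable_fun setT (fun xy : F * E => P xy.1 xy.2 A).
Variables (p : nat) (V : E -> R).
Hypotheses (p_gt0 : (0 < p)%N) (mV : measurable_fun setT V) (V0 : forall y, 0 <= V y).
Variable mu : probability (path F) R.
Hypothesis minv : forall h S, measurable S -> mu (shiftn h @^-1` S) = mu S.
Hypothesis forget : forall K eps : R, 0 < eps -> exists N (A : set (path F)),
  [/\ measurable A, ((1 - eps)%:E < mu A)%E &
  forall x n v y y', A x -> (N <= n)%N -> measurable_fun setT v ->
    (forall z, 0 <= v z <= 1)%E -> V y <= K -> V y' <= K ->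
    `|fine (kiter P (blocks p x 0 n) v y) - fine (kiter P (blocks p x 0 n) v y')| <= eps].

Local Notation Xi := (path (E * F)%type).
Local Notation indic S := (fun f : Xi => (\1_S f : R)%:E).

(** The reference configuration: functionals evaluated on it depend on the environment alone, so
    every Markov law is compared with one quantity determined by [mu]. *)
Definition emb (x : path F) : Xi := fun s => (point, x s).

Lemma measurable_emb : measurable_fun setT emb.
Proof.
by apply: measurable_pathP => s; apply/measurable_fun_pair => //=; exact: measurable_coord.
Qed.

Lemma measurable_indic_E S : measurable S -> measurable_fun setT (indic S).
Proof. by move=> mS; exact/measurable_EFinP/measurable_indic. Qed.

Lemma indic_ge0 S f : (0 <= indic S f)%E. Proof. by rewrite lee_fin. Qed.

Lemma indic_01 S f : (0 <= indic S f <= 1)%E.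
Proof. by rewrite !lee_fin indicE; case: (_ \in _); rewrite ?lexx ler01. Qed.

Lemma depends_indic (D : pred int) S : restr D @^-1` S = S -> depends D (indic S).
Proof. by move=> DS f; rewrite !indicE -{2}DS; congr ((nat_of_bool _)%:R%:E); apply/idP/idP; rewrite !inE. Qed.

Lemma integral_indicE (M : probability Xi R) S : measurable S ->
  (\int[M]_f indic S f = M S)%E.
Proof. by move=> mS; rewrite integral_indic// setIT. Qed.

Definition env_law (M : probability Xi R) :=
  forall A, measurable A -> M (@env _ _ E F @^-1` A) = mu A.

Lemma integral_env_law M (G : path F -> \bar R) : env_law M -> measurable_fun setT G ->
  (forall x, 0 <= G x)%E -> (\int[M]_f G (env f) = \int[mu]_x G x)%E.
Proof.
move=> eM mG G0; rewrite -(integral_image M (measurable_env (E:=E) (F:=F)) mG G0).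
by apply: eq_measure_integral => A mA _; exact: eM.
Qed.

Definition level (K : R) (t : int) : set Xi := [set f | K < V (f t).1].

Lemma measurable_level K t : measurable (level K t).
Proof.
rewrite (_ : level K t = ~` [set f | V (f t).1 <= K]).
  apply: measurableC; apply: measurable_set_le => //.
  apply: (measurableT_comp mV).
  exact: (measurableT_comp measurable_fst (measurable_coord t)).
by apply/seteqP; split=> f /=; rewrite /level/= ltNge => /negP.
Qed.

Definition tight (M : probability Xi R) := forall eps, 0 < eps ->
  exists K, forall k : nat, (M (level K (- (k * p)%:Z)) <= eps%:E)%E.

(** Open on the left because a run started at time [-mp] redraws the coordinates from [-mp + 1] to
    [mp] and keeps the one at [-mp]. *)
Definition win (m : nat) : pred int :=
  fun u => (- (m * p)%:Z < u) && (u <= (m * p)%:Z).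

Lemma winS m n u : (m <= n)%N -> win m u -> win n u.
Proof.
rewrite /win => mn; have : (m * p <= n * p)%N by rewrite leq_mul2r mn orbT.
by lia.
Qed.

Lemma win_upto m u : win m u -> - (m * p)%:Z < u <= - (m * p)%:Z + (m * p + m * p)%N%:Z.
Proof. rewrite /win PoszD; lia. Qed.

Section compare.
Variables (m n : nat) (S : set Xi).
Hypotheses (mn : (m <= n)%N) (mS : measurable S) (DS : restr (win m) @^-1` S = S).

Let u := Jit P (- (n * p)%:Z) (n * p + m * p) (indic S).

Let dH : depends (pred1 (- (m * p)%:Z)) (Jit P (- (m * p)%:Z) (m * p + m * p) (indic S)).
Proof.
apply: dependsS (depends_Jit P (depends_indic DS) (fun u Du => _)) => [v /=|v /win_upto].
  by case/andP => vm /orP[/win_upto|//]; lia.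
by case/andP.
Qed.

Lemma Jit_window_kiter f : u f = kiter P (blocks p (env f) m (n - m))
  (fun z => Jit P (- (m * p)%:Z) (m * p + m * p) (indic S) (upd (emb (env f)) (- (m * p)%:Z) z))
  (f (- (n * p)%:Z)).1.
Proof.
have e : (n * p + m * p)%N = ((n - m) * p + (m * p + m * p))%N.
  by rewrite addnA -(mulnDl (n - m)%N) subnK.
have e2 : - (n * p)%:Z + ((n - m) * p)%N%:Z = - (m * p)%:Z.
  rewrite -{1}(subnK mn) mulnDl PoszD; lia.
rewrite /u e Jit_add e2 Jit_kiter e2// /blocks subnKC//.
congr kiter; apply/funext => z; apply: (dependsP dH); first by rewrite !env_upd.
by move=> v /= /eqP ->; rewrite /upd eqxx.
Qed.

(** Replaces the state of [M] at time [-np] by [point]. The gap is at most [eps] if the environment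
    seen from [-mp], where the window opens, lies in [A] and the state has [V <= K]; on the two
    exceptional events it is at most 1, which adds their masses. Invariance of [mu] reduces the
    first mass to that of the complement of [A]. *)
Lemma compare (M : probability Xi R) K eps N (A : set (path F)) :
  env_law M -> 0 <= eps -> measurable A -> V point <= K -> (N <= n - m)%N ->
  (forall x n v y y', A x -> (N <= n)%N -> measurable_fun setT v ->
    (forall z, 0 <= v z <= 1)%E -> V y <= K -> V y' <= K ->
    `|fine (kiter P (blocks p x 0 n) v y) - fine (kiter P (blocks p x 0 n) v y')| <= eps) ->
  let c := (eps%:E + (mu (~` A) + M (level K (- (n * p)%:Z))))%E in
  (\int[M]_f u f <= \int[mu]_x u (emb x) + c)%E /\
  (\int[mu]_x u (emb x) <= \int[M]_f u f + c)%E.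
Proof.
move=> eM eps0 mA VK Nnm hA.
have mG := measurable_indic_E mS; have G0 := @indic_ge0 S.
have muu : measurable_fun setT u by exact: measurable_Jit.
have u01 f : (0 <= u f <= 1)%E by apply: Jit_le1 => // g; exact: indic_01.
have u0 f : (0 <= u f)%E by have /andP[] := u01 f.
have mue : measurable_fun setT (fun f : Xi => u (emb (env f))).
  have mee : measurable_fun setT (fun f : Xi => emb (env f)).
    exact: (measurableT_comp measurable_emb (measurable_env (E:=E) (F:=F))).
  exact: (measurableT_comp muu mee).
have uf f : u f \is a fin_num.
  by have /andP[a b] := u01 f; rewrite ge0_fin_numE// (le_lt_trans b)// ltry.
pose bad1 : set Xi := @env _ _ E F @^-1` (before p m @^-1` (~` A)).
pose bad2 := level K (- (n * p)%:Z).
have mA' : measurable (before p m @^-1` (~` A)).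
  by apply: measurable_preimage_before; exact: measurableC.
have mb1 : measurable bad1.
  by rewrite -[bad1]setTI; exact: (measurable_env measurableT mA').
have mb2 : measurable bad2 by exact: measurable_level.
have close f : (u f <= u (emb (env f)) + (eps%:E + (indic bad1 f + indic bad2 f)))%E /\
               (u (emb (env f)) <= u f + (eps%:E + (indic bad1 f + indic bad2 f)))%E.
  have [b1|nb1] := pselect (bad1 f).
    have i1 : indic bad1 f = 1%E by rewrite indicE mem_set.
    rewrite i1; have /andP[_ uf1] := u01 f; have /andP[_ ue1] := u01 (emb (env f)).
    have c1 : (1 <= eps%:E + (1 + indic bad2 f))%E.
      by rewrite addeA -[leLHS]adde0 leeD// ?indic_ge0// -[leLHS]add0e leeD2r.
    by split; [apply: le_trans uf1 _|apply: le_trans ue1 _]; rewrite (le_trans c1)// leeDr.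
  have [b2|nb2] := pselect (bad2 f).
    have i2 : indic bad2 f = 1%E by rewrite indicE mem_set.
    rewrite i2; have /andP[_ uf1] := u01 f; have /andP[_ ue1] := u01 (emb (env f)).
    have c1 : (1 <= eps%:E + (indic bad1 f + 1))%E.
      by rewrite addeA -[leLHS]add0e leeD2r// adde_ge0// indic_ge0.
    by split; [apply: le_trans uf1 _|apply: le_trans ue1 _]; rewrite (le_trans c1)// leeDr.
  have xA : A (before p m (env f)) by apply: contrapT.
  have Vf : V (f (- (n * p)%:Z)).1 <= K by rewrite leNgt; apply/negP.
  have i0 : (eps%:E + (indic bad1 f + indic bad2 f) = eps%:E)%E.
    by rewrite !indicE memNset// memNset//= adde0 adde0.
  rewrite i0.
  pose H z := Jit P (- (m * p)%:Z) (m * p + m * p) (indic S)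
    (upd (emb (env f)) (- (m * p)%:Z) z).
  have mH : measurable_fun setT H.
    by apply: measurableT_comp; [exact: measurable_Jit|exact: measurable_upd2].
  have H01 z : (0 <= H z <= 1)%E by apply: Jit_le1 => // g; exact: indic_01.
  have ufE : u f = kiter P (blocks p (before p m (env f)) 0 (n - m)) H (f (- (n * p)%:Z)).1.
    by rewrite blocks_before addn0 Jit_window_kiter.
  have ueE : u (emb (env f)) = kiter P (blocks p (before p m (env f)) 0 (n - m)) H point.
    by rewrite blocks_before addn0 Jit_window_kiter.
  have := hA _ _ _ _ _ xA Nnm mH H01 Vf VK; rewrite -ufE -ueE.
  rewrite -(fineK (uf f)) -(fineK (uf (emb (env f)))) -!EFinD !lee_fin !fineK//.
  by rewrite ler_norml => /andP[? ?]; split; lra.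
have mb1E := measurable_indic_E mb1; have mb2E := measurable_indic_E mb2.
have msum : measurable_fun setT (fun f => indic bad1 f + indic bad2 f)%E by exact: emeasurable_funD.
have mc : measurable_fun setT (fun f => eps%:E + (indic bad1 f + indic bad2 f))%E.
  exact: emeasurable_funD.
have sum0 f : (0 <= indic bad1 f + indic bad2 f)%E by rewrite adde_ge0// indic_ge0.
have c0 f : (0 <= eps%:E + (indic bad1 f + indic bad2 f))%E by rewrite adde_ge0.
have Ic : (\int[M]_f (eps%:E + (indic bad1 f + indic bad2 f)) =
   eps%:E + (mu (~` A) + M (level K (- (n * p)%:Z))))%E.
  rewrite ge0_integralD// integral_cst// [X in (_ * X)%E](@probability_setT _ _ _ M) mule1.
  rewrite ge0_integralD//.
  rewrite !integral_indicE//; congr (_ + (_ + _))%E.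
  by rewrite eM// minv//; exact: measurableC.
have Ie : (\int[M]_f u (emb (env f)) = \int[mu]_x u (emb x))%E.
  apply: (integral_env_law (G := fun x => u (emb x))) => //.
  exact: (measurableT_comp muu measurable_emb).
move=> c; rewrite /c -Ic -Ie; split.
  rewrite -ge0_integralD//; apply: ge0_le_integral => //.
    exact: emeasurable_funD.
  by move=> f _; have [] := close f.
rewrite -ge0_integralD//; apply: ge0_le_integral => //.
  exact: emeasurable_funD.
by move=> f _; have [] := close f.
Qed.

End compare.

Definition windowed (S : set Xi) := measurable S /\ exists m, restr (win m) @^-1` S = S.

Lemma windowed_coord t (A : set (E * F)) : measurable A ->
  windowed ((fun f : Xi => f t) @^-1` A).
Proof.
move=> mA; split; first by rewrite -[X in measurable X]setTI; exact: (measurable_coord t measurableT mA).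
have wt : win `|t|.+1 t.
  have : (`|t|.+1 <= `|t|.+1 * p)%N by rewrite leq_pmulr.
  by rewrite /win; lia.
by exists `|t|.+1%N; apply/seteqP; split=> f /=; rewrite /preimage/= /restr wt.
Qed.

Lemma restr_winS m n (S : set Xi) : (m <= n)%N -> restr (win m) @^-1` S = S -> restr (win n) @^-1` S = S.
Proof.
move=> mn DS; have e : predI (win m) (win n) =1 win m.
  by move=> u /=; case: (boolP (win m u)) => // /(winS mn) ->.
rewrite -{1}DS -[RHS]DS; apply/seteqP.
by split=> f /=; rewrite /preimage/= restrI (eq_restr _ _ e).
Qed.

Lemma windowedI : setI_closed windowed.
Proof.
move=> S S' [mS [m DS]] [mS' [m' DS']]; split; first exact: measurableI.
exists (maxn m m'); rewrite preimage_setI.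
by rewrite (restr_winS (leq_maxl _ _) DS) (restr_winS (leq_maxr _ _) DS').
Qed.

Lemma windowed_unique (M M' : probability Xi R) :
  (forall S, windowed S -> M S = M' S) -> forall S, measurable S -> M S = M' S.
Proof.
apply: path_probability_unique; first exact: windowedI.
- by move=> S [].
- exact: windowed_coord.
Qed.

Definition markov (M : probability Xi R) := forall t, markov_at mP M t.

Lemma le_eps_eq (a b : \bar R) : a \is a fin_num -> b \is a fin_num ->
  (forall eps, 0 < eps -> (a <= b + eps%:E)%E) -> (a <= b)%E.
Proof.
move=> fa fb h; rewrite -(fineK fa) -(fineK fb) lee_fin; apply/ler_addgt0Pr => e e0.
by rewrite -lee_fin EFinD !fineK//; exact: h.
Qed.

Lemma mu_setC_lt (A : set (path F)) eps : measurable A -> ((1 - eps)%:E < mu A)%E ->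
  (mu (~` A) <= eps%:E)%E.
Proof.
move=> mA; rewrite probability_setC//.
have : mu A \is a fin_num by exact: fin_num_measure.
by move=> /fineK <-; rewrite -EFinB lte_fin lee_fin => ?; lra.
Qed.

Lemma tight_markov_unique (M M' : probability Xi R) :
  env_law M -> env_law M' -> markov M -> markov M' -> tight M -> tight M' ->
  forall S, measurable S -> M S = M' S.
Proof.
move=> eM eM' mM mM' tM tM'; apply: windowed_unique => S [mS [m DS]].
suff H M1 M2 : env_law M1 -> env_law M2 -> markov M1 -> markov M2 -> tight M1 -> tight M2 ->
    (M1 S <= M2 S)%E by apply/eqP; rewrite eq_le !H.
move=> eM1 eM2 mM1 mM2 tM1 tM2; apply: le_eps_eq; rewrite ?fin_num_measure// => eps eps0.
(* Each of the two laws is compared with the chain from [point], with three error terms per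
   comparison. *)
pose ep := eps / 6; have ep0 : 0 < ep by rewrite divr_gt0.
have [K1 hK1] := tM1 _ ep0; have [K2 hK2] := tM2 _ ep0.
pose K := Num.max (V point) (Num.max K1 K2).
have [N [A [mA muA hA]]] := forget K ep0.
pose n := (m + N)%N.
have mn : (m <= n)%N by exact: leq_addr.
have Nn : (N <= n - m)%N by rewrite /n addKn.
have VK : V point <= K by rewrite le_max lexx.
have levelS K' : K' <= K -> forall t, level K t `<=` level K' t.
  by move=> KK t f; exact: le_lt_trans.
have tail M0 K' : K' <= K -> (forall k : nat, (M0 (level K' (- (k * p)%:Z)) <= ep%:E)%E) ->
    forall M0' : probability Xi R, M0' = M0 :> (set Xi -> \bar R) ->
    (M0' (level K (- (n * p)%:Z)) <= ep%:E)%E.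
  move=> KK hK M0' e; apply: le_trans (hK n); rewrite -e; apply: le_measure; rewrite ?inE.
  - exact: measurable_level.
  - exact: measurable_level.
  - exact: levelS.
have cE : (mu (~` A) <= ep%:E)%E by exact: mu_setC_lt.
have I M0 : markov M0 -> M0 S = (\int[M0]_f Jit P (- (n * p)%:Z) (n * p + m * p) (indic S) f)%E.
  move=> mM0; rewrite -integral_indicE//.
  have [] // := @markov_integral_window _ _ _ _ _ P mP M0 (- (n * p)%:Z) (n * p + m * p)
    (win m) (indic S).
  - move=> u; rewrite /win => /andP[u1 u2].
    have : (m * p <= n * p)%N by rewrite leq_mul2r mn orbT.
    rewrite PoszD; lia.
  - exact: depends_indic.
  - exact: measurable_indic_E.
have [h1 _] := compare mn mS DS eM1 (ltW ep0) mA VK Nn hA.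
have [_ h2] := compare mn mS DS eM2 (ltW ep0) mA VK Nn hA.
rewrite (I M1)// (I M2)//; apply: le_trans h1 _.
apply: (@le_trans _ _ ((\int[M2]_f Jit P (- (n * p)%:Z) (n * p + m * p) (indic S) f +
   (ep%:E + (ep%:E + ep%:E))) + (ep%:E + (ep%:E + ep%:E)))%E).
  apply: leeD.
    apply: le_trans h2 _; apply: leeD => //; apply: leeD => //; apply: leeD => //.
    by apply: (tail M2 K2) => //; rewrite !le_max lexx !orbT.
  apply: leeD => //; apply: leeD => //.
  by apply: (tail M1 K1) => //; rewrite !le_max lexx !orbT.
rewrite -addeA; apply: leeD => //; rewrite -!EFinD lee_fin /ep; lra.
Qed.

End tight_markov.

(** * Limits in total variation *)

Section tv_limit.
Context d (T : measurableType d) (R : realType).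
Variable a : nat -> probability T R.
Hypothesis cauchy_a : forall eps : R, 0 < eps -> exists N, forall k k', (N <= k)%N ->
  (N <= k')%N -> forall S, measurable S -> (a k S <= a k' S + eps%:E)%E.

Let r k S := fine (a k S).
Let rE k S : measurable S -> a k S = (r k S)%:E.
Proof. by move=> mS; rewrite /r fineK// fin_num_measure. Qed.

Let cauchy_r eps : 0 < eps -> exists N, forall k k', (N <= k)%N -> (N <= k')%N ->
  forall S, measurable S -> `|r k S - r k' S| <= eps.
Proof.
move=> /cauchy_a[N hN]; exists N => k k' Nk Nk' S mS.
have := hN _ _ Nk Nk' S mS; have := hN _ _ Nk' Nk S mS; rewrite !rE// -!EFinD !lee_fin.
by rewrite ler_norml => ? ?; apply/andP; split; lra.
Qed.

Let cvg_r S : measurable S -> cvgn (r ^~ S).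
Proof.
move=> mS; apply/cauchy_cvgP/cauchy_exP => eps eps0.
have [N hN] := cauchy_r (divr_gt0 eps0 (ltr0Sn _ 1)).
exists (r N S); exists N => // n /= Nn; rewrite /ball/=.
apply: le_lt_trans (hN _ _ (leqnn N) Nn S mS) _.
by rewrite ltr_pdivrMr// ltr_pMr// ltr1n.
Qed.

(** Limits are controlled on measurable sets only; the value 0 elsewhere keeps the function
    nonnegative on all sets. *)
Definition tv_lim (S : set T) : \bar R :=
  (if `[<measurable S>] then limn (r ^~ S) else 0)%:E.

Let tv_limE S : measurable S -> tv_lim S = (limn (r ^~ S))%:E.
Proof. by move=> mS; rewrite /tv_lim asboolT. Qed.

Let close eps : 0 < eps -> exists N, forall k, (N <= k)%N -> forall S, measurable S ->
  `|r k S - limn (r ^~ S)| <= eps.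
Proof.
move=> /cauchy_r[N hN]; exists N => k Nk S mS.
have c : `|r k S - r n S| @[n --> \oo] --> `|r k S - limn (r ^~ S)|.
  by apply: cvg_norm; apply: cvgB; [exact: cvg_cst|exact: cvg_r].
rewrite -(cvg_lim _ c)//; apply: limr_le; first exact: cvgP c.
by exists N => // n /= Nn; exact: hN.
Qed.

Let tv_lim_ge0 S : (0 <= tv_lim S)%E.
Proof.
rewrite /tv_lim; case: asboolP => [mS|//]; rewrite lee_fin.
apply: limr_ge; first exact: cvg_r.
by apply: nearW => n; exact: fine_ge0.
Qed.

Let tv_lim0 : tv_lim set0 = 0%E.
Proof.
rewrite tv_limE//; congr EFin; apply: cvg_lim => //.
by rewrite (_ : r ^~ set0 = cst 0); [exact: cvg_cst|apply/funext => n; rewrite /r measure0].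
Qed.

Let tv_lim_add (A : (set T)^nat) n : (forall i, measurable (A i)) -> trivIset setT A ->
  (\sum_(0 <= i < n) tv_lim (A i) = tv_lim (\big[setU/set0]_(i < n) A i))%E.
Proof.
move=> mA tA; rewrite tv_limE; last exact: bigsetU_measurable.
rewrite (eq_bigr _ (fun i _ => tv_limE (mA i))) sumEFin; congr EFin.
apply/esym/cvg_lim => //.
rewrite (_ : r ^~ _ = fun k => \sum_(0 <= i < n) r k (A i)).
  elim: n => [|n ih]; first by under eq_fun do rewrite big_geq//; rewrite big_geq//; exact: cvg_cst.
  by under eq_fun do rewrite big_nat_recr//=; rewrite big_nat_recr//=; apply: cvgD => //; exact: cvg_r.
apply/funext => k; apply: EFin_inj; rewrite -rE; last exact: bigsetU_measurable.
rewrite -sumEFin measure_bigsetU//.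
by rewrite big_mkord; apply: eq_bigr => i _; exact: rE.
Qed.

(** Convergence is uniform over measurable sets, so the sigma-additivity of a single [a N] passes to
    the limit by an [eps / 3] argument. *)
Let tv_lim_sigma : semi_sigma_additive tv_lim.
Proof.
move=> A mA tA mUA.
have mU n : measurable (\big[setU/set0]_(i < n) A i) by exact: bigsetU_measurable.
rewrite (_ : (fun n => _) = fun n => (limn (r ^~ (\big[setU/set0]_(i < n) A i)))%:E); last first.
  by apply/funext => n; rewrite tv_lim_add// tv_limE.
rewrite tv_limE//.
apply: cvg_EFin; first exact: nearW.
rewrite /=.
apply/cvgrPdist_le => eps eps0.
have e3 : 0 < eps / 3 by rewrite divr_gt0.
have [N hN] := close e3.
have : a N (\big[setU/set0]_(i < n) A i) @[n --> \oo] --> a N (\bigcup_n A n).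
  rewrite (_ : (fun n => _) = fun n => \sum_(0 <= i < n) a N (A i))%E.
    exact: measure_semi_sigma_additive.
  by apply/funext => n; rewrite big_mkord; exact: measure_bigsetU.
rewrite rE// (_ : (fun n => _) = fun n => (r N (\big[setU/set0]_(i < n) A i))%:E); last first.
  by apply/funext => n; rewrite rE.
move=> /fine_cvg /= /cvgrPdist_le /(_ _ e3)[M _ hM].
exists M => // n /= Mn; have /= := hM n Mn.
have := hN N (leqnn N) _ mUA; have := hN N (leqnn N) _ (mU n).
rewrite !ler_norml => /andP[? ?] /andP[? ?] /andP[? ?]; apply/andP; split; lra.
Qed.

HB.instance Definition _ := isMeasure.Build _ _ _ tv_lim tv_lim0 tv_lim_ge0 tv_lim_sigma.

Let tv_limT : tv_lim setT = 1%E.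
Proof.
rewrite tv_limE//; congr EFin; apply: cvg_lim => //.
by rewrite (_ : r ^~ _ = cst 1); [exact: cvg_cst|apply/funext => n; rewrite /r probability_setT].
Qed.

HB.instance Definition _ := Measure_isProbability.Build _ _ _ tv_lim tv_limT.

Lemma tv_limit : exists mu : probability T R, forall eps, 0 < eps -> exists N,
  forall k, (N <= k)%N -> forall S, measurable S ->
  (a k S <= mu S + eps%:E)%E /\ (mu S <= a k S + eps%:E)%E.
Proof.
pose mu : probability T R := tv_lim.
exists mu => eps /close[N hN]; exists N => k Nk S mS.
have muE : mu S = (limn (r ^~ S))%:E by exact: tv_limE.
have := hN k Nk S mS; rewrite muE rE// -!EFinD !lee_fin.
by rewrite ler_norml => /andP[? ?]; split; lra.
Qed.

End tv_limit.

Section integral_tv.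
Context d (T : measurableType d) (R : realType).
Local Open Scope ereal_scope.

(* The layer-cake average of the indicators of [i/n <= h] approximates [h] within [1/n]. *)
Lemma integral_tv_le (mu nu : probability T R) (eps : R) (h : T -> R) :
  (forall S, measurable S -> mu S <= nu S + eps%:E) -> measurable_fun setT h ->
  (forall x, (0 <= h x <= 1)%R) ->
  \int[mu]_x (h x)%:E <= \int[nu]_x (h x)%:E + eps%:E.
Proof.
move=> munu mh h01.
have h0 x : (0 <= h x)%R by have /andP[] := h01 x.
have mhE : measurable_fun setT (EFin \o h) by exact/measurable_EFinP.
have fin (m : probability T R) : \int[m]_x (h x)%:E \is a fin_num.
  rewrite ge0_fin_numE; last by apply: integral_ge0 => x _; rewrite lee_fin.
  apply: le_lt_trans (ltry 1); rewrite -(@probability_setT _ _ _ m) -[leRHS]mul1e.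
  rewrite -integral_cst//; apply: ge0_le_integral => //=.
    by move=> x _; rewrite lee_fin.
  by move=> x _; rewrite lee_fin; have /andP[] := h01 x.
pose A n (i : nat) := [set x | (i.+1%:R / n.+1%:R <= h x)%R].
have mA n i : measurable (A n i) by exact: measurable_set_le.
have sumA n x : (h x <= n.+1%:R^-1 * \sum_(i < n.+1) (\1_(A n i) x : R) + n.+1%:R^-1)%R /\
    (n.+1%:R^-1 * \sum_(i < n.+1) (\1_(A n i) x : R) <= h x)%R.
  (* The number of levels [(i + 1) / (n + 1)] reached by [h x] is the integer part of [(n + 1) h x]
     unless capped by [m]; the middle clause covers the uncapped case. *)
  have cnt m : (m <= n.+1)%N ->
      (\sum_(i < m) (\1_(A n i) x : R) <= n.+1%:R * h x)%R /\
      (\sum_(i < m) (\1_(A n i) x : R) < m%:R -> n.+1%:R * h x < \sum_(i < m) (\1_(A n i) x : R) + 1)%R /\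
      (\sum_(i < m) (\1_(A n i) x : R) <= m%:R :> R)%R.
    elim: m => [_|m ih mn].
      rewrite !big_ord0; split; first exact: mulr_ge0.
      by split=> //; rewrite ltxx.
    have [i1 [i2 i3]] := ih (ltnW mn); rewrite big_ord_recr/= indicE.
    have em : m.+1%:R = (m%:R + 1 :> R)%R by rewrite -natr1.
    have [h1|h1] := leP (m.+1%:R / n.+1%:R)%R (h x).
      rewrite mem_set//= !em.
      have h2 : (m%:R + 1 <= n.+1%:R * h x)%R by rewrite -em mulrC -ler_pdivrMr.
      split; first by apply: le_trans h2; rewrite lerD2r.
      split; last by rewrite lerD2r.
      rewrite ltrD2r => /i2; lra.
    rewrite memNset//=; last by apply/negP; rewrite -ltNge.
    rewrite addr0 em.
    have h2 : (n.+1%:R * h x < m%:R + 1)%R by rewrite -em mulrC -ltr_pdivlMr.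
    split=> //; split; last by lra.
    move=> _; move: i3; rewrite le_eqVlt => /predU1P[->//|/i2//].
  have [c1 [c2 c3]] := cnt n.+1 (leqnn _).
  have n0 : (0 < n.+1%:R :> R)%R by rewrite ltr0n.
  rewrite -[X in (_ + X)%R]mulr1 -mulrDr ![(_^-1 * _)%R]mulrC; split; last by rewrite ler_pdivrMr// mulrC.
  rewrite ler_pdivlMr// mulrC.
  move: c3; rewrite le_eqVlt => /predU1P[->|/c2/ltW//].
  have := h01 x => /andP[_ h1]; have := ler_wpM2l (ltW n0) h1; lra.
have step n : \int[mu]_x (h x)%:E <= \int[nu]_x (h x)%:E + eps%:E + n.+1%:R^-1%:E.
  have n0 : (0 <= n.+1%:R^-1 :> R)%R by rewrite invr_ge0.
  pose g x := \sum_(i < n.+1) (\1_(A n i) x : R)%:E.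
  have mgi (i : 'I_n.+1) : measurable_fun setT (fun x => (\1_(A n i) x : R)%:E).
    exact/measurable_EFinP/measurable_indic.
  have mg : measurable_fun setT g by apply: emeasurable_sum.
  have g0 x : 0 <= g x by apply: sume_ge0 => i _; rewrite lee_fin.
  have Ig (m : probability T R) : \int[m]_x g x = \sum_(i < n.+1) m (A n i).
    rewrite ge0_integral_sum//; apply: eq_bigr => i _.
    by rewrite integral_indic// setIT.
  have munu' : \sum_(i < n.+1) mu (A n i) <= \sum_(i < n.+1) nu (A n i) + (n.+1%:R * eps)%:E.
    apply: (@le_trans _ _ (\sum_(i < n.+1) (nu (A n i) + eps%:E))).
      by apply: lee_sum => i _; exact: munu.
    rewrite big_split/= leeD2l// sumEFin lee_fin sumr_const card_ord.
    by rewrite mulr_natl.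
  apply: (@le_trans _ _ (\int[mu]_x ((n.+1%:R^-1)%:E * g x + n.+1%:R^-1%:E))).
    apply: ge0_le_integral => //.
    - by move=> x _; rewrite lee_fin.
    - by apply: emeasurable_funD => //; exact: measurable_funeM.
    - move=> x _; rewrite /g sumEFin -EFinM -EFinD lee_fin.
      by have [] := sumA n x.
  rewrite ge0_integralD//; last 2 first.
  - by move=> x _; apply: mule_ge0 => //; rewrite lee_fin.
  - exact: measurable_funeM.
  rewrite integral_cst// [X in _ + _ * X](@probability_setT _ _ _ mu) mule1 leeD2r//.
  rewrite ge0_integralZl_EFin//.
  rewrite Ig; apply: (@le_trans _ _ ((n.+1%:R^-1)%:E *
    (\sum_(i < n.+1) nu (A n i) + (n.+1%:R * eps)%:E))).
    by rewrite lee_wpmul2l// lee_fin.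
  rewrite muleDr//; last by rewrite fin_num_adde_defl.
  rewrite -EFinM mulrA mulVf ?mul1r ?pnatr_eq0// leeD2r// -Ig -ge0_integralZl_EFin//.
  apply: ge0_le_integral => //.
  - by move=> x _; apply: mule_ge0 => //; rewrite lee_fin.
  - exact: measurable_funeM.
  - move=> x _; rewrite /g sumEFin -EFinM lee_fin.
    by have [] := sumA n x.
rewrite -(fineK (fin mu)) -(fineK (fin nu)) -EFinD lee_fin.
apply/ler_addgt0Pr => e e0.
have := step (Num.bound e^-1); rewrite -(fineK (fin mu)) -(fineK (fin nu)) -!EFinD lee_fin.
move=> /le_trans; apply; rewrite lerD2l invf_ple ?posrE//.
apply: (@le_trans _ _ (Num.bound e^-1)%:R).
  by rewrite ltW// archi_boundP// invr_ge0 ltW.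
by rewrite ler_nat.
Qed.

End integral_tv.

(** * Kolmogorov extension for spaces coded by bits *)

Section bit_tree.
Context (R : realType) (q : seq bool -> R).
Hypotheses (q0 : forall s, 0 <= q s) (q1 : q [::] = 1)
  (qS : forall s, q s = q (rcons s false) + q (rcons s true)).

Let D : set (measurableTypeR R) := `[0, 1[%classic.
Let mD : measurable D. Proof. exact: measurable_itv. Qed.

Definition unif01 : set (measurableTypeR R) -> \bar R := mrestr (@lebesgue_measure R) mD.
HB.instance Definition _ := Measure.on unif01.
Let unif01T : unif01 setT = 1%E.
Proof.
by rewrite /unif01 /mrestr setTI lebesgue_measure_itv/= lte_fin ltr01 sube0.
Qed.
HB.instance Definition _ := Measure_isProbability.Build _ _ _ unif01 unif01T.

(** Nested cells: the words of length [n] cut [0, 1[ into consecutive intervals of lengths [q s].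
    The state records the word of the cell of [u] and its left endpoint, so that the bits of a
    uniform variable have the law prescribed by [q]. *)
Fixpoint bit_state (n : nat) (u : R) : seq bool * R :=
  if n is n'.+1 then
    let: (s, l) := bit_state n' u in
    if u < l + q (rcons s false) then (rcons s false, l)
    else (rcons s true, l + q (rcons s false))
  else ([::], 0).

Definition bit n u := last false (bit_state n.+1 u).1.

Lemma bit_stateS n u : (bit_state n.+1 u).1 = rcons (bit_state n u).1 (bit n u).
Proof.
by rewrite /bit /=; case: (bit_state n u) => s l; case: ifP => _; rewrite last_rcons.
Qed.

Lemma bit_stateE n u : (bit_state n u).1 = mkseq (bit ^~ u) n.
Proof.
elim: n => // n ih; rewrite bit_stateS ih /mkseq -addn1 iotaD map_cat cats1.
by rewrite add0n.
Qed.

Lemma bit_state_cell n s : size s = n -> exists l,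
  [/\ forall u, (bit_state n u).1 = s -> (bit_state n u).2 = l,
      measurable ([set u | (bit_state n u).1 = s] : set (measurableTypeR R)) &
      D `&` [set u | (bit_state n u).1 = s] = `[l, l + q s[%classic].
Proof.
elim: n s => [|n ih] s.
  move=> /size0nil ->; exists 0; split=> //.
  - by rewrite (_ : [set _ | _] = setT)//; apply/seteqP; split.
  - rewrite add0r q1 (_ : [set _ | _] = setT) ?setIT//.
    by apply/seteqP; split.
case/lastP: s => // s b; rewrite size_rcons => -[/ih[l [hl ml Dl]]].
have iff u : (bit_state n.+1 u).1 = rcons s b <->
    (bit_state n u).1 = s /\ (u < l + q (rcons s false)) = ~~ b.
  rewrite /=; have := hl u; case: (bit_state n u) => s' l' /= hl'.
  have [es|/eqP ns] := eqVneq s' s; last first.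
    by split=> [|[]//]; case: ifP => _ /rcons_inj[].
  rewrite es -(hl' es); case: (u < _); split=> [/rcons_inj[]|[_]] //; case: b => //.
have set_rcons : [set u | (bit_state n.+1 u).1 = rcons s b] =
    [set u | (bit_state n u).1 = s] `&` [set u | (u < l + q (rcons s false)) = ~~ b].
  by apply/seteqP; split => u /iff.
have qs := qS s.
exists (if b then l + q (rcons s false) else l); split.
- move=> u hu; have [es ub] := (iff u).1 hu; rewrite /=; have := hl u es; move: es ub.
  by case: (bit_state n u) => s' l' /= -> + ->; case: b {hu iff set_rcons} => /= ->.
- rewrite set_rcons; apply: measurableI => //.
  case: b {iff set_rcons} => /=.
    rewrite (_ : [set _ | _] = `[l + q (rcons s false), +oo[%classic); first exact: measurable_itv.
    apply/seteqP; split => u /=; rewrite in_itv/= andbT leNgt; first by move=> ->.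
    by move/negbTE.
  rewrite (_ : [set _ | _] = `]-oo, (l + q (rcons s false))[%classic); first exact: measurable_itv.
  by apply/seteqP; split => u /=; rewrite in_itv.
- rewrite set_rcons setIA Dl.
  have q00 := q0 (rcons s false); have q01 := q0 (rcons s true).
  case: b {iff set_rcons} => /=; apply/seteqP; split => u /=; rewrite !in_itv/=.
  + by move=> [/andP[? ?] /negbT]; rewrite -leNgt => ?; apply/andP; split => //; lra.
  + move=> /andP[? ?]; split; first by apply/andP; split; lra.
    by apply/negbTE; rewrite -leNgt.
  + by move=> [/andP[? ?] ?]; apply/andP.
  + by move=> /andP[? ?]; split=> //; apply/andP; split => //; lra.
Qed.

(** Bit sequences are two-sided paths padded by [false], in order to reuse the sigma-algebra of
    [path]. *)
Definition bit_path (u : measurableTypeR R) : path bool :=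
  fun t => if t is Posz n then bit n u else false.

Lemma measurable_bit_path : measurable_fun setT bit_path.
Proof.
apply: measurable_pathP => -[n|n] /=; last exact: measurable_cst.
apply: (measurable_fun_bool true); rewrite setTI.
rewrite (_ : _ @^-1` _ = \bigcup_(s in [set s : n.+1.-tuple bool | last false s])
   [set u | (bit_state n.+1 u).1 = s]).
  apply: fin_bigcup_measurable; first exact: finite_finset.
  by move=> s _; have [l []] := bit_state_cell (size_tuple s).
apply/seteqP; split => [u /= bu|u [s /= ls us]]; last by rewrite /preimage/= /bit us ls.
have sz : size (bit_state n.+1 u).1 == n.+1 by rewrite bit_stateE size_mkseq.
by exists (Tuple sz).
Qed.

Lemma bit_tree_law : exists nu : probability (path bool) R, forall n s, size s = n ->
  nu [set c | mkseq (fun i => c (Posz i)) n = s] = (q s)%:E.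
Proof.
exists (image_prob unif01 measurable_bit_path) => n s sn.
have [l [_ _ Dl]] := bit_state_cell sn.
transitivity (@lebesgue_measure R
  (bit_path @^-1` [set c | mkseq (fun i => c (Posz i)) n = s] `&` D)) => //; rewrite setIC.
rewrite (_ : D `&` _ = `[l, l + q s[%classic); last first.
  by rewrite -Dl; congr (_ `&` _); apply/seteqP; split => u /=; rewrite bit_stateE.
rewrite lebesgue_measure_itv/= lte_fin ltrDl; case: ltP => h.
  by rewrite -EFinB addrC addKr.
by congr EFin; apply/eqP; rewrite eq_le h q0.
Qed.

End bit_tree.

(** A measurable retract of the space of bit sequences: the part of being standard Borel that the
    extension theorem uses. *)
Definition codable d (T : measurableType d) :=
  exists (code : T -> path bool) (decode : path bool -> T),
  [/\ measurable_fun setT code, measurable_fun setT decode & cancel code decode].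

Section kolmogorov.
Context (R : realType) dE dF (E : measurableType dE) (F : measurableType dF).
Local Notation Xi := (path (E * F)%type).
Variables (codeE : E -> path bool) (decodeE : path bool -> E).
Variables (codeF : F -> path bool) (decodeF : path bool -> F).
Hypotheses (mcodeE : measurable_fun setT codeE) (mdecodeE : measurable_fun setT decodeE).
Hypotheses (mcodeF : measurable_fun setT codeF) (mdecodeF : measurable_fun setT decodeF).
Hypotheses (codeEK : cancel codeE decodeE) (codeFK : cancel codeF decodeF).

Variable w : nat -> pred int.
Hypothesis wS : forall m n t, (m <= n)%N -> w m t -> w n t.
Hypothesis w_cover : forall t, exists m, w m t.

Variable La : nat -> probability Xi R.
Hypothesis consistent : forall m k, (m <= k)%N -> forall S, measurable S ->
  La k (restr (w m) @^-1` S) = La m S.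

Definition codeXi (f : Xi) : path bool := fun t =>
  if t is Posz n then
    if unpickle n is Some (s, b, j) then
      if b then codeE (f s).1 j else codeF (f s).2 j
    else false
  else false.

Definition decodeXi (c : path bool) : Xi := fun t =>
  (decodeE (fun j => c (Posz (pickle (t, true, j)))),
   decodeF (fun j => c (Posz (pickle (t, false, j))))).

(** The erasure [restr] read through the code. It acts bit by bit, so the first [n] bits of the
    result depend on the first [n] bits only. *)
Definition cut (D : pred int) (c : path bool) : path bool := fun t =>
  if t is Posz n then
    if unpickle n is Some (s, b, j) then
      if b && ~~ D s then codeE point j else c t
    else false
  else false.

Lemma measurable_codeXi : measurable_fun setT codeXi.
Proof.
apply: measurable_pathP => -[n|n] /=; last exact: measurable_cst.
rewrite /codeXi; case: unpickle => [[[s [|]] j]|]; last exact: measurable_cst.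
  exact: (measurableT_comp (@measurable_coord _ bool j) (measurableT_comp mcodeE
    (measurableT_comp measurable_fst (measurable_coord s)))).
exact: (measurableT_comp (@measurable_coord _ bool j) (measurableT_comp mcodeF
  (measurableT_comp measurable_snd (measurable_coord s)))).
Qed.

Lemma measurable_decodeXi : measurable_fun setT decodeXi.
Proof.
apply: measurable_pathP => t; apply/measurable_fun_pair => /=.
  by apply: (measurableT_comp mdecodeE); apply: measurable_pathP => j; exact: measurable_coord.
by apply: (measurableT_comp mdecodeF); apply: measurable_pathP => j; exact: measurable_coord.
Qed.

Lemma measurable_cut D : measurable_fun setT (cut D).
Proof.
apply: measurable_pathP => -[n|n] /=; last exact: measurable_cst.
rewrite /cut; case: unpickle => [[[s b] j]|]; last exact: measurable_cst.
by case: (b && ~~ D s); [exact: measurable_cst|exact: measurable_coord].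
Qed.

Lemma codeXi_restr D f : codeXi (restr D f) = cut D (codeXi f).
Proof.
apply/funext => -[n|n] //=; rewrite /codeXi /cut.
case: unpickle => [[[s b] j]|]//; rewrite /restr.
by case: b => //=; case: (D s).
Qed.

Lemma decodeXi_cut D c : decodeXi (cut D c) = restr D (decodeXi c).
Proof.
apply/funext => t; have [Dt|/negbTE Dt] := boolP (D t); rewrite /restr Dt.
  by congr pair; [congr decodeE|congr decodeF]; apply/funext => j;
    rewrite /cut pickleK ?Dt ?andbF.
congr pair; last by congr decodeF; apply/funext => j; rewrite /cut pickleK.
rewrite -[RHS]codeEK; congr decodeE; apply/funext => j.
by rewrite /cut pickleK Dt.
Qed.

Lemma codeXiK : cancel codeXi decodeXi.
Proof.
move=> f; apply/funext => t; rewrite /decodeXi /codeXi [RHS]surjective_pairing.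
congr pair; rewrite -?codeEK -?codeFK; [rewrite -[RHS]codeEK; congr decodeE|rewrite -[RHS]codeFK; congr decodeF].
  by apply/funext => j; rewrite pickleK.
by apply/funext => j; rewrite pickleK.
Qed.

Definition pre (n : nat) (c : path bool) := mkseq (fun i => c (Posz i)) n.

Lemma measurable_pre n (A : set (seq bool)) : measurable [set c | A (pre n c)].
Proof.
rewrite (_ : [set c | _] = \bigcup_(s in [set s : n.-tuple bool | A s])
  \bigcap_(i in [set i : 'I_n | true]) ((fun c : path bool => c (Posz i)) @^-1` [set tnth s i])).
  apply: fin_bigcup_measurable; first exact: finite_finset.
  move=> s _; apply: fin_bigcap_measurable; first exact: finite_finset.
  by move=> i _; rewrite -[X in measurable X]setTI; exact: measurable_coord.
have szp c : size (pre n c) == n by rewrite size_mkseq.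
apply/seteqP; split => [c /= Ac|c [s As hs]] /=.
  exists (Tuple (szp c)) => // i _ /=.
  by rewrite (tnth_nth false)/= nth_mkseq.
rewrite (_ : pre n c = s)//; apply: (@eq_from_nth _ false); first by rewrite size_mkseq size_tuple.
move=> i; rewrite size_mkseq => ni; rewrite nth_mkseq//.
by have /= := hs (Ordinal ni) isT; rewrite (tnth_nth false).
Qed.

Lemma preS n c : pre n.+1 c = rcons (pre n c) (c (Posz n)).
Proof. by rewrite /pre /mkseq -addn1 iotaD map_cat cats1 add0n. Qed.

(** Finitely many bits read finitely many coordinates, which a large window contains. By consistency
    the mass of a word under [La m] is then constant for large [m]; this is the weight [q]. *)
Lemma pre_bound n : exists M, forall m f, (M <= m)%N ->
  pre n (codeXi (restr (w m) f)) = pre n (codeXi f).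
Proof.
elim: n => [|n [M hM]]; first by exists 0%N.
have [M' hM'] : exists M', forall m f, (M' <= m)%N ->
    codeXi (restr (w m) f) (Posz n) = codeXi f (Posz n).
  rewrite /codeXi; case: unpickle => [[[s b] j]|]; last by exists 0%N.
  have [M' ws] := w_cover s; exists M' => m f Mm; rewrite /restr.
  by rewrite (wS Mm ws).
exists (maxn M M') => m f; rewrite geq_max => /andP[m1 m2].
by rewrite !preS hM'// hM.
Qed.

Definition bound n := projT1 (cid (pre_bound n)).
Lemma boundP n m f : (bound n <= m)%N -> pre n (codeXi (restr (w m) f)) = pre n (codeXi f).
Proof. exact: (projT2 (cid (pre_bound n))). Qed.

Let W n (A : set (seq bool)) : set Xi := [set f | A (pre n (codeXi f))].
Let mW n A : measurable (W n A).
Proof.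
rewrite -[W n A]setTI.
exact: (measurable_codeXi measurableT (measurable_pre n A)).
Qed.

Let La_bound n A m : (bound n <= m)%N -> La m (W n A) = La (bound n) (W n A).
Proof.
move=> nm; rewrite -(consistent nm)//; congr (La m _).
by apply/seteqP; split => f; rewrite /W /preimage/= boundP.
Qed.

Let q s := fine (La (bound (size s)) (W (size s) [set s])).
Let qE s m : (bound (size s) <= m)%N -> (q s)%:E = La m (W (size s) [set s]).
Proof. by move=> sm; rewrite /q fineK ?fin_num_measure// La_bound. Qed.

Let q0 s : 0 <= q s. Proof. exact: fine_ge0. Qed.
Let q1 : q [::] = 1.
Proof.
apply: EFin_inj; rewrite (qE (leqnn _)) (_ : W _ _ = setT) ?probability_setT//.
by apply/seteqP; split.
Qed.

Let qS s : q s = q (rcons s false) + q (rcons s true).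
Proof.
pose m := maxn (bound (size s)) (bound (size s).+1).
apply: EFin_inj; rewrite EFinD !(@qE _ m) ?size_rcons ?leq_maxl ?leq_maxr//.
rewrite -measureU//.
- congr (La m _); apply/seteqP; split => f; rewrite /W/= !preS.
    by move=> ->; case: (codeXi f _); [right|left].
  by case=> /rcons_inj[].
- by apply/seteqP; split => f //; rewrite /W/= => -[-> /rcons_inj[]].
Qed.

(** The weights of the words define a law on bit sequences, which is then decoded. Since [decodeXi]
    is defined everywhere, it suffices to compare laws of codes on events decided by finitely many
    bits, where both sides are the same sum over words. *)
Lemma kolmogorov : exists M : probability Xi R,
  forall m S, measurable S -> M (restr (w m) @^-1` S) = La m S.
Proof.
have [nu hnu] := bit_tree_law q0 q1 qS.
have nuA n A m : (bound n <= m)%N -> nu [set c | A (pre n c)] = La m (W n A).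
  move=> nm.
  have szp c : size (pre n c) == n by rewrite size_mkseq.
  rewrite (_ : [set c | _] = \bigcup_(s in [set s : n.-tuple bool | A s]) [set c | pre n c = s]); last first.
    apply/seteqP; split => [c /= Ac|c [s As /= ->]]//.
    by exists (Tuple (szp c)).
  rewrite (_ : W n A = \bigcup_(s in [set s : n.-tuple bool | A s]) W n [set tval s]); last first.
    apply/seteqP; split => [f /= Af|f [s As]]; last by rewrite /W/= => ->.
    by exists (Tuple (szp (codeXi f))).
  have fD : finite_set [set s : n.-tuple bool | A s] by exact: finite_finset.
  have m1 (s : n.-tuple bool) : measurable [set c | pre n c = s].
    exact: (@measurable_pre n [set tval s]).
  have t1 : trivIset [set s : n.-tuple bool | A s] (fun s => [set c | pre n c = s]).
    by move=> s s' _ _ [c [/= -> /val_inj]].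
  have t2 : trivIset [set s : n.-tuple bool | A s] (fun s => W n [set tval s]).
    by move=> s s' _ _ [f []]; rewrite /W/= => -> /val_inj.
  have e1 := @measure_fin_bigcup _ _ _ nu _ _ _ fD t1 (fun s _ => m1 s).
  have e2 := @measure_fin_bigcup _ _ _ (La m) _ _ _ fD t2 (fun s _ => mW n _).
  rewrite e1 e2.
  apply: eq_fsbigr => s _; rewrite [LHS](hnu n s (size_tuple s)).
  by rewrite (@qE _ m) ?size_tuple.
exists (image_prob nu measurable_decodeXi) => m S mS.
have e1 : decodeXi @^-1` (restr (w m) @^-1` S) = cut (w m) @^-1` (decodeXi @^-1` S).
  by apply/seteqP; split => c; rewrite /preimage/= decodeXi_cut.
have e2 : codeXi @^-1` (decodeXi @^-1` S) = S.
  by apply/seteqP; split => f; rewrite /preimage/= codeXiK.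
suff key B : measurable B -> nu (cut (w m) @^-1` B) = La m (codeXi @^-1` B).
  rewrite -{2}e2 -key; first by rewrite -e1.
  by rewrite -[X in measurable X]setTI; exact: (measurable_decodeXi measurableT mS).
pose M1 := image_prob nu (measurable_cut (w m)).
pose M2 := image_prob (La m) measurable_codeXi.
move: B; suff : forall B, measurable B -> M1 B = M2 B by [].
pose G := [set S : set (path bool) | measurable S /\
  exists n, forall c c' : path bool, (forall t, t < Posz n -> c t = c' t) -> S c -> S c'].
apply: (@path_probability_unique _ _ _ M1 M2 G).
- move=> A B [mA [n hA]] [mB [n' hB]]; split; first exact: measurableI.
  exists (maxn n n') => c c' cc' [Ac Bc]; split; [apply: hA Ac|apply: hB Bc] => t tn; apply: cc'.
    by apply: lt_le_trans tn _; rewrite lez_nat leq_maxl.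
  by apply: lt_le_trans tn _; rewrite lez_nat leq_maxr.
- by move=> A [].
- move=> t A mA; split; first by rewrite -[X in measurable X]setTI; exact: (measurable_coord t measurableT mA).
  by exists `|t|.+1%N => c c' cc'; rewrite /preimage/= cc'//; lia.
- move=> A [mA [n hA]].
  suff : nu (cut (w m) @^-1` A) = La m (codeXi @^-1` A) by [].
  (* For the event [A], a word padded by [false] represents every code with these first bits, since
     codes and cuts are [false] at negative indices. *)
  pose fill (s : seq bool) : path bool := fun t => if t is Posz i then nth false s i else false.
  have hf c : (forall i, c (Negz i) = false) -> A c <-> A (fill (pre n c)).
    move=> c0; split; apply: hA => -[i|i] ti; rewrite /fill/= ?c0//.
      by rewrite nth_mkseq.
    by rewrite nth_mkseq.
  pose gcut (s : seq bool) := pre n (cut (w m) (fill s)).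
  have gE c : pre n (cut (w m) c) = gcut (pre n c).
    apply: (@eq_from_nth _ false); first by rewrite !size_mkseq.
    move=> i; rewrite size_mkseq => ni; rewrite !nth_mkseq//= /cut.
    by case: unpickle => [[[s b] j]|]//; case: ifP => // _; rewrite /fill nth_mkseq.
  pose k := maxn m (bound n).
  transitivity (nu [set c | (A \o fill \o gcut) (pre n c)]).
    congr (nu _); apply/seteqP; split => c; rewrite /preimage/=.
      by rewrite -gE; move/hf; apply.
    by rewrite -gE => h; apply/hf.
  rewrite (nuA n (A \o fill \o gcut) k) ?leq_maxr//.
  rewrite -(consistent (leq_maxl m (bound n))); last first.
    by rewrite -[X in measurable X]setTI; exact: (measurable_codeXi measurableT mA).
  congr (La k _); apply/seteqP; split => f; rewrite /W /preimage/= codeXi_restr -gE.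
    by move=> h; apply/hf.
  by move/hf; apply.
Qed.

End kolmogorov.

(** * Existence of a tight Markov law *)

Section existence.
Context (R : realType) dE dF (E : measurableType dE) (F : measurableType dF)
  (P : F -> E -> probability E R).
Hypothesis mP : forall A, measurable A ->
  measurable_fun setT (fun xy : F * E => P xy.1 xy.2 A).
Variables (p : nat) (V : E -> R).
Hypotheses (p_gt0 : (0 < p)%N) (mV : measurable_fun setT V) (V0 : forall y, 0 <= V y).
Variable mu : probability (path F) R.
Hypothesis minv : forall h S, measurable S -> mu (shiftn h @^-1` S) = mu S.
Hypothesis forget : forall K eps : R, 0 < eps -> exists N (A : set (path F)),
  [/\ measurable A, ((1 - eps)%:E < mu A)%E &
  forall x n v y y', A x -> (N <= n)%N -> measurable_fun setT v ->
    (forall z, 0 <= v z <= 1)%E -> V y <= K -> V y' <= K ->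
    `|fine (kiter P (blocks p x 0 n) v y) - fine (kiter P (blocks p x 0 n) v y')| <= eps].
Hypothesis tight_start : forall eps : R, 0 < eps -> exists K : R, exists2 A : set (path F),
  measurable A /\ ((1 - eps)%:E < mu A)%E & forall x k, A x ->
  (kiter P (blocks p x 0 k) (fun z => (V z)%:E) point <= K%:E)%E.
Hypotheses (codE : codable E) (codF : codable F).

Local Notation Xi := (path (E * F)%type).
Local Notation indic S := (fun f : Xi => (\1_S f : R)%:E).

Lemma Jop_indep t (D : pred int) (G : Xi -> \bar R) : depends D G -> ~~ D (t + 1) ->
  Jop P t G = G.
Proof.
move=> dG Dt; apply/funext => f; rewrite /Jop.
transitivity (\int[P (f t).2 (f t).1]_z (cst (G f)) z)%E.
  apply: eq_integral => z _; apply: (dependsP dG); first by rewrite env_upd.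
  by move=> s Ds; rewrite /upd; case: eqP => // e; move: Dt; rewrite -e Ds.
by rewrite integral_cst// [X in (_ * X)%E](@probability_setT _ _ _ (P (f t).2 (f t).1)) mule1.
Qed.

Lemma Jit_indep s n (D : pred int) (G : Xi -> \bar R) : depends D G ->
  (forall u, D u -> u <= s) -> Jit P s n G = G.
Proof.
elim: n s => // n ih s dG Ds /=; rewrite ih//; last by move=> u /Ds; lia.
by apply: (Jop_indep dG); apply/negP => /Ds; lia.
Qed.

Fixpoint run (M : probability Xi R) (s : int) (n : nat) : probability Xi R :=
  if n is n'.+1 then run (step mP M s) (s + 1) n' else M.

Lemma integral_run M s n G : measurable_fun setT G -> (forall f, 0 <= G f)%E ->
  (\int[run M s n]_f G f = \int[M]_f Jit P s n G f)%E.
Proof.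
move=> mG G0; elim: n M s => //= n ih M s; rewrite ih integral_step//.
  exact: measurable_Jit.
by move=> f; exact: Jit_ge0.
Qed.

Lemma runE M s n S : measurable S -> run M s n S = (\int[M]_f Jit P s n (indic S) f)%E.
Proof.
move=> mS; rewrite -integral_run ?integral_indicE//; exact: measurable_indic_E.
Qed.

Let mG S := @measurable_indic_E R _ _ E F S.
Let G0 S := @indic_ge0 R _ _ E F S.

Definition start : probability Xi R := image_prob mu (@measurable_emb _ _ E F).

Lemma integral_start G : measurable_fun setT G -> (forall f, 0 <= G f)%E ->
  (\int[start]_f G f = \int[mu]_x G (emb E x))%E.
Proof. exact: integral_image. Qed.

Lemma env_law_run s n : env_law mu (run start s n).
Proof.
move=> A mA; have mS : measurable (@env _ _ E F @^-1` A).
  by rewrite -[X in measurable X]setTI; exact: (measurable_env measurableT mA).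
rewrite runE// (@Jit_indep _ _ pred0).
- by rewrite integral_indicE.
- by apply: depends_indic; apply/seteqP; split => f; rewrite /preimage/= env_restr.
- by [].
Qed.

Definition chain_law (k : nat) : probability Xi R :=
  run start (- (k * p)%:Z) (k * p + k * p).

Lemma env_law_chain k : env_law mu (chain_law k). Proof. exact: env_law_run. Qed.

Lemma mulp_le m n : (m <= n)%N -> (m * p <= n * p)%N.
Proof. by move=> mn; rewrite leq_mul2r mn orbT. Qed.

(** From time [-kp] on, the longer chain applies the same operator as the one of length [k], to
    another initial law; the steps after the window leave the event unchanged. This is the form that
    [compare] treats. *)
Lemma chain_law_split m k k' S : (m <= k)%N -> (k <= k')%N -> measurable S ->
  restr (win p m) @^-1` S = S ->
  chain_law k' S = (\int[run start (- (k' * p)%:Z) ((k' - k) * p)]_f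
    Jit P (- (k * p)%:Z) (k * p + m * p) (indic S) f)%E.
Proof.
move=> mk kk' mS DS.
rewrite integral_run; last 2 first.
- by apply: measurable_Jit => //; exact: mG.
- by move=> f; exact: Jit_ge0.
rewrite /chain_law runE//; apply: eq_integral => f _.
have km := mulp_le mk; have kkm := mulp_le kk'.
have -> : (k' * p + k' * p = (k' - k) * p + ((k * p + m * p) + (k' - m) * p))%N.
  by rewrite !mulnBl; lia.
rewrite Jit_add; congr (Jit _ _ _ _ _).
have -> : - (k' * p)%:Z + ((k' - k) * p)%N = - (k * p)%:Z :> int by rewrite mulnBl; lia.
rewrite Jit_add; congr (Jit _ _ _ _).
apply: (Jit_indep _ (depends_indic _ DS)) => u /andP[_]; rewrite PoszD; lia.
Qed.

Lemma chain_law_start m k S : (m <= k)%N -> measurable S ->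
  restr (win p m) @^-1` S = S ->
  chain_law k S = (\int[mu]_x Jit P (- (k * p)%:Z) (k * p + m * p) (indic S) (emb E x))%E.
Proof.
move=> mk mS DS; rewrite (chain_law_split mk (leqnn k))// subnn mul0n integral_start//.
  by apply: measurable_Jit => //; exact: mG.
by move=> f; exact: Jit_ge0.
Qed.

(** Markov's inequality in a fixed environment, when its view from [-kp] has a bounded mean of [V].
    The choice of [K] gives [eps / 2] there; the other environments have mass at most [eps / 2], for
    all [k] at once by invariance. *)
Lemma tight_run eps : 0 < eps -> exists K, forall k k', (k <= k')%N ->
  (run start (- (k' * p)%:Z) ((k' - k) * p) (level V K (- (k * p)%:Z)) <= eps%:E)%E.
Proof.
move=> eps0; have e2 : 0 < eps / 2 by rewrite divr_gt0.
have [K0 [A [mA muA] hA]] := tight_start e2.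
pose K := 2 * (`|K0| + 1) / eps.
have Kgt0 : 0 < K by rewrite divr_gt0// mulr_gt0// ltr_wpDl.
have KK : K0 / K <= eps / 2.
  rewrite ler_pdivrMr// /K; have := ler_norm K0.
  have -> : eps / 2 * (2 * (`|K0| + 1) / eps) = `|K0| + 1 by field; lra.
  lra.
exists K => k k' kk'; rewrite runE; last exact: measurable_level.
set S := level V K (- (k * p)%:Z); have mS : measurable S by exact: measurable_level.
rewrite integral_start; last 2 first.
- by apply: measurable_Jit => //; exact: mG.
- by move=> f; exact: Jit_ge0.
have mA' : measurable (before p k @^-1` (~` A)).
  by apply: measurable_preimage_before; exact: measurableC.
have mu1 : measurable_fun setT (fun x : path F =>
    Jit P (- (k' * p)%:Z) ((k' - k) * p) (indic S) (emb E x)).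
  apply: (measurableT_comp (measurable_Jit mP _ _ (mG mS) (@G0 S))).
  exact: measurable_emb.
have mi : measurable_fun setT (fun x : path F => (\1_(before p k @^-1` (~` A)) x : R)%:E).
  exact/measurable_EFinP/measurable_indic.
apply: (@le_trans _ _ (\int[mu]_x ((eps / 2)%:E + (\1_(before p k @^-1` (~` A)) x)%:E))%E); last first.
  rewrite ge0_integralD//; last first.
    by move=> x _; rewrite lee_fin ltW.
  rewrite integral_cst// [X in (_ * X)%E](@probability_setT _ _ _ mu) mule1.
  rewrite integral_indic// setIT; have := mu_setC_lt mA muA.
  rewrite -(minv (- (k * p)%:Z) (measurableC mA)) => /(leeD2l (eps / 2)%:E)/le_trans; apply.
  by rewrite -EFinD lee_fin; lra.
apply: ge0_le_integral => //.
- by move=> x _; exact: Jit_ge0.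
- exact: emeasurable_funD.
move=> x _.
have J1 : (Jit P (- (k' * p)%:Z) ((k' - k) * p) (indic S) (emb E x) <= 1)%E.
  by have /andP[] := Jit_le1 mP (- (k' * p)%:Z) ((k' - k) * p) (mG mS) (@indic_01 R _ _ E F S) (emb E x).
have [xA|nxA] := pselect (A (before p k x)); last first.
  apply: le_trans J1 _; rewrite indicE mem_set//= -[leLHS]add0e leeD2r// lee_fin ltW//.
rewrite indicE memNset//= adde0.
have e2' : - (k' * p)%:Z + ((k' - k) * p)%N = - (k * p)%:Z :> int.
  by have := mulp_le kk'; rewrite mulnBl; lia.
have dS : depends (pred1 (- (k * p)%:Z)) (indic S).
  apply: depends_indic; apply/seteqP; split => f;
  by rewrite /preimage/S/level/= /restr /= eqxx.
rewrite Jit_kiter ?e2'// -[seg _ _ _](_ : blocks p x k (k' - k) = _); last first.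
  by rewrite /blocks subnKC.
have indV z : indic S (upd (emb E x) (- (k * p)%:Z) z) = (\1_[set z | K < V z] z)%:E.
  rewrite !indicE; congr ((nat_of_bool _)%:R%:E).
  by apply/idP/idP; rewrite !inE /S /level /= /upd eqxx.
under [X in kiter P _ X]eq_fun do rewrite indV.
have mKV : measurable [set z | K < V z].
  rewrite (_ : [set z | _] = ~` [set z | V z <= K]).
    by apply: measurableC; exact: measurable_set_le.
  by apply/seteqP; split=> z /=; rewrite ltNge => /negP.
apply: (@le_trans _ _ (kiter P (blocks p x k (k' - k)) (fun z => (K^-1)%:E * (V z)%:E + 0%:E)%E point)).
  apply: le_kiter => //.
  - exact/measurable_EFinP/measurable_indic.
  - by apply: emeasurable_funD => //; apply: measurable_funeM; exact/measurable_EFinP.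
  - move=> z; rewrite adde0 -EFinM lee_fin indicE.
    have [|] := boolP (z \in _); last by rewrite mulr_ge0 ?invr_ge0 ?(ltW Kgt0).
    by rewrite inE/= => KV; rewrite ler_pdivlMl// mulr1 ltW.
have mVE : measurable_fun setT (fun z => (V z)%:E) by exact/measurable_EFinP.
rewrite kiter_affine ?invr_ge0 ?(ltW Kgt0)// adde0 -[k]addn0 -blocks_before addn0.
apply: (@le_trans _ _ ((K^-1)%:E * K0%:E)%E).
  by rewrite lee_wpmul2l ?lee_fin ?invr_ge0 ?(ltW Kgt0)//; exact: hA.
by rewrite -EFinM lee_fin mulrC.
Qed.

Lemma chain_law_cauchy m eps : 0 < eps -> exists N, forall k k', (N <= k)%N -> (N <= k')%N ->
  forall S, measurable S -> restr (win p m) @^-1` S = S ->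
  (chain_law k S <= chain_law k' S + eps%:E)%E.
Proof.
move=> eps0; pose ep := eps / 3; have ep0 : 0 < ep by rewrite divr_gt0.
have [K1 hK1] := tight_run ep0.
pose K := Num.max (V point) K1.
have [N [A [mA muA hA]]] := forget K ep0.
suff H k k' S : (m + N <= k)%N -> (k <= k')%N -> measurable S ->
    restr (win p m) @^-1` S = S ->
    (chain_law k S <= chain_law k' S + eps%:E)%E /\
    (chain_law k' S <= chain_law k S + eps%:E)%E.
  exists (m + N)%N => k k' Nk Nk' S mS DS.
  by have [kk'|/ltnW kk'] := leqP k k'; [have [] := H k k' S|have [] := H k' k S].
move=> Nk kk' mS DS.
have mk : (m <= k)%N by exact: leq_trans (leq_addr _ _) Nk.
rewrite (chain_law_split mk kk')// (chain_law_start mk)//.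
have [] := @compare _ _ _ _ _ P mP p V p_gt0 mV mu minv m k S mk mS DS
  (run start (- (k' * p)%:Z) ((k' - k) * p)) K ep N A (@env_law_run _ _) (ltW ep0) mA _ _ hA.
- by rewrite le_max lexx.
- by rewrite leq_subRL// ; exact: Nk.
move=> h1 h2.
have c3 : (ep%:E + (mu (~` A) + run start (- (k' * p)%:Z) ((k' - k) * p)
    (level V K (- (k * p)%:Z))) <= eps%:E)%E.
  apply: (@le_trans _ _ (ep%:E + (ep%:E + ep%:E))%E); last first.
    by rewrite -!EFinD lee_fin /ep; lra.
  apply: leeD => //; apply: leeD; first exact: mu_setC_lt.
  apply: le_trans (hK1 k k' kk'); apply: le_measure; rewrite ?inE; [exact: measurable_level..|].
  by move=> f; rewrite /level/= gt_max => /andP[].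
by split; [apply: (le_trans h2)|apply: (le_trans h1)]; rewrite leeD2l.
Qed.

Lemma eq_prob_eps (a b : \bar R) : a \is a fin_num -> b \is a fin_num ->
  (forall eps, 0 < eps -> (a <= b + eps%:E)%E /\ (b <= a + eps%:E)%E) -> a = b.
Proof.
by move=> fa fb h; apply/eqP; rewrite eq_le !le_eps_eq// => eps /h[].
Qed.

Lemma restr_idem (D : pred int) (S : set Xi) :
  restr D @^-1` (restr D @^-1` S) = restr D @^-1` S.
Proof.
apply/seteqP; split => f; rewrite /preimage/= restrI (eq_restr _ _ (D' := D))//.
- by move=> u /=; rewrite andbb.
- by move=> u /=; rewrite andbb.
Qed.

Lemma restrC (D D' : pred int) (f : Xi) : restr D (restr D' f) = restr D' (restr D f).
Proof. by apply/funext => s; rewrite /restr/=; case: (D s); case: (D' s). Qed.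

Lemma measurable_restr_preimage (D : pred int) (S : set Xi) :
  measurable S -> measurable (restr D @^-1` S).
Proof. by move=> mS; rewrite -[X in measurable X]setTI; exact: (measurable_restr _ measurableT mS). Qed.

(** The rate of convergence depends on the window, so a limit is taken on each window; these limits
    are consistent and are glued by [kolmogorov]. *)
Lemma chain_limit : exists M : probability Xi R, forall m eps, 0 < eps -> exists N,
  forall k, (N <= k)%N -> forall S, measurable S -> restr (win p m) @^-1` S = S ->
  (chain_law k S <= M S + eps%:E)%E /\ (M S <= chain_law k S + eps%:E)%E.
Proof.
pose a m k := image_prob (chain_law k) (measurable_restr (win p m) (E:=E) (F:=F)).
have aE m k S : a m k S = chain_law k (restr (win p m) @^-1` S) by [].
have lim m : exists La : probability Xi R, forall eps, 0 < eps -> exists N,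
    forall k, (N <= k)%N -> forall S, measurable S ->
    (a m k S <= La S + eps%:E)%E /\ (La S <= a m k S + eps%:E)%E.
  apply: (tv_limit (a := a m)) => eps eps0.
  have [N hN] := chain_law_cauchy m eps0; exists N => k k' Nk Nk' S mS.
  rewrite !aE; apply: hN => //; first exact: measurable_restr_preimage.
  exact: restr_idem.
pose La m := projT1 (cid (lim m)); have hLa m := projT2 (cid (lim m)).
rewrite -/(La _) in hLa.
have winSp m n t : (m <= n)%N -> win p m t -> win p n t by exact: winS.
have win_cover t : exists m, win p m t.
  exists `|t|.+1%N; have : (`|t|.+1 <= `|t|.+1 * p)%N by rewrite leq_pmulr.
  by rewrite /win; lia.
have consistent m k : (m <= k)%N -> forall S, measurable S ->
    La k (restr (win p m) @^-1` S) = La m S.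
  move=> mk S mS; apply: eq_prob_eps; rewrite ?fin_num_measure//.
    exact: measurable_restr_preimage.
  move=> eps eps0; have e2 : 0 < eps / 2 by rewrite divr_gt0.
  have [N1 h1] := hLa m _ e2; have [N2 h2] := hLa k _ e2.
  pose n := maxn N1 N2.
  have [a1 a2] := h1 n (leq_maxl _ _) S mS.
  have [b1 b2] := h2 n (leq_maxr _ _) _ (measurable_restr_preimage (win p m) mS).
  have e : a k n (restr (win p m) @^-1` S) = a m n S.
    rewrite !aE; congr (chain_law n _); exact: restr_winS mk (restr_idem _ _).
  rewrite e in b1 b2.
  have ee : (eps%:E = (eps / 2)%:E + (eps / 2)%:E)%E by rewrite -EFinD -splitr.
  rewrite ee !addeA; split; [apply: le_trans b2 _|apply: le_trans a2 _]; exact: leeD2r.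
have [codeE [decodeE [mcE mdE cEK]]] := codE.
have [codeF [decodeF [mcF mdF cFK]]] := codF.
have [M hM] := kolmogorov mcE mdE mcF mdF cEK cFK winSp win_cover consistent.
exists M => m eps /(hLa m)[N hN]; exists N => k Nk S mS DS.
by have := hN k Nk S mS; rewrite aE DS -hM// DS.
Qed.

(** Exact for every transition that the run performs: the steps after [t + 1] change neither side,
    and those before [t] are common to both. *)
Lemma chain_law_markov t k S : (- (k * p)%:Z <= t) -> (t < (k * p)%:Z) -> measurable S ->
  chain_law k (restr (upto (t + 1)) @^-1` S) =
  (\int[chain_law k]_f Jop P t (indic S) (restr (upto t) f))%E.
Proof.
move=> kt tk mS; set S' := restr (upto (t + 1)) @^-1` S.
have mS' : measurable S' by exact: measurable_restr_preimage.
pose h f := Jop P t (indic S) (restr (upto t) f).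
have mh : measurable_fun setT h.
  exact: (measurableT_comp (measurable_Jop mP t (mG mS) (@G0 S)) (measurable_restr _)).
have h0 f : (0 <= h f)%E by apply: Jop_ge0; exact: G0.
rewrite runE// -[RHS]/(\int[chain_law k]_f h f)%E integral_run//; apply: eq_integral => f _.
pose a := `|(t + (k * p)%:Z)%R|%N; pose b := (k * p + k * p - a - 1)%N.
have at_ : - (k * p)%:Z + a%:Z = t by rewrite /a; lia.
have -> : (k * p + k * p = a + (1 + b))%N by rewrite /b /a; lia.
rewrite !Jit_add at_; congr (Jit _ _ _ _ _).
have dS' : depends (upto (t + 1)) (indic S').
  by apply: depends_indic; exact: restr_idem.
have dh : depends (upto t) h.
  by move=> g; rewrite /h restrI (eq_restr _ _ (D' := upto t))// => u /=; rewrite andbb.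
have eS n : Jit P (t + 1) n (indic S') = indic S' by exact: (Jit_indep _ dS').
have eh n : Jit P (t + 1) n h = h by apply: (Jit_indep _ dh) => u; rewrite /upto; lia.
rewrite eS eh [RHS](Jit_indep 1 dh)//=.
apply/funext => g; rewrite /h /Jop /restr /upto lexx; apply: eq_integral => z _.
rewrite !indicE; congr ((nat_of_bool _)%:R%:E).
suff e : restr (upto (t + 1)) (upd g (t + 1) z) = upd (restr (upto t) g) (t + 1) z.
  by apply/idP/idP; rewrite !inE /S' /preimage/= e.
apply/funext => u; rewrite /restr /upd /upto; case: eqP => [->|/eqP ut]; first by rewrite lexx; case: ifP.
by congr (if _ then _ else _); lia.
Qed.

(** Both sides are window functionals of the law, but the right one integrates a [0, 1]-valued
    function instead of an indicator, hence [integral_tv_le]. *)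
Lemma chain_limit_markov (M : probability Xi R) :
  (forall m eps, 0 < eps -> exists N,
    forall k, (N <= k)%N -> forall S, measurable S -> restr (win p m) @^-1` S = S ->
    (chain_law k S <= M S + eps%:E)%E /\ (M S <= chain_law k S + eps%:E)%E) ->
  markov mP M.
Proof.
move=> hM t; apply: (windowed_unique p_gt0) => S [mS [m0 DS0]].
pose m := maxn m0 `|t|.+2.
have DS := restr_winS p_gt0 (leq_maxl _ _ : (m0 <= m)%N) DS0.
have tm : - (m * p)%:Z < t /\ t + 1 <= (m * p)%:Z.
  have : (`|t|.+2 <= m)%N by exact: leq_maxr.
  have : (m <= m * p)%N by rewrite leq_pmulr.
  by lia.
have wt : win p m t by rewrite /win; lia.
set S' := restr (upto (t + 1)) @^-1` S.
have mS' : measurable S' by exact: measurable_restr_preimage.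
have dS g : S (restr (win p m) g) = S g by exact: (congr1 (@^~ g) DS).
have DS' : restr (win p m) @^-1` S' = S'.
  by apply/funext => f; rewrite /S' /preimage/= restrC dS.
pose h f := Jop P t (indic S) (restr (upto t) f).
have mJ : measurable_fun setT (Jop P t (indic S)) by apply: measurable_Jop => //; exact: mG.
have mh : measurable_fun setT h by exact: (measurableT_comp mJ (measurable_restr _)).
have h01 f : (0 <= h f <= 1)%E.
  rewrite Jop_ge0/=; last exact: G0.
  by apply: Jop_le1 => //; [exact: mG|exact: indic_01].
have dh : depends (win p m) h.
  move=> f; apply: (dependsP (depends_Jop P t (depends_indic R DS))).
    by rewrite !env_restr.
  move=> u /= /orP[/eqP ->|/andP[wu _]]; rewrite /restr; case: ifP => //.
    by rewrite wt.
  by rewrite wu.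
pose hr f := fine (h f).
have hrE f : (hr f)%:E = h f.
  have /andP[a b] := h01 f.
  by rewrite /hr fineK// ge0_fin_numE// (le_lt_trans b)// ltry.
have mhr : measurable_fun setT hr.
  by apply/measurable_EFinP; apply: (eq_measurable_fun h) => // f _; rewrite /= hrE.
have hr01 f : 0 <= hr f <= 1 by rewrite -!lee_fin hrE h01.
have RHS_ : step mP (past M t) t S = (\int[M]_f h f)%E.
  rewrite bind_probE//; transitivity (\int[past M t]_f Jop P t (indic S) f)%E.
    by apply: eq_integral => f _; rewrite JE.
  by rewrite integral_past// => f; apply: Jop_ge0; exact: G0.
have finh (N : probability Xi R) : (\int[N]_f h f)%E \is a fin_num.
  rewrite ge0_fin_numE; last by apply: integral_ge0 => f _; have /andP[] := h01 f.
  apply: le_lt_trans (ltry 1); rewrite -(@probability_setT _ _ _ N) -[leRHS]mul1e.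
  rewrite -integral_cst//; apply: ge0_le_integral => //=.
    by move=> x _; have /andP[] := h01 x.
  by move=> x _; have /andP[] := h01 x.
have winh (N : probability Xi R) :
    (\int[image_prob N (measurable_restr (win p m))]_f (hr f)%:E = \int[N]_f h f)%E.
  under eq_integral do rewrite hrE.
  rewrite integral_image//; last by move=> f; have /andP[] := h01 f.
  by apply: eq_integral => f _; exact: dh.
rewrite RHS_ -[LHS]/(M S'); apply: eq_prob_eps; rewrite ?fin_num_measure//.
move=> eps eps0; have e2 : 0 < eps / 2 by rewrite divr_gt0.
have [N hN] := hM m _ e2; pose k := maxn N m.
have hk := hN k (leq_maxl _ _).
have [a1 a2] := hk _ mS' DS'.
have kp : (m * p <= k * p)%N by rewrite mulp_le// leq_maxr.
have chm := @chain_law_markov t k S _ _ mS.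
have {}chm : chain_law k S' = (\int[chain_law k]_f h f)%E by apply: chm; lia.
have closeM (N1 N2 : probability Xi R) :
    (forall S, measurable S -> restr (win p m) @^-1` S = S -> (N1 S <= N2 S + (eps / 2)%:E)%E) ->
    (\int[N1]_f h f <= \int[N2]_f h f + (eps / 2)%:E)%E.
  move=> h12; rewrite -!winh; apply: integral_tv_le => // B mB; apply: h12.
    exact: measurable_restr_preimage.
  exact: restr_idem.
have b1 : (\int[M]_f h f <= \int[chain_law k]_f h f + (eps / 2)%:E)%E.
  by apply: closeM => B mB DB; have [] := hk B mB DB.
have b2 : (\int[chain_law k]_f h f <= \int[M]_f h f + (eps / 2)%:E)%E.
  by apply: closeM => B mB DB; have [] := hk B mB DB.
rewrite chm in a1 a2.
rewrite (_ : eps%:E = (eps / 2)%:E + (eps / 2)%:E)%E; last by rewrite -EFinD -splitr.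
rewrite !addeA; split; [apply: le_trans a2 _|apply: le_trans b1 _]; exact: leeD2r.
Qed.

Lemma exists_tight_markov : exists M : probability Xi R,
  [/\ env_law mu M, markov mP M & tight p V M].
Proof.
have [M hM] := chain_limit; exists M; split.
- move=> A mA; have mS : measurable (@env _ _ E F @^-1` A).
    by rewrite -[X in measurable X]setTI; exact: (measurable_env measurableT mA).
  apply: eq_prob_eps; rewrite ?fin_num_measure// => eps eps0.
  (* [win p 0] is empty, so events of the environment alone are window events with [m = 0]. *)
  have [N hN] := hM 0%N _ eps0; have := hN N (leqnn N) _ mS.
  rewrite env_law_chain// => h; have [|h1 h2] := h; last by split.
  by apply/seteqP; split => f; rewrite /preimage/= env_restr.
- exact: chain_limit_markov.
- move=> eps eps0; have e2 : 0 < eps / 2 by rewrite divr_gt0.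
  have [K hK] := tight_run e2; exists K => k.
  have mS : measurable (level V K (- (k * p)%:Z) : set Xi) by exact: measurable_level.
  have DS : restr (win p k.+1) @^-1` level V K (- (k * p)%:Z) = level V K (- (k * p)%:Z) :> set Xi.
    (* The window is [k.+1] because [-kp] is the excluded left end of [win p k]. *)
    have wk : win p k.+1 (- (k * p)%:Z) by rewrite /win mulSn; lia.
    by apply/seteqP; split => f; rewrite /preimage /level/= /restr wk.
  have [N hN] := hM k.+1 _ e2; pose k' := maxn N k.+1.
  have [_ h2] := hN k' (leq_maxl _ _) _ mS DS.
  apply: (le_trans h2); have kk' : (k <= k')%N by exact: leq_trans (leqnSn k) (leq_maxr _ _).
  suff -> : chain_law k' (level V K (- (k * p)%:Z)) =
      run start (- (k' * p)%:Z) ((k' - k) * p) (level V K (- (k * p)%:Z)).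
    apply: (le_trans (leeD2r _ (hK k k' kk'))); rewrite -EFinD lee_fin; lra.
  rewrite /chain_law !runE//; apply: eq_integral => f _.
  have -> : (k' * p + k' * p = (k' - k) * p + (k * p + k' * p))%N.
    by have := mulp_le kk'; rewrite mulnBl; lia.
  rewrite Jit_add; congr (Jit _ _ _ _ _).
  have -> : - (k' * p)%:Z + ((k' - k) * p)%N = - (k * p)%:Z :> int.
    by have := mulp_le kk'; rewrite mulnBl; lia.
  apply: (@Jit_indep _ _ (pred1 (- (k * p)%:Z))); last by move=> u /= /eqP ->.
  apply: depends_indic; apply/seteqP; split => g;
  by rewrite /preimage /level/= /restr /= eqxx.
Qed.

End existence.

(** * Stationarity *)

Section conditional_form.
Context (R : realType) dE dF (E : measurableType dE) (F : measurableType dF)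
  (P : F -> E -> probability E R).
Hypothesis mP : forall A, measurable A ->
  measurable_fun setT (fun xy : F * E => P xy.1 xy.2 A).
Local Notation Xi := (path (E * F)%type).
Local Notation indic S := (fun f : Xi => (\1_S f : R)%:E).

Definition up_to (t : int) (C : set Xi) := measurable C /\ restr (upto t) @^-1` C = C.

Definition next_in (t : int) (A : set E) : set Xi := [set f | A (f (t + 1)).1].

Lemma measurable_next_in t A : measurable A -> measurable (next_in t A).
Proof.
move=> mA; rewrite -[X in measurable X]setTI.
exact: (measurableT_comp measurable_fst (measurable_coord (t + 1)) measurableT mA).
Qed.

Lemma measurable_kernel_at t A : measurable A ->
  measurable_fun setT (fun f : Xi => P (f t).2 (f t).1 A).
Proof.
move=> mA; apply: (@measurableT_comp _ _ _ _ _ _ _ _ (fun f : Xi => ((f t).2, (f t).1)) (mP mA)).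
apply/measurable_fun_pair => /=.
  exact: (measurableT_comp measurable_snd (measurable_coord t)).
exact: (measurableT_comp measurable_fst (measurable_coord t)).
Qed.

Lemma restr_upd_next t f z :
  restr (upto (t + 1)) (upd (restr (upto t) f) (t + 1) z) = upd (restr (upto t) f) (t + 1) z :> Xi.
Proof.
rewrite restr_upd_in ?restrI; last by rewrite /upto lexx.
congr upd; apply/funext => s; rewrite /restr /upto/=; congr (if _ then _ else _); lia.
Qed.

Lemma restr_upd_past t f z :
  restr (upto t) (upd (restr (upto t) f) (t + 1) z) = restr (upto t) f :> Xi.
Proof.
rewrite restr_upd_out ?restrI; last by rewrite /upto; lia.
by apply/funext => s; rewrite /restr/= andbb.
Qed.

Lemma step_pastE (M : probability Xi R) t S : measurable S ->
  step mP (past M t) t S = (\int[M]_f Jop P t (indic S) (restr (upto t) f))%E.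
Proof.
move=> mS; have mI : measurable_fun setT (indic S) by exact: measurable_indic_E.
rewrite bind_probE//.
transitivity (\int[past M t]_f Jop P t (indic S) f)%E.
  by apply: eq_integral => f _; rewrite JE.
rewrite integral_past//; first exact: measurable_Jop.
by move=> f; apply: Jop_ge0 => g; exact: indic_ge0.
Qed.

Lemma Jop_next t (C : set Xi) A f : up_to t C -> measurable A ->
  Jop P t (indic (C `&` next_in t A)) (restr (upto t) f) =
  ((\1_C f)%:E * P (f t).2 (f t).1 A)%E.
Proof.
move=> [mC DC] mA; rewrite /Jop {1 2}/restr /upto lexx -/(upto t).
have Cx g : C (restr (upto t) g) = C g by exact: (congr1 (@^~ g) DC).
have mA1 : measurable_fun setT (fun z => (\1_A z : R)%:E).
  exact/measurable_EFinP/measurable_indic.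
transitivity (\int[P (f t).2 (f t).1]_z ((\1_C f)%:E * (\1_A z)%:E))%E.
  apply: eq_integral => z _; rewrite -EFinM !indicE.
  rewrite -natrM mulnb; congr ((nat_of_bool _)%:R%:E).
  set g := upd _ _ _; have gC : C g = C f by rewrite -Cx /g restr_upd_past Cx.
  have gA : next_in t A g = A z by rewrite /next_in /g /= /upd eqxx.
  by rewrite in_setI; congr andb; apply/idP/idP; rewrite !inE ?gC ?gA.
rewrite ge0_integralZl_EFin//.
by rewrite integral_indic// setIT.
Qed.

Lemma integral_indic_mul (M : probability Xi R) (C : set Xi) (h : Xi -> \bar R) :
  measurable C -> (\int[M]_f ((\1_C f)%:E * h f) = \int[M]_(f in C) h f)%E.
Proof.
move=> mC; rewrite [RHS]integral_mkcond; apply: eq_integral => f _.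
by rewrite epatch_indic muleC.
Qed.

(** Tests the transition against past events, the form in which shifts and conditioning are easy and
    to which [is_cond_prob] reduces. *)
Definition cond_markov (M : probability Xi R) t := forall C A, up_to t C -> measurable A ->
  M (C `&` next_in t A) = (\int[M]_(f in C) P (f t).2 (f t).1 A)%E.

Lemma markov_cond M t : markov_at mP M t -> cond_markov M t.
Proof.
move=> mM C A uC mA; have [mC DC] := uC.
have mB : measurable (C `&` next_in t A) by apply: measurableI => //; exact: measurable_next_in.
have e := mM _ mB; rewrite step_pastE// in e.
transitivity (M (restr (upto (t + 1)) @^-1` (C `&` next_in t A))).
  congr (M _); apply/seteqP; split => f.
    move=> [Cf Af]; split; last by rewrite /next_in/= /restr /upto lexx.
    rewrite /= -DC /preimage/= restrI; move: Cf; rewrite -{1}DC /preimage/=.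
    by congr C; apply/funext => s; rewrite /restr /upto/=; congr (if _ then _ else _); lia.
  rewrite /preimage/= => -[Cf Af]; split; last by move: Af; rewrite /next_in/= /restr /upto lexx.
  move: Cf; rewrite -{1}DC /preimage/= restrI -{2}DC /preimage/=.
  by congr C; apply/funext => s; rewrite /restr /upto/=; congr (if _ then _ else _); lia.
rewrite [LHS]e.
by rewrite -[RHS]integral_indic_mul//; apply: eq_integral => f _; exact: Jop_next.
Qed.

Lemma pair_path_unique (M M' : probability Xi R) (G : set (set Xi)) :
  setI_closed G -> G `<=` measurable ->
  (forall t A, measurable A -> G ((fun f : Xi => (f t).1) @^-1` A)) ->
  (forall t A, measurable A -> G ((fun f : Xi => (f t).2) @^-1` A)) ->
  (forall S, G S -> M S = M' S) -> forall S, measurable S -> M S = M' S.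
Proof.
move=> GI mG G1 G2 MM.
apply: (@measure_unique _ _ _ G (fun=> setT)) => //.
- apply/seteqP; split; last by apply: smallest_sub => //; exact: sigma_algebra_measurable.
  apply: smallest_sub; first exact: smallest_sigma_algebra.
  move=> _ [i [A [mA ->]]].
  have : measurable_fun setT (fun f : g_sigma_algebraType G => (f i : E * F)).
    apply/measurable_fun_pairP; split => _ B mB; rewrite setTI; apply: sub_gen_smallest.
      exact: G1.
    exact: G2.
  by move=> /(_ measurableT _ mA); rewrite setTI.
- by move=> _; rewrite (_ : setT = (fun f : Xi => (f 0).1) @^-1` setT)//; exact: G1.
- by apply/seteqP; split => // x _; exists 0%N.
- by move=> _; rewrite [X in (X < _)%E](probability_setT M) ltry.
Qed.

Lemma up_to_fst s t A : s <= t -> measurable A ->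
  up_to t ((fun f : Xi => (f s).1) @^-1` A).
Proof.
move=> st mA; split.
  rewrite -[X in measurable X]setTI.
  exact: (measurableT_comp measurable_fst (measurable_coord s) measurableT mA).
by apply/seteqP; split => f; rewrite /preimage/= /restr /upto st.
Qed.

Lemma up_to_snd s t A : measurable A -> up_to t ((fun f : Xi => (f s).2) @^-1` A).
Proof.
move=> mA; split.
  rewrite -[X in measurable X]setTI.
  exact: (measurableT_comp measurable_snd (measurable_coord s) measurableT mA).
by apply/seteqP; split => f; rewrite /preimage/= /restr; case: ifP.
Qed.

(** The events that reduce, once [Y] is erased beyond [t + 1], to a past event intersected with one
    on [Y_{t+1}] form a generating pi-system, and on them the two forms coincide. *)
Lemma cond_markovP M t : cond_markov M t -> markov_at mP M t.
Proof.
move=> cM.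
pose G := [set B : set Xi | measurable B /\ exists C A, [/\ up_to t C, measurable A &
  restr (upto (t + 1)) @^-1` B = C `&` next_in t A]].
have upT : up_to t setT by split.
have up0 : up_to t set0 by split.
have nT : next_in t setT = setT by [].
apply: (@pair_path_unique _ _ G).
- move=> B B' [mB [C [A [[mC DC] mA BE]]]] [mB' [C' [A' [[mC' DC'] mA' BE']]]].
  split; first exact: measurableI.
  exists (C `&` C'), (A `&` A'); split.
  + by split; [exact: measurableI|rewrite preimage_setI DC DC'].
  + exact: measurableI.
  + by rewrite preimage_setI BE BE' setIACA.
- by move=> B [].
- move=> s A mA; split.
    rewrite -[X in measurable X]setTI.
    exact: (measurableT_comp measurable_fst (measurable_coord s) measurableT mA).
  have [st|] := boolP (s <= t).
    exists ((fun f : Xi => (f s).1) @^-1` A), setT; split=> //; first exact: up_to_fst.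
    rewrite nT setIT; apply/seteqP; split => f; rewrite /preimage/= /restr /upto.
      by rewrite (_ : s <= t + 1)//; lia.
    by rewrite (_ : s <= t + 1)//; lia.
  have [->|st1] := eqVneq s (t + 1).
    exists setT, A; split=> //; rewrite setTI; apply/seteqP; split => f;
    by rewrite /preimage/next_in/= /restr /upto lexx.
  (* Beyond [t + 1] the erased coordinate is [point], so the event becomes everything or nothing. *)
  move=> st; have su : upto (t + 1) s = false by rewrite /upto; lia.
  have [Ap|nAp] := pselect (A point).
    exists setT, setT; split=> //; rewrite nT setIT; apply/seteqP; split => f //=.
    by rewrite /preimage/= /restr su.
  exists set0, setT; split=> //; rewrite set0I; apply/seteqP; split => f //=.
  by rewrite /preimage/= /restr su.
- move=> s A mA; split; first by have [] := up_to_snd s t mA.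
  exists ((fun f : Xi => (f s).2) @^-1` A), setT; split=> //; first exact: up_to_snd.
  rewrite nT setIT; apply/seteqP; split => f; rewrite /preimage/= /restr; by case: ifP.
move=> B [mB [C [A [uC mA BE]]]].
rewrite -[LHS]/(M (restr (upto (t + 1)) @^-1` B)) BE cM// step_pastE//.
rewrite -[LHS]integral_indic_mul; last by case: uC.
apply: eq_integral => f _; rewrite -Jop_next//; apply: eq_integral => z _.
rewrite !indicE -BE; congr ((nat_of_bool _)%:R%:E).
by apply/idP/idP; rewrite !inE /preimage/= restr_upd_next.
Qed.

End conditional_form.

Section stationarity.
Context (R : realType) dE dF (E : measurableType dE) (F : measurableType dF)
  (P : F -> E -> probability E R).
Hypothesis mP : forall A, measurable A ->
  measurable_fun setT (fun xy : F * E => P xy.1 xy.2 A).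
Variables (p : nat) (V : E -> R).
Hypotheses (p_gt0 : (0 < p)%N) (mV : measurable_fun setT V) (V0 : forall y, 0 <= V y).
Variable mu : probability (path F) R.
Hypothesis minv : forall h S, measurable S -> mu (shiftn h @^-1` S) = mu S.
Local Notation Xi := (path (E * F)%type).

Definition shifted (M : probability Xi R) h : probability Xi R :=
  image_prob M (measurable_shiftn (T := (E * F)%type) h).

Lemma shiftedE M h S : shifted M h S = M (shiftn h @^-1` S). Proof. by []. Qed.

Lemma shiftn_shiftn d (T : measurableType d) h h' (f : path T) :
  shiftn h (shiftn h' f) = shiftn (h + h') f.
Proof. by apply/funext => t; rewrite /shiftn; congr f; rewrite addrA. Qed.

Lemma shiftn0 d (T : measurableType d) (f : path T) : shiftn 0 f = f.
Proof. by apply/funext => t; rewrite /shiftn addr0. Qed.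

Lemma restr_shiftn t h (f : Xi) :
  restr (upto t) (shiftn h f) = shiftn h (restr (upto (t + h)) f).
Proof. by apply/funext => s; rewrite /restr /shiftn /upto lerD2r. Qed.

Lemma measurable_shiftn_preimage d (T : measurableType d) h (S : set (path T)) :
  measurable S -> measurable (shiftn h @^-1` S).
Proof. by move=> mS; rewrite -[X in measurable X]setTI; exact: (measurable_shiftn h measurableT mS). Qed.

Lemma up_to_shiftn t h (C : set Xi) : up_to t C -> up_to (t + h) (shiftn h @^-1` C).
Proof.
move=> [mC DC]; split; first exact: measurable_shiftn_preimage.
have Cx g : C (restr (upto t) g) = C g by exact: (congr1 (@^~ g) DC).
by apply/seteqP; split => f; rewrite /preimage/= -restr_shiftn Cx.
Qed.

Lemma shifted_markov M h : markov mP M -> markov mP (shifted M h).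
Proof.
move=> mM t; apply: cond_markovP => C A uC mA.
have e : shiftn h @^-1` (C `&` next_in t A) = (shiftn h @^-1` C) `&` next_in (t + h) A.
  by rewrite preimage_setI; congr (_ `&` _); apply/seteqP; split => f;
    rewrite /preimage/next_in/= /shiftn addrAC.
have [mC _] := uC.
rewrite shiftedE e (markov_cond (mM (t + h)) (up_to_shiftn h uC) mA).
rewrite -[LHS]integral_indic_mul; last exact: measurable_shiftn_preimage.
rewrite -[RHS]integral_indic_mul//.
pose G f := ((\1_C f)%:E * P (f t).2 (f t).1 A)%E : \bar R.
have mG : measurable_fun setT (G : Xi -> \bar R).
  by apply: emeasurable_funM; [exact: measurable_indic_E|exact: measurable_kernel_at].
have G0 f : (0 <= G f)%E by rewrite mule_ge0// lee_fin.
by rewrite -[RHS]/(\int[shifted M h]_f G f)%E /shifted (integral_image _ _ mG G0).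
Qed.

Lemma shifted_env_law M h : env_law mu M -> env_law mu (shifted M h).
Proof.
move=> eM A mA; rewrite shiftedE -[RHS](minv h mA) -eM//.
exact: measurable_shiftn_preimage.
Qed.

Lemma level_tail (M : probability Xi R) t eps : 0 < eps ->
  exists K, (M (level V K t) <= eps%:E)%E.
Proof.
move=> eps0.
have mL (n : nat) : measurable (level V n%:R t : set Xi) by exact: measurable_level.
have [|||n hn] := @measure_incr_gt _ _ _ M (fun n : nat => ~` level V n%:R t) (1 - eps)%:E.
- by move=> n; exact: measurableC.
- move=> n m nm f /=; rewrite /level/= => h1 h2; apply: h1; apply: le_lt_trans h2.
  by rewrite ler_nat.
- rewrite (_ : \bigcup_n _ = setT) ?probability_setT ?lte_fin; first by lra.
  apply/seteqP; split => // f _; exists (Num.bound (V (f t).1)) => //.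
  rewrite /level/=; apply/negP; rewrite -leNgt ltW// archi_boundP//.
exists n%:R; move: hn; rewrite probability_setC//.
have : M (level V n%:R t) \is a fin_num by exact: fin_num_measure.
by move=> /fineK <-; rewrite -EFinB lte_fin lee_fin => ?; lra.
Qed.

Lemma tight_const (M : probability Xi R) :
  (forall K k, M (level V K (- (k * p)%:Z)) = M (level V K 0)) -> tight p V M.
Proof.
by move=> h eps /(level_tail M 0)[K hK]; exists K => k; rewrite h.
Qed.

Lemma level_shiftn K t h : shiftn h @^-1` level V K t = level V K (t + h) :> set Xi.
Proof. by []. Qed.

Lemma stationary_tight (M : probability Xi R) :
  (forall h S, measurable S -> M (shiftn h @^-1` S) = M S) -> tight p V M.
Proof.
move=> sM; apply: tight_const => K k.
by rewrite -(sM (- (k * p)%:Z) (level V K 0))// ?level_shiftn ?add0r//; exact: measurable_level.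
Qed.

Hypothesis unique : forall M M' : probability Xi R, env_law mu M -> env_law mu M' ->
  markov mP M -> markov mP M' -> tight p V M -> tight p V M' ->
  forall S, measurable S -> M S = M' S.

(* Invariance under the shift by [-p] comes first: it makes the law of [Y] at time [-kp-1]
   independent of [k], so that the law shifted by [-1] is tight too. *)
Lemma tight_markov_stationary (M : probability Xi R) : env_law mu M -> markov mP M ->
  tight p V M -> forall h S, measurable S -> M (shiftn h @^-1` S) = M S.
Proof.
move=> eM mM tM.
have tp : tight p V (shifted M (- p%:Z)).
  move=> eps /tM[K hK]; exists K => k; rewrite shiftedE level_shiftn.
  by apply: le_trans (hK k.+1); rewrite mulSn PoszD opprD addrC.
have invp S : measurable S -> M (shiftn (- p%:Z) @^-1` S) = M S.
  move=> mS; rewrite -shiftedE; apply: unique => //; first exact: shifted_env_law.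
  exact: shifted_markov.
have lev K (k : nat) t : M (level V K (t - (k * p)%:Z)) = M (level V K t).
  elim: k => [|k ih]; first by rewrite mul0n subr0.
  rewrite -{}ih -[RHS]invp; last exact: measurable_level.
  by rewrite level_shiftn mulSn PoszD opprD addrA addrAC.
have t1 : tight p V (shifted M (-1)).
  apply: tight_const => K k; rewrite !shiftedE !level_shiftn add0r addrC; exact: lev.
have inv1 S : measurable S -> M (shiftn (-1) @^-1` S) = M S.
  move=> mS; rewrite -shiftedE; apply: unique => //; first exact: shifted_env_law.
  exact: shifted_markov.
have invN (n : nat) S : measurable S -> M (shiftn (- n%:Z) @^-1` S) = M S.
  elim: n S => [|n ih] S mS.
    by rewrite oppr0; congr (M _); apply/seteqP; split => f; rewrite /preimage/= shiftn0.
  rewrite -[RHS]inv1// -[RHS]ih; last exact: measurable_shiftn_preimage.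
  congr (M _); apply/seteqP; split => f; rewrite /preimage/= shiftn_shiftn.
    by rewrite (_ : -1 - n%:Z = - n.+1%:Z)//; lia.
  by rewrite (_ : -1 - n%:Z = - n.+1%:Z)//; lia.
move=> h S mS; have [h0|h0] := leP h 0.
  by rewrite (_ : h = - `|h|%N%:Z); [exact: invN|lia].
rewrite -[LHS](invN `|h|%N); last exact: measurable_shiftn_preimage.
have e : h - `|h|%N%:Z = 0 by lia.
congr (M _); apply/seteqP; split => f; rewrite /preimage/= shiftn_shiftn e shiftn0//.
Qed.

End stationarity.

(** * Ergodicity *)

Section extremality.
Context (R : realType) d (T : measurableType d) (mu nu : probability (path T) R).
Hypothesis muI : forall h S, measurable S -> mu (shiftn h @^-1` S) = mu S.
Hypothesis nuI : forall h S, measurable S -> nu (shiftn h @^-1` S) = nu S.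
Hypothesis dom : forall S, measurable S -> mu S = 0%E -> nu S = 0%E.
Hypothesis erg : forall S, measurable S -> S = shiftn 1 @^-1` S ->
  mu S = 0%E \/ mu S = 1%E.
Local Notation phi A := (fine (nu A) - fine (mu A)).

Let fineU (m : probability (path T) R) A B : measurable A -> measurable B ->
  fine (m (A `|` B)) = fine (m A) + fine (m B) - fine (m (A `&` B)).
Proof.
move=> mA mB; have -> : A `|` B = A `|` (B `\` A) by rewrite setUDr setDv setD0.
rewrite measureU//; [|exact: measurableD|by rewrite setDE setICA setICr setI0].
have -> : m B = (m (A `&` B) + m (B `\` A))%E.
  by rewrite setIC addeC -measureDI.
have fm C : measurable C -> m C \is a fin_num by exact: fin_num_measure.
rewrite !fineD ?fm//; [by lra|exact: measurableI|exact: measurableD|exact: measurableD].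
Qed.

Let maximal A := measurable A /\ forall B, measurable B -> phi B <= phi A.

Let exists_maximal : exists A, maximal A.
Proof.
pose nc : {charge set (path T) -> \bar R} := charge_of_finite_measure nu.
pose mc : {charge set (path T) -> \bar R} := charge_of_finite_measure mu.
pose c : {charge set (path T) -> \bar R} := cadd nc (cscale (-1) mc).
have cE A : measurable A -> c A = (phi A)%:E.
  move=> mA; rewrite /c/= /cadd/= /cscale/= EFinB !fineK ?fin_num_measure//.
  by rewrite mulN1e.
have [D [N [[mD posD] [mN negN] DN DN0]]] := Hahn_decomposition c.
exists D; split=> // B mB; have mBD : measurable (B `&` D) by exact: measurableI.
have mBN : measurable (B `&` N) by exact: measurableI.
have mDB : measurable (D `\` B) by exact: measurableD.
have p1 : 0 <= phi (D `\` B).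
  by rewrite -lee_fin -cE//; apply: posD => //; exact: subDsetl.
have p2 : phi (B `&` N) <= 0.
  by rewrite -lee_fin -cE//; apply: negN => //; exact: subIsetr.
have NE : N = ~` D.
  apply/seteqP; split => f; last by move=> nD; have [] : (D `|` N) f by rewrite DN.
  by move=> Nf Df; have : (D `&` N) f by []; rewrite DN0.
have split (m : probability (path T) R) A C : measurable A -> measurable C ->
    fine (m A) = fine (m (A `\` C)) + fine (m (A `&` C)).
  move=> mA mC; rewrite (measureDI m mA mC) fineD// fin_num_measure//.
    exact: measurableD.
  exact: measurableI.
move: p1 p2; rewrite NE -setDE.
rewrite (split nu D B)// (split mu D B)// (split nu B D)// (split mu B D)//.
by rewrite (setIC D B); lra.
Qed.

(** By inclusion-exclusion for [phi]: the intersection has [phi] at most [phi B], so joining [B] to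
    [A] loses nothing. *)
Let maximalU A B : maximal A -> maximal B -> maximal (A `|` B).
Proof.
move=> [mA hA] [mB hB]; split=> [|C mC]; first exact: measurableU.
apply: le_trans (hA _ mC) _; rewrite !fineU//.
by have := hB _ (measurableI _ _ mA mB); lra.
Qed.

Let maximal_shiftn h A : maximal A -> maximal (shiftn h @^-1` A).
Proof.
move=> [mA hA]; split; first exact: measurable_shiftn_preimage.
by rewrite nuI// muI.
Qed.

(** Uses no density: a Hahn positive set maximizes [phi], and maximal sets are stable under shifts
    and unions, so the union of the shifts of [D] is invariant with the same [phi]. By ergodicity it
    is [mu]-null or of full [mu]-measure, and domination makes [phi] vanish on it; thus [nu <= mu],
    and complements give equality. *)
Lemma ergodic_extremal S : measurable S -> nu S = mu S.
Proof.
have [D maxD] := exists_maximal.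
(* Shifting in both directions makes the union invariant as an equality of sets, which [erg]
   requires. *)
pose U := fix U n := if n is n'.+1
  then U n' `|` (shiftn 1 @^-1` U n' `|` shiftn (-1) @^-1` U n') else D.
have maxU n : maximal (U n).
  elim: n => [//|n ih] /=.
  by apply: maximalU => //; apply: maximalU; exact: maximal_shiftn.
have mU n : measurable (U n) by have [] := maxU n.
pose W := \bigcup_n U n.
have mW : measurable W by exact: bigcup_measurable.
have nd : nondecreasing_seq U.
  by apply/nondecreasing_seqP => n; apply/subsetPset; exact: subsetUl.
have invW : W = shiftn 1 @^-1` W.
  apply/seteqP; split => f [n _ Un]; exists n.+1 => //=; right.
    by right; rewrite /preimage/= shiftn_shiftn (_ : -1 + 1 = 0) ?shiftn0.
  by left.
have phiU n : phi (U n) = phi D.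
  by apply/eqP; rewrite eq_le (maxD.2 _ (mU n)) ((maxU n).2 _ maxD.1).
have cv (m : probability (path T) R) : fine (m (U n)) @[n --> \oo] --> fine (m W).
  apply: fine_cvg; rewrite fineK ?fin_num_measure//.
  exact: nondecreasing_cvg_mu.
have phiW : phi W = phi D.
  have : phi (U n) @[n --> \oo] --> phi W by exact: cvgB.
  under eq_fun do rewrite phiU.
  by move/(cvg_unique (@Rhausdorff R)) => /(_ _ (@cvg_cst _ _ _ _ _)) <-.
have phi0 : phi D = 0.
  rewrite -phiW; case: (erg mW invW) => muW.
    by rewrite muW dom// subrr.
  have : nu (~` W) = 0%E.
    apply: dom; first exact: measurableC.
    by rewrite probability_setC// muW subee.
  rewrite muW probability_setC// => /eqP.
  rewrite -(fineK (fin_num_measure nu _ mW)) -EFinB eqe subr_eq0 => /eqP e.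
  by rewrite -e subrr.
move=> mS; have hS := maxD.2 _ mS; have hC := maxD.2 _ (measurableC mS).
move: hS hC; rewrite phi0 !probability_setC// !fineB ?fin_num_measure//=.
move=> h1 h2; rewrite -(fineK (fin_num_measure nu _ mS)) -(fineK (fin_num_measure mu _ mS)).
by congr EFin; lra.
Qed.

End extremality.

Section conditioning.
Context (R : realType) d (T : measurableType d) (M : probability T R).
Variables (S : set T) (mS : measurable S).
Hypothesis S_gt0 : (0 < M S)%E.

Definition given : probability T R := mnormalize (mrestr M mS) M.

Lemma givenE A : given A = (M (A `&` S) * ((fine (M S))^-1)%:E)%E.
Proof.
rewrite /given/= /mnormalize/= /mrestr/= setTI ifF//.
by apply/negbTE; rewrite negb_or gt_eqF//= lt_eqF// ltey_eq fin_num_measure.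
Qed.

Lemma integral_given C h : measurable C -> measurable_fun setT h ->
  (forall x, 0 <= h x)%E ->
  (\int[given]_(x in C) h x = ((fine (M S))^-1)%:E * \int[M]_(x in C `&` S) h x)%E.
Proof.
move=> mC mh h0; have r0 : 0 <= (fine (M S))^-1 by rewrite invr_ge0 fine_ge0.
have mCS : measurable (C `&` S) by exact: measurableI.
have mCD : measurable (C `\` S) by exact: measurableD.
transitivity (\int[mscale (NngNum r0) (mrestr M mS)]_(x in C) h x)%E.
  apply: eq_measure_integral => A mA _ /=.
  by rewrite givenE /mscale/= /mrestr muleC.
rewrite ge0_integral_mscale//=; last exact: measurable_funTS.
congr *%E; rewrite -{1}(setUIDK C S) ge0_integral_setU//=; last first.
- by rewrite disj_set2E setDE setIACA setICr setI0.
- exact: measurable_funTS.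
rewrite [X in (_ + X)%E]null_set_integral//= ?adde0//; last 2 first.
- by exact: measurable_funTS.
- by rewrite /mrestr setDE -setIA setICl setI0 measure0.
apply: eq_measure_integral => A mA AC; rewrite /= /mrestr.
by congr (M _); apply/seteqP; split=> [x []//|x Ax]; split=> //; have [] := AC _ Ax.
Qed.

End conditioning.

Section ergodicity.
Context (R : realType) dE dF (E : measurableType dE) (F : measurableType dF)
  (P : F -> E -> probability E R).
Hypothesis mP : forall A, measurable A ->
  measurable_fun setT (fun xy : F * E => P xy.1 xy.2 A).
Variables (p : nat) (V : E -> R).
Hypotheses (p_gt0 : (0 < p)%N) (mV : measurable_fun setT V) (V0 : forall y, 0 <= V y).
Variable mu : probability (path F) R.
Hypothesis minv : forall h S, measurable S -> mu (shiftn h @^-1` S) = mu S.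
Local Notation Xi := (path (E * F)%type).

Definition past_approx (M : probability Xi R) (S : set Xi) := forall eps, 0 < eps ->
  exists t (C : set Xi), [/\ up_to t C, (M (S `\` C) <= eps%:E)%E & (M (C `\` S) <= eps%:E)%E].

Lemma up_toS s t (C : set Xi) : s <= t -> up_to s C -> up_to t C.
Proof.
move=> st [mC DC]; split=> //.
have Cx g : C (restr (upto s) g) = C g by exact: (congr1 (@^~ g) DC).
apply/funext => f; rewrite /preimage/= -[LHS]Cx restrI -[RHS]Cx.
congr C; apply/funext => u; rewrite /restr /upto/=; congr (if _ then _ else _); lia.
Qed.

Lemma up_toU t (C D : set Xi) : up_to t C -> up_to t D -> up_to t (C `|` D).
Proof.
by move=> [mC DC] [mD DD]; split; [exact: measurableU|rewrite preimage_setU DC DD].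
Qed.

Lemma up_toI t (C D : set Xi) : up_to t C -> up_to t D -> up_to t (C `&` D).
Proof.
by move=> [mC DC] [mD DD]; split; [exact: measurableI|rewrite preimage_setI DC DD].
Qed.

Lemma up_toC t (C : set Xi) : up_to t C -> up_to t (~` C).
Proof.
by move=> [mC DC]; split; [exact: measurableC|rewrite -[in RHS]DC].
Qed.

Lemma up_to_coord t A : measurable A -> up_to t ((fun f : Xi => f t) @^-1` A).
Proof.
move=> mA; split.
  by rewrite -[X in measurable X]setTI; exact: (measurable_coord t measurableT mA).
by apply/seteqP; split => f; rewrite /preimage/= /restr /upto lexx.
Qed.

Lemma past_approxU M S S' : measurable S -> measurable S' ->
  past_approx M S -> past_approx M S' -> past_approx M (S `|` S').
Proof.
move=> mS mS' aS aS' eps eps0; have e2 : 0 < eps / 2 by rewrite divr_gt0.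
have [t [C [uC h1 h2]]] := aS _ e2; have [t' [C' [uC' h1' h2']]] := aS' _ e2.
have uC1 : up_to (Num.max t t') C by apply: up_toS uC; rewrite le_max lexx.
have uC2 : up_to (Num.max t t') C' by apply: up_toS uC'; rewrite le_max lexx orbT.
have [[mC _] [mC' _]] := (uC, uC').
exists (Num.max t t'), (C `|` C'); split; first exact: up_toU.
- apply: (@le_trans _ _ (M ((S `\` C) `|` (S' `\` C')))%E).
    apply: le_measure; rewrite ?inE.
    + by apply: measurableD; exact: measurableU.
    + by apply: measurableU; exact: measurableD.
    + by move=> f [[] Sf nC]; [left|right]; split=> //; apply: contra_not nC => ?; [left|right].
  rewrite [eps]splitr EFinD; apply: le_trans (leeD h1 h1').
  by apply: measureU2; exact: measurableD.
apply: (@le_trans _ _ (M ((C `\` S) `|` (C' `\` S')))%E).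
  apply: le_measure; rewrite ?inE.
  + by apply: measurableD; exact: measurableU.
  + by apply: measurableU; exact: measurableD.
  + by move=> f [[] Sf nC]; [left|right]; split=> //; apply: contra_not nC => ?; [left|right].
rewrite [eps]splitr EFinD; apply: le_trans (leeD h2 h2').
by apply: measureU2; exact: measurableD.
Qed.

(** The approximable events form a sigma-algebra containing the coordinate events; a countable union
    is first truncated at the cost of [eps / 2]. *)
Lemma past_approximation M S : measurable S -> past_approx M S.
Proof.
move: S; suff : measurable `<=` [set S : set Xi | measurable S /\ past_approx M S].
  by move=> h S /h[].
have up0 t : up_to t (set0 : set Xi) by split.
apply: smallest_sub; last first.
  move=> _ [t [A [mA ->]]]; have u := up_to_coord t mA; split; first by have [] := u.
  move=> eps eps0; exists t, ((fun f : Xi => f t) @^-1` A); split=> //;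
  by rewrite setDv measure0 lee_fin ltW.
split.
- split=> // eps eps0; exists 0, set0; split=> //; by rewrite setDv measure0 lee_fin ltW.
- move=> S [mS aS]; rewrite setTD; split; first exact: measurableC.
  move=> eps eps0; have [t [C [uC h1 h2]]] := aS _ eps0.
  exists t, (~` C); split; first exact: up_toC.
    by rewrite setDE setCK setIC -setDE.
  by rewrite setDE setCK setIC -setDE.
- move=> A hA; have mA (n : nat) : measurable (A n : set Xi) by have [] := hA n.
  have mW : measurable (\bigcup_n A n : set Xi) by exact: bigcup_measurable.
  split=> // eps eps0; have e2 : 0 < eps / 2 by rewrite divr_gt0.
  pose B (n : nat) : set Xi := \bigcup_(i < n) A i.
  have mB n : measurable (B n) by exact: bigcup_measurable.
  have aB n : past_approx M (B n).
    elim: n => [|n ih].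
      rewrite /B bigcup_mkord big_ord0 => e e0.
      by exists 0, set0; split=> //; rewrite setDv measure0 lee_fin ltW.
    rewrite /B bigcup_mkord big_ord_recr -bigcup_mkord.
    by apply: past_approxU; [exact: mB|exact: mA|exact: ih|exact: (hA n).2].
  have BW : \bigcup_n B n = \bigcup_n A n.
    apply/seteqP; split=> [f [n _ [i _ Ai]]|f [n _ An]]; first by exists i.
    by exists n.+1 => //; exists n => /=.
  have [|||n hn] := @measure_incr_gt _ _ _ M B (M (\bigcup_n A n) - (eps / 2)%:E)%E.
  + exact: mB.
  + by move=> n m nm f [i /= il Ai]; exists i => //=; exact: leq_trans nm.
  + by rewrite BW -(fineK (fin_num_measure M _ mW)) -EFinB lte_fin ltrBlDr ltrDl.
  have BA : B n `<=` \bigcup_n A n by move=> f [i _ Ai]; exists i.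
  have dB : (M (\bigcup_n A n `\` B n) <= (eps / 2)%:E)%E.
    rewrite measureD//; last by rewrite ltey_eq fin_num_measure.
    rewrite (setIidr BA) leeBlDr ?fin_num_measure// addeC -leeBlDr// ltW//.
  have [t [C [uC h1 h2]]] := aB n _ e2; have [mC _] := uC.
  exists t, C; split=> //.
    rewrite [eps]splitr EFinD; apply: le_trans (leeD dB h1).
    apply: (@le_trans _ _ (M ((\bigcup_n A n `\` B n) `|` (B n `\` C)))).
      apply: le_measure; rewrite ?inE; first exact: measurableD.
      + by apply: measurableU; exact: measurableD.
      + by move=> f [Af nC]; have [Bf|nB] := pselect (B n f); [right|left].
    by apply: measureU2; exact: measurableD.
  apply: (@le_trans _ _ (M (C `\` B n))).
    apply: le_measure; rewrite ?inE; [exact: measurableD|exact: measurableD|].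
    by move=> f [Cf nA]; split=> // /BA.
  by apply: le_trans h2 _; rewrite lee_fin ler_pdivrMr// ler_pMr// ler1n.
Qed.

Lemma shiftn_invariant (S : set Xi) : S = shiftn 1 @^-1` S -> forall h, shiftn h @^-1` S = S.
Proof.
move=> S1; have Sn (n : nat) : shiftn n%:Z @^-1` S = S.
  elim: n => [|n ih]; first by apply/seteqP; split=> f; rewrite /preimage/= shiftn0.
  rewrite -[RHS]ih [in RHS]S1; apply/funext => f; rewrite /preimage/= shiftn_shiftn.
  by rewrite (_ : 1 + n%:Z = n.+1%:Z)//; lia.
move=> h; have [h0|h0] := leP 0 h.
  by rewrite (_ : h = `|h|%N%:Z) ?Sn//; lia.
rewrite -{1}(Sn `|h|%N); have e : `|h|%N%:Z + h = 0 by lia.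
by apply/seteqP; split=> f; rewrite /preimage/= shiftn_shiftn e shiftn0.
Qed.

(** Shifting an approximation moves its time horizon to the prescribed [t]; the errors do not
    change, since both the event and the law are invariant. *)
Lemma approx_invariant (M : probability Xi R) (S : set Xi) t : (forall h S, measurable S -> M (shiftn h @^-1` S) = M S) ->
  measurable S -> S = shiftn 1 @^-1` S -> forall eps, 0 < eps ->
  exists C : set Xi, [/\ up_to t C, (M (S `\` C) <= eps%:E)%E & (M (C `\` S) <= eps%:E)%E].
Proof.
move=> sM mS S1 eps eps0; have [s [C [uC h1 h2]]] := past_approximation M mS eps0.
have [mC _] := uC; have SI := shiftn_invariant S1 (t - s).
exists (shiftn (t - s) @^-1` C); split.
- by have := up_to_shiftn (t - s) uC; rewrite addrC subrK.
- rewrite -SI -[X in M X]/(shiftn (t - s) @^-1` (S `\` C)) sM//.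
  exact: measurableD.
- rewrite -SI -[X in M X]/(shiftn (t - s) @^-1` (C `\` S)) sM//.
  exact: measurableD.
Qed.

(* An invariant event is almost in the past of every time, so conditioning on it keeps the
   transition probabilities. *)
Lemma given_cond_markov (M : probability Xi R) (S : set Xi) (mS : measurable S) : (0 < M S)%E ->
  (forall h S, measurable S -> M (shiftn h @^-1` S) = M S) ->
  S = shiftn 1 @^-1` S -> (forall t, cond_markov P M t) -> forall t, cond_markov P (given M mS) t.
Proof.
move=> S0 sM S1 cM t C A uC mA; have [mC _] := uC.
have mPA := measurable_kernel_at mP t mA.
have mN : measurable (next_in t A : set Xi) by exact: measurable_next_in.
rewrite givenE// integral_given// [LHS]muleC; congr *%E.
pose g (f : Xi) := P (f t).2 (f t).1 A.
have g0 f : (0 <= g f)%E by [].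
have g1 f : (g f <= 1)%E by exact: probability_le1.
have fint D : measurable D -> (\int[M]_(f in D) g f)%E \is a fin_num.
  move=> mD; rewrite ge0_fin_numE; last exact: integral_ge0.
  apply: (@le_lt_trans _ _ (\int[M]_(f in D) cst 1 f)%E).
    by apply: ge0_le_integral => //; exact: measurable_funTS.
  by rewrite integral_cst// mul1e ltey_eq fin_num_measure.
have int_le D D' : measurable D -> measurable D' ->
    (\int[M]_(f in D) g f <= \int[M]_(f in D') g f + M (D `\` D'))%E.
  move=> mD mD'; have mDD := measurableD mD mD'.
  apply: (@le_trans _ _ (\int[M]_(f in D' `|` (D `\` D')) g f)%E).
    apply: ge0_subset_integral => //; first by exact: measurableU.
      exact: measurable_funTS.
    by move=> f Df; have [D'f|nD'] := pselect (D' f); [left|right].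
  rewrite ge0_integral_setU//=; last first.
  - by rewrite disj_set2E setDE setICA setICr setI0.
  - exact: measurable_funTS.
  rewrite leeD2l//.
  apply: (@le_trans _ _ (\int[M]_(f in D `\` D') cst 1 f)%E).
    by apply: ge0_le_integral => //; exact: measurable_funTS.
  by rewrite integral_cst// mul1e.
have M_le D D' : measurable D -> measurable D' -> (M D <= M D' + M (D `\` D'))%E.
  move=> mD mD'; have mDD := measurableD mD mD'.
  apply: (@le_trans _ _ (M (D' `|` (D `\` D')))); last exact: measureU2.
  apply: le_measure; rewrite ?inE//; first exact: measurableU.
  by move=> f Df; have [D'f|nD'] := pselect (D' f); [left|right].
have le_DI B D D' : measurable B -> measurable D -> measurable D' ->
    (M ((B `&` D) `\` (B `&` D')) <= M (D `\` D'))%E.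
  move=> mB mD mD'; apply: le_measure; rewrite ?inE.
  - by apply: measurableD; exact: measurableI.
  - exact: measurableD.
  - by move=> f [[Bf Df] h]; split=> // D'f; exact: h.
have mCN : measurable (C `&` next_in t A) by exact: measurableI.
have mCS : measurable (C `&` S) by exact: measurableI.
have fM D : measurable D -> M D \is a fin_num by exact: fin_num_measure.
have fCNS := fM _ (measurableI _ _ mCN mS).
have key eps : 0 < eps ->
   (M (C `&` next_in t A `&` S) <= \int[M]_(f in C `&` S) g f + eps%:E)%E /\
   (\int[M]_(f in C `&` S) g f <= M (C `&` next_in t A `&` S) + eps%:E)%E.
  move=> eps0; have e2 : 0 < eps / 2 by rewrite divr_gt0.
  have [D [uD h1 h2]] := approx_invariant t sM mS S1 e2; have [mD _] := uD.
  have mCD : measurable (C `&` D) by exact: measurableI.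
  have e : M (C `&` next_in t A `&` D) = (\int[M]_(f in C `&` D) g f)%E.
    by rewrite -cM//; [rewrite setIAC|exact: up_toI].
  have mCND : measurable (C `&` next_in t A `&` D) by exact: measurableI.
  have mCNS : measurable (C `&` next_in t A `&` S) by exact: measurableI.
  split.
    apply: le_trans (M_le _ _ mCNS mCND) _; rewrite e.
    rewrite [eps]splitr EFinD addeA; apply: leeD.
      apply: le_trans (int_le _ _ mCD mCS) _; rewrite leeD2l//.
      exact: le_trans (le_DI _ _ _ mC mD mS) h2.
    exact: le_trans (le_DI _ _ _ mCN mS mD) h1.
  apply: le_trans (int_le _ _ mCS mCD) _; rewrite -e.
  rewrite [eps]splitr EFinD addeA; apply: leeD.
    apply: le_trans (M_le _ _ mCND mCNS) _; rewrite leeD2l//.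
    exact: le_trans (le_DI _ _ _ mCN mD mS) h2.
  exact: le_trans (le_DI _ _ _ mC mS mD) h1.
have h1 := fun eps eps0 => (key eps eps0).1.
have h2 := fun eps eps0 => (key eps eps0).2.
have fCS := fint _ mCS.
apply/eqP; rewrite eq_le; apply/andP; split; exact: le_eps_eq.
Qed.

Hypothesis unique : forall M M' : probability Xi R, env_law mu M -> env_law mu M' ->
  markov mP M -> markov mP M' -> tight p V M -> tight p V M' ->
  forall S, measurable S -> M S = M' S.

Lemma stationary_markov_ergodic (M : probability Xi R) :
  (forall S, measurable S -> S = shiftn 1 @^-1` S -> mu S = 0%E \/ mu S = 1%E) ->
  env_law mu M -> markov mP M ->
  (forall h S, measurable S -> M (shiftn h @^-1` S) = M S) ->
  forall S, measurable S -> S = shiftn 1 @^-1` S -> M S = 0%E \/ M S = 1%E.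
Proof.
move=> erg eM mM sM S mS S1; have [S0|S0] := eqVneq (M S) 0%E; [by left|right].
have S_gt0 : (0 < M S)%E by rewrite lt0e S0/=.
pose N := given M mS.
have sN h A : measurable A -> N (shiftn h @^-1` A) = N A.
  move=> mA; rewrite /N !givenE// -{1}(shiftn_invariant S1 h) -preimage_setI sM//.
  exact: measurableI.
have mN : markov mP N.
  move=> t; apply: cond_markovP; apply: given_cond_markov => // s.
  exact: markov_cond (mM s).
pose nu := image_prob N (measurable_env (E := E) (F := F)).
have eN : env_law mu N.
  move=> A mA; rewrite -[LHS]/(nu A); apply: (ergodic_extremal minv _ _ erg) => //.
    move=> h B mB; apply: (sN h (@env _ _ E F @^-1` B)).
    by rewrite -[X in measurable X]setTI; exact: (measurable_env measurableT mB).
  move=> B mB B0; apply/eqP; rewrite eq_le measure_ge0 andbT.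
  have mEB : measurable (@env _ _ E F @^-1` B).
    by rewrite -[X in measurable X]setTI; exact: (measurable_env measurableT mB).
  rewrite -[X in (X <= _)%E]/(N (@env _ _ E F @^-1` B)) /N givenE//.
  have -> : M (@env _ _ E F @^-1` B `&` S) = 0%E.
    apply/eqP; rewrite eq_le measure_ge0 andbT -B0 -eM//.
    by apply: le_measure; rewrite ?inE//; exact: measurableI.
  by rewrite mul0e.
have <- : N S = 1%E.
  by rewrite givenE// setIid -[X in (X * _)%E](fineK (fin_num_measure M _ mS)) -EFinM mulfV//
     fine_eq0 ?fin_num_measure.
by apply: unique => //; exact: stationary_tight.
Qed.

End ergodicity.

(** * Polish spaces *)

(* A point of a Polish space is coded by the bits [(n, k)] telling whether it lies in the interior
   of the ball of radius [2^-n] around the [k]th point of a dense sequence. *)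
Section polish_codable.
Context (R : realType) (E : completePseudoMetricType R).
Hypothesis hausE : hausdorff_space E.
Variable u : nat -> E.
Hypothesis u_dense : forall (y : E) (e : R), 0 < e -> exists k, ball (u k) e y.
Local Notation BE := (borel E).

Let e (n : nat) : R := 2^-1 ^+ n.

Let e0 n : 0 < e n. Proof. by rewrite exprn_gt0. Qed.

Let eS n : e n = e n.+1 + e n.+1.
Proof. by rewrite /e exprS -mulrDl [X in X * _](_ : _ = 1) ?mul1r//; lra. Qed.

Let e_le n m : (n <= m)%N -> e m <= e n.
Proof. by move=> nm; apply: ler_wiXn2l => //; rewrite invr_le1 ?ler1n ?unitfE. Qed.

Let e_lt a : 0 < a -> exists n, e n < a.
Proof.
move=> a0; have h : (e n @[n --> \oo] --> (0 : R)).
  by apply: cvg_expr; rewrite ger0_norm// invf_lt1// ltr1n.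
have /cvgrPdist_lt/(_ _ a0)[n _ hn] := h; exists n.
by have := hn n (leqnn n); rewrite sub0r normrN ger0_norm// ltW.
Qed.

Let code (y : BE) : path bool := fun t =>
  if t is Posz m then
    if unpickle m is Some (n, k) then `[< interior (ball (u k) (e n)) (y : E) >] else false
  else false.

Let bit (c : path bool) (n k : nat) : bool := c (Posz (pickle (n, k))).

Let bit_code y n k : bit (code y) n k = `[< interior (ball (u k) (e n)) y >].
Proof. by rewrite /bit /code pickleK. Qed.

Let first n k : set (path bool) := [set c | bit c n k /\ forall j, (j < k)%N -> ~ bit c n j].

(** A countable condition, hence measurable, that every code of a point satisfies. Its selected
    centres lie within [e n] and [e m <= e n] of the point, whence the radius [2 e n]; such centres
    form a Cauchy sequence, and one more [e n] reaches the limit in [near_all]. *)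
Let valid : set (path bool) := [set c |
  (forall n, exists k, first n k c) /\
  (forall n m k l, (n <= m)%N -> first n k c -> first m l c -> ball (u k) (e n + e n) (u l))].

Let near_all (c : path bool) : set BE :=
  [set y | forall n k, first n k c -> ball (u k) (e n + e n + e n) (y : E)].

Let decode (c : path bool) : BE := if `[< valid c >] then xget point (near_all c) else point.

Let valid_near c : valid c -> exists y, near_all c y.
Proof.
move=> [h1 h2]; pose k n := projT1 (cid (h1 n)).
have hk n : first n (k n) c by rewrite /k; case: cid.
pose x n : E := u (k n).
have hx n m : (n <= m)%N -> ball (x n) (e n + e n) (x m) by move=> nm; exact: (h2 n m).
have cx : cvg (x n @[n --> \oo]).
  apply: cauchy_cvg; apply: cauchy_exP => eps eps0.
  have [n hn] : exists n, e n < eps / 2 by apply: e_lt; rewrite divr_gt0.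
  exists (x n); exists n => // m /= nm; apply: le_ball (hx _ _ nm).
  by rewrite [eps]splitr lerD ?ltW.
exists (lim (x n @[n --> \oo])) => n l hl.
have /cvg_ballP/(_ _ (e0 n))[N _ hN] := cx.
pose m := maxn n N.
apply: (@ball_triangle _ _ (x m)); first by apply: h2 hl (hk m); exact: leq_maxl.
by apply: ball_sym; apply: hN; rewrite /= leq_maxr.
Qed.

Let decode_near c : valid c -> near_all c (decode c).
Proof.
move=> vc; rewrite /decode asboolT//; have [y hy] := valid_near vc.
exact: (@xgetPex _ _ (near_all c) (ex_intro _ y hy)).
Qed.

Let first_exists c n k : bit c n k -> exists k', first n k' c.
Proof.
move=> b; have ex : exists k, bit c n k by exists k.
exists (ex_minn ex); case: ex_minnP => m bm hm; split=> // j jm bj.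
by have := hm _ bj; rewrite leqNgt jm.
Qed.

Let valid_code y : valid (code y).
Proof.
split=> [n|n m k l nm [bk _] [bl _]].
  have [k hk] := u_dense y (e0 n.+1).
  apply: (@first_exists _ _ k); rewrite bit_code; apply/asboolP.
  apply/nbhs_ballP; exists (e n.+1) => /=; first exact: e0.
  by move=> z hz; rewrite eS; apply: ball_triangle hz.
move: bk bl; rewrite !bit_code => /asboolP/interior_subset bk /asboolP/interior_subset bl.
apply: (ball_triangle bk); apply: ball_sym; exact: le_ball (e_le nm) _ bl.
Qed.

Let codeK : cancel code decode.
Proof.
move=> y; have vy := valid_code y; have ny := decode_near vy.
have [h1 _] := vy; pose k n := projT1 (cid (h1 n)).
have hk n : first n (k n) (code y) by rewrite /k; case: cid.
have lim_ z : (forall n, ball (u (k n)) (e n + e n + e n) z) -> u (k n) @[n --> \oo] --> z.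
  move=> hz; apply/cvg_ballP => eps eps0.
  have [n hn] : exists n, e n < eps / 3 by apply: e_lt; rewrite divr_gt0.
  exists n => // m /= nm; apply: ball_sym; apply: le_ball (hz m).
  by have := e_le nm; lra.
apply: (cvg_unique hausE (F := u (k n) @[n --> \oo])).
  by apply: lim_ => n; exact: ny.
apply: lim_ => n; have [+ _] := hk n; rewrite bit_code => /asboolP/interior_subset.
by apply: le_ball; have := e0 n; lra.
Qed.

Let measurable_code : measurable_fun setT code.
Proof.
apply: measurable_pathP => -[m|m]; last exact: measurable_cst.
rewrite /code; case: (unpickle m) => [[n k]|]; last exact: measurable_cst.
apply: (measurable_fun_bool true); rewrite setTI; apply: sub_sigma_algebra.
rewrite (_ : _ @^-1` _ = interior (ball (u k) (e n))); first exact: open_interior.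
by apply/seteqP; split => y /=; rewrite /preimage/= => /asboolP.
Qed.

Let measurable_bit n k : measurable [set c | bit c n k].
Proof.
have mc : measurable_fun setT (fun c : path bool => bit c n k) by exact: measurable_coord.
by have := mc measurableT [set true] I; rewrite setTI.
Qed.

Let measurable_first n k : measurable (first n k).
Proof.
rewrite (_ : first n k = [set c | bit c n k] `&` \bigcap_(j < k) ~` [set c | bit c n j]).
  by apply: measurableI => //; apply: bigcap_measurableType => j _; exact: measurableC.
by apply/seteqP; split => c [h1 h2]; split.
Qed.

Let measurable_valid : measurable valid.
Proof.
rewrite (_ : valid = (\bigcap_n \bigcup_k first n k) `&` \bigcap_n \bigcap_m \bigcap_k \bigcap_l
   (if `[< (n <= m)%N -> ball (u k) (e n + e n) (u l) >] then setT
    else ~` (first n k `&` first m l))).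
  apply: measurableI.
    by apply: bigcapT_measurable => n; exact: bigcup_measurable.
  apply: bigcapT_measurable => n; apply: bigcapT_measurable => m.
  apply: bigcapT_measurable => k; apply: bigcapT_measurable => l.
  by case: ifP => // _; apply: measurableC; exact: measurableI.
apply/seteqP; split => c [h1 h2]; split.
- by move=> n _; have [k hk] := h1 n; exists k.
- move=> n _ m _ k _ l _; case: ifPn => // /asboolPn h [f1 f2].
  by apply: h => nm; exact: h2 nm f1 f2.
- by move=> n; have [k _ hk] := h1 n I; exists k.
- move=> n m k l nm f1 f2; move: (h2 n I m I k I l I); case: ifPn => [/asboolP h _|_ h].
    exact: h.
  by exfalso; apply: h.
Qed.

(** Writes the preimage of an open set as a countable union of events on bits. The decoded point is
    within [3 e n] of the selected centre, hence in the ball of radius [4 e n]. *)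
Let decode_open c (U : set E) : valid c -> open U ->
  U (decode c) <-> exists n k, first n k c /\ ball (u k) (e n + e n + e n + e n) `<=` U.
Proof.
move=> vc oU; have ny := decode_near vc; split; last first.
  move=> [n [k [f hU]]]; apply: hU; apply: le_ball (ny _ _ f).
  by have := e0 n; lra.
move=> Uy; have /nbhs_ballP[r /= r0 hr] := open_nbhs_nbhs (conj oU Uy).
(* The 7 is 3 + 4: from the decoded point to the centre, then from the centre to [z]. *)
have [n hn] : exists n, e n < r / 7 by apply: e_lt; rewrite divr_gt0.
have [h1 _] := vc; have [k hk] := h1 n; exists n, k; split=> // z hz.
apply: hr; have := ball_triangle (ball_sym (ny _ _ hk)) hz.
by apply: le_ball; lra.
Qed.

Let measurable_decode : measurable_fun setT decode.
Proof.
apply: (@measurability _ _ _ _ setT decode (@open E)) => // _ [U oU <-]; rewrite setTI.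
rewrite (_ : _ @^-1` _ = (valid `&` \bigcup_n \bigcup_k
   (if `[< ball (u k) (e n + e n + e n + e n) `<=` U >] then first n k else set0)) `|`
   (~` valid `&` if `[< U point >] then setT else set0)).
  apply: measurableU; apply: measurableI => //.
  - apply: bigcup_measurable => n _; apply: bigcup_measurable => k _; by case: ifP.
  - exact: measurableC.
  - by case: ifP.
apply/seteqP; split => c.
  rewrite /preimage/= => Uc; have [vc|nvc] := pselect (valid c); [left|right]; split=> //.
    have [n [k [f h]]] := (decode_open vc oU).1 Uc.
    by exists n => //; exists k => //; rewrite asboolT.
  by move: Uc; rewrite /decode asboolF// => Up; rewrite asboolT.
move=> [[vc [n _ [k _]]]|[nvc]]; case: ifPn => // /asboolP h.
  by move=> f; apply/(decode_open vc oU); exists n, k.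
by rewrite /preimage/= /decode asboolF.
Qed.

Lemma codable_dense_seq : codable BE.
Proof. by exists code, decode; split; [exact: measurable_code|exact: measurable_decode|exact: codeK]. Qed.

End polish_codable.

Lemma polish_codable (R : realType) (E : completePseudoMetricType R) :
  polish E -> codable (borel E).
Proof.
move=> [hE [D [/countable_injP[f injf] dD]]].
pose u k : E := xget point [set x | D x /\ f x = k].
apply: (@codable_dense_seq _ _ hE u) => y r r0.
have [] := dD (interior (ball y r)) _ (@open_interior _ _).
  by exists y; exact: nbhsx_ballx.
move=> x [/interior_subset yx Dx]; exists (f x).
have : [set z | D z /\ f z = f x] (u (f x)).
  by apply: (@xgetPex _ point [set z | D z /\ f z = f x]); exists x.
move=> [Du fu]; have -> : u (f x) = x by apply: injf; rewrite ?inE.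
exact: ball_sym.
Qed.

(** * Solutions and laws on paths *)

Section image_law.
Context (R : realType) d1 d2 (T1 : measurableType d1) (T2 : measurableType d2).
Variables (M : probability T1 R) (f : T1 -> T2) (mf : measurable_fun setT f).

Lemma ae_image_prob (Q : T2 -> Prop) : {ae image_prob M mf, forall x, Q x} ->
  {ae M, forall w, Q (f w)}.
Proof.
move=> [N [mN N0 QN]]; exists (f @^-1` N); split=> //.
  by rewrite -[X in measurable X]setTI; exact: mf.
by move=> w /= nQ; apply: QN.
Qed.

End image_law.

Lemma probability_ae d (T : measurableType d) (R : realType) (M : probability T R) (A : set T) :
  measurable A -> {ae M, forall w, A w} -> M A = 1%E.
Proof.
move=> mA aeA; have : M (~` A) = 0%E by apply: measure_negligible => //; exact: measurableC.
rewrite probability_setC// => /eqP; rewrite -(fineK (fin_num_measure M _ mA)).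
by rewrite -EFinB eqe subr_eq0 => /eqP <-.
Qed.

(** * The environment as a law on paths *)

Section lags.
Context d (F : measurableType d) (p : nat).

(** Most recent state first, the order in which [lam], [b] and [eta] take their arguments; [seg]
    lists the same states in the order in which the kernels act. *)
Definition lag (x : path F) : p.-tuple F := [tuple x (p%:Z - 1 - i%:Z) | i < p].

Lemma measurable_lag : measurable_fun setT lag.
Proof.
apply/measurable_fun_tnthP => i.
rewrite (_ : _ \o _ = fun x : path F => x (p%:Z - 1 - i%:Z)); first exact: measurable_coord.
by apply/funext => x; rewrite /= tnth_mktuple.
Qed.

Lemma lag_shiftn h x : lag (shiftn h x) = [tuple x (p%:Z - 1 - i%:Z + h) | i < p].
Proof. by []. Qed.

Lemma size_seg (x : path F) s n : size (seg x s n) = n.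
Proof. by elim: n s => //= n ih s; rewrite ih. Qed.

Lemma nth_seg a (x : path F) s n i : (i < n)%N -> nth a (seg x s n) i = x (s + i%:Z).
Proof.
elim: n s i => //= n ih s [|i] lin; first by rewrite addr0.
by rewrite /= ih// -addrA.
Qed.

Lemma seg_lag (x : path F) : seg x 0 p = rev_tuple (lag x).
Proof.
apply: (@eq_from_nth _ point) => [|i]; rewrite size_seg ?size_tuple// => lip.
rewrite nth_seg//= nth_rev size_map size_enum_ord//.
have lj : (p - i.+1 < p)%N by lia.
rewrite -[(p - i.+1)%N]/(nat_of_ord (Ordinal lj)) (nth_map (Ordinal lj)) ?size_enum_ord// nth_ord_enum/=.
by congr x; lia.
Qed.

End lags.

Section environment.
Context (R : realType) dF (F : measurableType dF).
Context d0 (Om : measurableType d0) (Pr : probability Om R) (X : int -> Om -> F).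
Hypotheses (mX : measurable_process X) (sX : stationary Pr X).
Variables (p : nat) (lam b : p.-tuple F -> R).
Hypotheses (mlam : measurable_fun setT lam) (lam0 : forall x, 0 < lam x)
  (mb : measurable_fun setT b) (b0 : forall x, 0 < b x).
Hypothesis hbint : (\int[Pr]_w (logp (b [tuple X (p%:Z - i%:Z) w | i < p]))%:E < +oo)%E.
Hypothesis hcontr : {ae Pr, forall w,
     (limn_esup (fun n : nat =>
        ((\prod_(k < n)
            lam [tuple X (- 1 - (k * p)%:Z - i%:Z) w | i < p]) `^ (n%:R^-1))%:E)
      < 1)%E}.

Lemma measurable_path_of : measurable_fun setT (path_of X : Om -> path F).
Proof. by apply: measurable_pathP => t; exact: mX. Qed.

Definition path_law : probability (path F) R := image_prob Pr measurable_path_of.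

Lemma path_law_shiftn h S : measurable S -> path_law (shiftn h @^-1` S) = path_law S.
Proof. by move=> mS; exact: (sX h mS). Qed.

Definition driftL (x : path F) : R := lam (lag p x).
(** Raising [b] to at least 1 preserves the drift inequality, makes the logarithm equal to [logp b],
    and provides the bound [B >= 1] that dominates products by sums. *)
Definition driftB (x : path F) : R := Num.max (b (lag p x)) 1.

Lemma measurable_driftL : measurable_fun setT driftL.
Proof. exact: (measurableT_comp mlam (@measurable_lag _ F p)). Qed.

Lemma measurable_driftB : measurable_fun setT driftB.
Proof.
by apply: measurable_maxr => //; exact: (measurableT_comp mb (@measurable_lag _ F p)).
Qed.

Lemma driftB_ge1 x : 1 <= driftB x.
Proof. by rewrite /driftB le_max lexx orbT. Qed.

(** The hypothesis is about [X_p, ..., X_1], whereas [lag] reads [X_{p-1}, ..., X_0]; stationarity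
    absorbs the shift by one. *)
Lemma ln_driftB_integral : (\int[path_law]_x (ln (driftB x))%:E < +oo)%E.
Proof.
have mln : measurable_fun setT (fun x : path F => (ln (driftB x))%:E).
  by apply/measurable_EFinP; exact: (measurableT_comp (@measurable_ln R) measurable_driftB).
have ln0 x : (0 <= (ln (driftB x))%:E)%E by rewrite lee_fin ln_ge0// driftB_ge1.
have m1 := measurable_shiftn (T := F) 1.
have e : (\int[path_law]_x (ln (driftB x))%:E = \int[image_prob path_law m1]_x (ln (driftB x))%:E)%E.
  by apply: eq_measure_integral => A mA _; rewrite -[LHS](path_law_shiftn 1 mA).
rewrite e (integral_image _ _ mln ln0).
have m2 : measurable_fun setT (fun x : path F => (ln (driftB (shiftn 1 x)))%:E).
  exact: (measurableT_comp mln m1).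
rewrite /path_law (integral_image Pr measurable_path_of m2 (fun x => ln0 (shiftn 1 x))).
move: hbint; congr (_ < _)%E; apply: eq_integral => w _; congr EFin.
rewrite /driftB lag_shiftn /logp; congr (ln (Num.max (b _) _)).
by apply: eq_from_tnth => i; rewrite !tnth_mktuple; congr X; lia.
Qed.

Lemma drift_summable :
  path_law (\bigcup_(i : nat) [set x | forall k, sumB p driftL driftB x 0 k <= i%:R]) = 1%E.
Proof.
set W := \bigcup_(i in _) _.
have mW : measurable W.
  apply: bigcup_measurable => i _.
  rewrite (_ : mkset _ = \bigcap_k [set x | sumB p driftL driftB x 0 k <= i%:R]).
    apply: bigcapT_measurable => k; apply: measurable_set_le => //.
    by apply: measurable_sumB; [exact: measurable_driftL|exact: measurable_driftB].
  by apply/seteqP; split=> [x h k _|x h k]; exact: h.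
have mln : measurable_fun setT (fun x : path F => ln (driftB x)).
  exact: (measurableT_comp (@measurable_ln R) measurable_driftB).
(* Sublinearity is almost sure for each fixed slope; the slopes [1 / (m + 1)] yield a single null
   set that serves for all. *)
have sub : {ae path_law, forall x, forall m : nat, exists N, forall n, (N <= n)%N ->
    ln (driftB (before p n.+1 x)) <= m.+1%:R^-1 * n.+1%:R}.
  apply: ae_foralln => m.
  apply: (stationary_sublinear path_law_shiftn p (xi := fun x => ln (driftB x))) => //.
  - by move=> x; rewrite ln_ge0// driftB_ge1.
  - exact: ln_driftB_integral.
have {}sub := ae_image_prob sub.
suff h : {ae Pr, forall w, (path_of X @^-1` W) w}.
  apply: (probability_ae (M := Pr) _ h).
  by rewrite -[X in measurable X]setTI; exact: (measurable_path_of measurableT mW).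
move: sub hcontr; apply: filterS2 => w hsub hc.
have [|||delta d0'|i hi] := @summable_of_root_test R (fun n => prodL p driftL (path_of X w) 0 n)
    (fun n => driftB (before p n.+1 (path_of X w))).
- by move=> n; apply: prodr_gt0 => i _; exact: lam0.
- by move=> n; exact: driftB_ge1.
- rewrite (_ : (fun n => _) = (fun n : nat => ((\prod_(k < n)
    lam [tuple X (- 1 - (k * p)%:Z - i%:Z) w | i < p]) `^ (n%:R^-1))%:E)); first exact: hc.
  (* [before p k.+1] places the lags of block [k] at the times [-1 - kp - i] of the contraction
     condition. *)
  apply/funext => n; congr EFin; congr powR; apply: eq_bigr => k _; congr lam.
  apply: eq_from_tnth => i; rewrite !tnth_mktuple /before/shiftn/path_of; congr X.
  by rewrite add0n mulSn PoszD; lia.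
- have [m hm] : exists m : nat, m.+1%:R^-1 <= delta.
    exists (Num.bound delta^-1); rewrite invf_ple ?posrE//.
    have := archi_boundP (ltW (_ : 0 < delta^-1)); rewrite invr_gt0 => /(_ d0') h.
    by apply: ltW; apply: lt_trans h _; rewrite ltr_nat.
  have [N hN] := hsub m; exists N => n Nn; apply: le_trans (hN _ Nn) _.
  by rewrite ler_wpM2r.
by exists i => // k; exact: hi.
Qed.

End environment.

Section solutions.
Context (R : realType) dE dF (E : measurableType dE) (F : measurableType dF)
  (P : F -> E -> probability E R).
Hypothesis mP : forall A, measurable A ->
  measurable_fun setT (fun xy : F * E => P xy.1 xy.2 A).
Context d0 (Om0 : measurableType d0) (P0 : probability Om0 R) (X0 : int -> Om0 -> F).
Hypothesis mX0 : measurable_process X0.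
Local Notation Xi := (path (E * F)%type).
Local Notation mu := (path_law P0 mX0).

Section past_filtration.
Context d (Om : measurableType d) (Y : int -> Om -> E) (X : int -> Om -> F) (t : int).

Definition past_gen : set (set Om) :=
  [set S | (exists s B, measurable B /\ S = X s @^-1` B) \/
           (exists s A, (s < t)%R /\ measurable A /\ S = Y s @^-1` A)].

Local Notation Past := (g_sigma_algebraType past_gen).

Lemma past_measurable_X s : measurable_fun setT (X s : Past -> F).
Proof. by move=> _ A mA; rewrite setTI; apply: sub_gen_smallest; left; exists s, A. Qed.

Lemma past_measurable_Y s : s < t -> measurable_fun setT (Y s : Past -> E).
Proof. by move=> st _ A mA; rewrite setTI; apply: sub_gen_smallest; right; exists s, A. Qed.

(** [C] does not change when the path is first erased beyond [t - 1], and every coordinate of the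
    erased path is measurable for the past sigma-algebra. *)
Lemma past_sigma_up_to (C : set Xi) : up_to (t - 1) C ->
  past_sigma Y X t ((fun w => (fun s => (Y s w, X s w)) : Xi) @^-1` C).
Proof.
move=> [mC <-]; pose g (w : Past) : Xi := restr (upto (t - 1)) (fun s => (Y s w, X s w)).
have mg : measurable_fun setT g.
  apply: measurable_pathP => s; rewrite /g /restr /upto.
  have [st|_] := boolP (s <= t - 1); apply/measurable_fun_pair => /=.
  - by apply: past_measurable_Y; lia.
  - exact: past_measurable_X.
  - exact: measurable_cst.
  - exact: past_measurable_X.
by have := mg measurableT _ mC; rewrite setTI.
Qed.

End past_filtration.

(** Converse inclusion on the path space: the events of [up_to (t - 1)] form a sigma-algebra that
    contains the generators of the past. *)
Lemma past_sigma_coord t (S : set Xi) :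
  past_sigma (fun t (f : Xi) => (f t).1) (fun t (f : Xi) => (f t).2) t S -> up_to (t - 1) S.
Proof.
move: S; apply: smallest_sub.
  split=> [|S [mS DS]|A hA].
  - by split.
  - by rewrite setTD; split; [exact: measurableC|rewrite -[in RHS]DS].
  - split; first by apply: bigcup_measurable => n _; have [] := hA n.
    rewrite preimage_bigcup; apply: eq_bigcup => // n _; by have [] := hA n.
move=> S [[s [B [mB ->]]]|[s [A [st [mA ->]]]]]; first exact: up_to_snd.
by apply: up_to_fst => //; lia.
Qed.

Lemma solution_of_law (M : probability Xi R) : env_law mu M -> markov mP M ->
  (forall h S, measurable S -> M (shiftn h @^-1` S) = M S) ->
  solution P P0 X0 M (fun t (f : Xi) => (f t).1) (fun t (f : Xi) => (f t).2).
Proof.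
move=> eM mM sM; split.
- by move=> t; exact: (measurableT_comp measurable_fst (measurable_coord t)).
- by move=> t; exact: (measurableT_comp measurable_snd (measurable_coord t)).
- move=> h S mS; have e h' : (fun (f : Xi) t => ((f (t + h')).1, (f (t + h')).2)) = shiftn h'.
    by apply/funext => f; apply/funext => t; rewrite -surjective_pairing.
  rewrite e sM//; congr (M _); apply/seteqP; split=> f; rewrite /preimage/= /path_of;
  by rewrite (_ : (fun t => _) = f)//; apply/funext => t; rewrite -surjective_pairing.
- by move=> S mS; rewrite -[RHS]/(mu S) -eM.
move=> t A mA; split=> [U mU|S /past_sigma_coord uS].
  pose Y t (f : Xi) := (f t).1; pose X t (f : Xi) := (f t).2.
  have mXY : measurable_fun setT
      (fun f : g_sigma_algebraType (past_gen Y X t) => (X (t - 1) f, Y (t - 1) f)).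
    apply/measurable_fun_pair => /=; first exact: past_measurable_X.
    by apply: past_measurable_Y; lia.
  have := measurableT_comp (mP mA) mXY measurableT mU; rewrite setTI; exact.
rewrite setIC -(markov_cond (mM (t - 1)) uS mA).
by congr (M (_ `&` _)); apply/funext => f; rewrite /next_in/= subrK.
Qed.

Section law_of_solution.
Context d (Om : measurableType d) (M : probability Om R).
Variables (Y : int -> Om -> E) (X : int -> Om -> F).
Hypothesis sol : solution P P0 X0 M Y X.
Local Notation Z := (fun t w => (Y t w, X t w)).

Lemma solution_measurable : measurable_process Z.
Proof. by have [mY mX _ _ _] := sol; move=> t; apply/measurable_fun_pair. Qed.

Local Notation law := (path_law M solution_measurable).

Lemma solution_shiftn h (S : set Xi) : measurable S -> law (shiftn h @^-1` S) = law S.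
Proof. by have [_ _ sZ _ _] := sol; exact: path_law_shiftn. Qed.

Lemma solution_env_law : env_law mu law.
Proof. by have [_ _ _ eX _] := sol; move=> A mA; exact: (eX A mA). Qed.

Lemma solution_markov : markov mP law.
Proof.
have [_ _ _ _ cZ] := sol; move=> t; apply: cond_markovP => C A uC mA; have [mC _] := uC.
have [_ hC] := cZ (t + 1) A mA.
have pC : past_sigma Y X (t + 1) (path_of Z @^-1` C).
  by apply: past_sigma_up_to; rewrite addrK.
have mpC : measurable (path_of Z @^-1` C).
  rewrite -[X in measurable X]setTI.
  exact: (measurable_path_of solution_measurable measurableT mC).
have e := hC _ pC; rewrite addrK in e.
rewrite -[LHS]/(M (path_of Z @^-1` C `&` Y (t + 1) @^-1` A)) setIC -e.
rewrite -[RHS]integral_indic_mul//.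
pose G (f : Xi) := ((\1_C f)%:E * P (f t).2 (f t).1 A)%E : \bar R.
have mG : measurable_fun setT G.
  apply: emeasurable_funM; last exact: measurable_kernel_at.
  exact/measurable_EFinP/measurable_indic.
have G0 f : (0 <= G f)%E by rewrite mule_ge0// lee_fin.
rewrite -[RHS]/(\int[law]_f G f)%E /path_law (integral_image _ _ mG G0).
rewrite [LHS]integral_mkcond; apply: eq_integral => w _.
by rewrite epatch_indic muleC.
Qed.

End law_of_solution.

End solutions.

Section laws_on_paths.
Context (R : realType) dE dF (E : measurableType dE) (F : measurableType dF)
  (P : F -> E -> probability E R).
Hypothesis mP : forall A, measurable A ->
  measurable_fun setT (fun xy : F * E => P xy.1 xy.2 A).
Hypotheses (codE : codable E) (codF : codable F).
Context d0 (Om : measurableType d0) (Pr : probability Om R) (X : int -> Om -> F).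
Hypotheses (mX : measurable_process X) (sX : stationary Pr X).
Variables (p : nat) (V : E -> R).
Hypotheses (p_gt0 : (0 < p)%N) (mV : measurable_fun setT V) (V0 : forall y, 0 <= V y).
Local Notation mu := (path_law Pr mX).
Local Notation Xi := (path (E * F)%type).
Hypothesis forget : forall K eps : R, 0 < eps -> exists N (A : set (path F)),
  [/\ measurable A, ((1 - eps)%:E < mu A)%E &
  forall x n v y y', A x -> (N <= n)%N -> measurable_fun setT v ->
    (forall z, 0 <= v z <= 1)%E -> V y <= K -> V y' <= K ->
    `|fine (kiter P (blocks p x 0 n) v y) - fine (kiter P (blocks p x 0 n) v y')| <= eps].
Hypothesis tight_start : forall eps : R, 0 < eps -> exists K : R, exists2 A : set (path F),
  measurable A /\ ((1 - eps)%:E < mu A)%E & forall x k, A x ->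
  (kiter P (blocks p x 0 k) (fun z => (V z)%:E) point <= K%:E)%E.

Let minv h S : measurable S -> mu (shiftn h @^-1` S) = mu S.
Proof. exact: path_law_shiftn. Qed.

Let unique (M M' : probability Xi R) : env_law mu M -> env_law mu M' ->
  markov mP M -> markov mP M' -> tight p V M -> tight p V M' ->
  forall S, measurable S -> M S = M' S.
Proof. exact: (tight_markov_unique p_gt0 mV minv forget). Qed.

Lemma exists_solution : exists M : probability Xi R,
  solution P Pr X M (fun t (f : Xi) => (f t).1) (fun t (f : Xi) => (f t).2).
Proof.
have [M [eM mM tM]] := exists_tight_markov mP p_gt0 mV V0 minv forget tight_start codE codF.
exists M; apply: (solution_of_law eM mM).
exact: (tight_markov_stationary p_gt0 mV V0 minv unique eM mM tM).
Qed.

Lemma solution_unique d1 (Om1 : measurableType d1) (P1 : probability Om1 R)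
  (Y1 : int -> Om1 -> E) (X1 : int -> Om1 -> F)
  d2 (Om2 : measurableType d2) (P2 : probability Om2 R)
  (Y2 : int -> Om2 -> E) (X2 : int -> Om2 -> F) :
  solution P Pr X P1 Y1 X1 -> solution P Pr X P2 Y2 X2 ->
  same_law P1 (fun t w => (Y1 t w, X1 t w)) P2 (fun t w => (Y2 t w, X2 t w)).
Proof.
move=> s1 s2 S mS.
have t1 := stationary_tight p mV V0 (fun h S mS => solution_shiftn s1 h mS).
have t2 := stationary_tight p mV V0 (fun h S mS => solution_shiftn s2 h mS).
exact: (unique (solution_env_law mX s1) (solution_env_law mX s2)
  (solution_markov mP s1) (solution_markov mP s2) t1 t2 mS).
Qed.

Lemma solution_ergodic d1 (Om1 : measurableType d1) (P1 : probability Om1 R)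
  (Y1 : int -> Om1 -> E) (X1 : int -> Om1 -> F) :
  ergodic Pr X -> solution P Pr X P1 Y1 X1 -> ergodic P1 (fun t w => (Y1 t w, X1 t w)).
Proof.
move=> [_ erg] s1; split; first by have [] := s1.
move=> S mS S1; apply: (stationary_markov_ergodic p_gt0 mV V0 minv unique _
  (solution_env_law mX s1) (solution_markov mP s1)
  (fun h S mS => solution_shiftn s1 h mS) mS S1).
by move=> A mA A1; exact: erg.
Qed.

End laws_on_paths.

Theorem theorem2 (R : realType)
  (E F : completePseudoMetricType R) (polE : polish E) (polF : polish F)
  (P : borel F -> borel E -> probability (borel E) R)
  (hPmeas : forall A : set (borel E), measurable A ->
     measurable_fun setT (fun xy : borel F * borel E => P xy.1 xy.2 A))
  (d0 : measure_display) (Om : measurableType d0) (Pr : probability Om R)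
  (X : int -> Om -> borel F) (hXmeas : measurable_process X)
  (hXstat : stationary Pr X)
  (p : nat) (hp : (0 < p)%N)
  (* (A4) *)
  (V : borel E -> R) (lam b : p.-tuple (borel F) -> R)
  (hVmeas : measurable_fun setT V) (hVpos : forall y, 0 < V y)
  (hlammeas : measurable_fun setT lam) (hlampos : forall x, 0 < lam x)
  (hbmeas : measurable_fun setT b) (hbpos : forall x, 0 < b x)
  (hdrift : forall (x : p.-tuple (borel F)) (y : borel E),
     (kiter P x (fun z => (V z)%:E) y
       <= (lam (rev_tuple x) * V y + b (rev_tuple x))%:E)%E)
  (hlamint : (\int[Pr]_w (logp (lam [tuple X (p%:Z - i%:Z) w | i < p]))%:E
               < +oo)%E)
  (hbint : (\int[Pr]_w (logp (b [tuple X (p%:Z - i%:Z) w | i < p]))%:E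
               < +oo)%E)
  (hcontr : {ae Pr, forall w,
     (limn_esup (fun n : nat =>
        ((\prod_(k < n)
            lam [tuple X (- 1 - (k * p)%:Z - i%:Z) w | i < p]) `^ (n%:R^-1))%:E)
      < 1)%E})
  (* (A5) *)
  (eta : R -> p.-tuple (borel F) -> R)
  (hetameas : measurable_fun [set rx : R * p.-tuple (borel F) | 0 < rx.1]
                (fun rx => eta rx.1 rx.2))
  (hetarange : forall r x, 0 < r -> 0 < eta r x < 1)
  (hminor : forall r : R, 0 < r ->
     exists nu : p.-tuple (borel F) -> probability (borel E) R,
       (forall A : set (borel E), measurable A -> measurable_fun setT (fun x => nu x A)) /\
       (forall (x : p.-tuple (borel F)) (y : borel E) (A : set (borel E)),
          measurable A -> V y <= r ->
          ((eta r (rev_tuple x))%:E * nu (rev_tuple x) A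
            <= kiter P x (fun z => (\1_A z)%:E) y)%E)) :
  (* existence *)
  (exists (d : measure_display) (Om' : measurableType d) (Pr' : probability Om' R)
          (Y' : int -> Om' -> borel E) (X' : int -> Om' -> borel F),
     solution P Pr X Pr' Y' X') /\
  (* uniqueness in distribution *)
  (forall (d1 : measure_display) (Om1 : measurableType d1) (P1 : probability Om1 R)
          (Y1 : int -> Om1 -> borel E) (X1 : int -> Om1 -> borel F)
          (d2 : measure_display) (Om2 : measurableType d2) (P2 : probability Om2 R)
          (Y2 : int -> Om2 -> borel E) (X2 : int -> Om2 -> borel F),
     solution P Pr X P1 Y1 X1 -> solution P Pr X P2 Y2 X2 ->
     same_law P1 (fun t w => (Y1 t w, X1 t w)) P2 (fun t w => (Y2 t w, X2 t w))) /\
  (* ergodicity *)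
  (ergodic Pr X ->
   forall (d1 : measure_display) (Om1 : measurableType d1) (P1 : probability Om1 R)
          (Y1 : int -> Om1 -> borel E) (X1 : int -> Om1 -> borel F),
     solution P Pr X P1 Y1 X1 -> ergodic P1 (fun t w => (Y1 t w, X1 t w))).
Proof.
have mu_minor : forall r, 0 < r -> exists e : path (borel F) -> R,
    [/\ measurable_fun setT e, forall x, 0 < e x &
    forall x, exists nu : probability (borel E) R,
    forall y A, measurable A -> V y <= r ->
    ((e x)%:E * nu A <= kiter P (seg x 0 p) (fun z => (\1_A z)%:E) y)%E].
  move=> r r0; exists (fun x => eta r (lag p x)); split.
  (* [eta] is given as measurable on positive levels; for the fixed [r > 0] the slice stays
     there. *)
  - apply: (measurable_comp (F := [set rx : R * p.-tuple (borel F) | 0 < rx.1])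
      (f := fun rx => eta rx.1 rx.2) (g := fun x => (r, lag p x))) => //.
    + rewrite (_ : mkset _ = fst @^-1` `]0, +oo[%classic).
        by rewrite -[X in measurable X]setTI; exact: measurable_fst.
      by apply/seteqP; split=> -[s x]; rewrite /preimage/= in_itv/= andbT.
    + by move=> _ [x _ <-].
    + by apply/measurable_fun_pair => //=; exact: measurable_lag.
  - by move=> x; have /andP[] := hetarange r (lag p x) r0.
  have [nu [_ hnu]] := hminor r r0.
  move=> x; exists (nu (lag p x)) => y A mA Vr.
  have := hnu (rev_tuple (lag p x)) y A mA Vr.
  have -> : rev_tuple (rev_tuple (lag p x)) = lag p x by apply: val_inj; rewrite /= revK.
  by rewrite seg_lag.
have mu_drift x y : (kiter P (seg x 0 p) (fun z => (V z)%:E) y <=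
    (driftL lam x * V y + driftB b x)%:E)%E.
  rewrite seg_lag; apply: le_trans (hdrift _ _) _.
  have -> : rev_tuple (rev_tuple (lag p x)) = lag p x by apply: val_inj; rewrite /= revK.
  by rewrite lee_fin lerD2l /driftB le_max lexx.
have V0 y : 0 <= V y by exact/ltW.
have mL := measurable_driftL hlammeas; have mB := measurable_driftB hbmeas.
have L0 x : 0 < driftL lam x by exact: hlampos.
have fin_sum := drift_summable hXmeas hXstat hlammeas hlampos hbmeas hbint hcontr.
have minv h S : measurable S ->
    path_law Pr hXmeas (shiftn h @^-1` S) = path_law Pr hXmeas S.
  exact: path_law_shiftn.
have hf := forget hPmeas hVmeas V0 mL mB L0 (driftB_ge1 b) mu_drift mu_minor minv fin_sum.
have ht := tight_start hPmeas hVmeas V0 mL mB L0 (driftB_ge1 b) mu_drift fin_sum point.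
have cE := polish_codable polE; have cF := polish_codable polF.
split; last split.
- have [M sM] := exists_solution hPmeas cE cF hXstat hp hVmeas V0 hf ht.
  by eexists; exists (path (borel E * borel F)%type); exists M; do 2 eexists; exact: sM.
- move=> d1 Om1 P1 Y1 X1 d2 Om2 P2 Y2 X2 s1 s2.
  exact: (solution_unique hPmeas hXstat hp hVmeas V0 hf s1 s2).
- move=> erg d1 Om1 P1 Y1 X1 s1.
  exact: (solution_ergodic hPmeas hXstat hp hVmeas V0 hf erg s1).
Qed.
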